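(* Let $0 < a < \frac14$, set $L_a = [-2a,2a]^2 \setminus [-a,a]^2$, and let $0 < \delta < \frac12 \min\{1-4a, a\}$. Let $\psi_\delta\in L^2(\mathbb{R}^2)$ be the function with $\hat{\psi}_\delta = f_{(L_a;\delta,\frac{\delta}{2})}$. Then $\hat{\psi}_\delta \in C_c(\widehat{\mathbb{R}}^2)\setminus C_c^1(\widehat{\mathbb{R}}^2)$, and $\mathcal{W}(\psi_\delta)$ is a Parseval frame for $L^2(\mathbb{R}^2)$.
   Context: Fix a function $\theta \in C^\infty(\mathbb{R})$, real-valued, with $\theta(x)=0$ for $x\le -1$, $\theta(x)=1$ for $x \ge 1$, and $\theta(x)^2+\theta(-x)^2=1$ for all $x\in\mathbb{R}$ (such functions exist). The function $f_{(L_a;\delta,\frac{\delta}{2})}:\mathbb{R}^2\to\mathbb{R}$ is defined by $$f_{(L_a;\delta,\frac{\delta}{2})}(x,y)=\begin{cases} \theta\left(\frac{2a-|y|}{\delta}\right) & |x| \in [0, 2a-\delta],\ |y| \in [2a-\delta,2a+\delta], \\ \theta\left(\frac{4a-|x|-|y|-\delta}{\delta} \right) & |x|,|y| \in [2a - \delta, 2a + \delta],\ 4a-2\delta \leq |x|+|y| \leq 4a,\\ \theta\left(\frac{2a-|x|}{\delta}\right) & |y| \in [0, 2a-\delta],\ |x| \in [2a-\delta,2a+\delta], \\ 1 & (|x|,|y|) \in [0,2a-\delta]^2 \setminus [0,a + \frac{\delta}{2}]^2, \\ 1 & |x|,|y| \in [a - \frac{\delta}{2},a +\frac{\delta}{2}],\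 2a\leq |x|+|y| \leq 2a + \delta, \\ \theta\left(\frac{|y|-a}{\delta/2}\right) & |x| \in [0, a-\frac{\delta}{2}],\ |y| \in [a-\frac{\delta}{2},a+\frac{\delta}{2}], \\ \theta\left(\frac{|x|+|y|-2a +\delta/2}{\delta/2} \right) & |x|,|y| \in [a - \frac{\delta}{2},a +\frac{\delta}{2}],\ 2a -\delta\leq |x|+|y| \leq 2a, \\ \theta\left(\frac{|x|-a}{\delta/2}\right) & |y| \in [0, a-\frac{\delta}{2}],\ |x| \in [a-\frac{\delta}{2},a+\frac{\delta}{2}], \\ 0 & \text{otherwise.} \end{cases}$$ The Fourier transform is $\hat f(\gamma)=\int_{\mathbb{R}^d} f(x)e^{-2\pi i x\cdot\gamma}\,dx$ on $L^1\cap L^2$, extended unitarily to $L^2(\mathbb{R}^d)\to L^2(\widehat{\mathbb{R}}^d)$, where $\widehat{\mathbb{R}}^d$ denotes $\mathbb{R}^d$ as frequency domain. $C_c$ (resp. $C_c^1$) denotes continuous (resp. continuously differentiable) compactly supported functions. For $\psi\in L^2(\mathbb{R}^d)$, the dyadic wavelet system is $\mathcal{W}(\psi)=\{2^{nd/2}\psi(2^n x-k): n\in\mathbb{Z},k\in\mathbb{Z}^d\}$. A family $\{e_j\}_{j\in J}$ in a separable Hilbert space $\mathcal{H}$ is a Parseval frame for $\mathcal{H}$ if $\sum_{j\in J}|\langle f,e_j\rangle|^2=\|f\|^2$ for all $f\in\mathcal{H}$. *)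

(* Defs.v *)
From HB Require Import structures.
From mathcomp Require Export all_boot all_order all_algebra.
From mathcomp Require Export complex.
From mathcomp Require Export all_classical all_reals all_analysis.

Set Implicit Arguments.
Unset Strict Implicit.
Unset Printing Implicit Defensive.

Import Order.TTheory GRing.Theory Num.Theory.
Import numFieldNormedType.Exports.

Local Open Scope classical_set_scope.
Local Open Scope ring_scope.

(* Lebesgue measure on the Borel sets of R^2; every L^2 class for its completion
   has a Borel representative. *)
Definition leb2 (R : realType) :=
  ((@lebesgue_measure R) \x (@lebesgue_measure R))%E.

Section L2.
Context {R : realType}.
Implicit Types f g : R * R -> R[i].

Definition cmeasurable f : Prop :=
  measurable_fun [set: measurableTypeR R * measurableTypeR R]
    (fun p => complex.Re (f p)) /\
  measurable_fun [set: measurableTypeR R * measurableTypeR R]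
    (fun p => complex.Im (f p)).

Definition Lpnorm (p : R) f : \bar R :=
  'N[@leb2 R]_p%:E[EFin \o (fun x => Normc.normc (f x))]%E.

Definition in_Lp (p : R) f : Prop := cmeasurable f /\ (Lpnorm p f < +oo)%E.

Definition cintegral f : R[i] :=
  (Rintegral (@leb2 R) setT (fun x => complex.Re (f x)) +i*
   Rintegral (@leb2 R) setT (fun x => complex.Im (f x)))%C.

Definition inner f g : R[i] := cintegral (fun x => f x * ((g x)^*)%C).

Definition expi (t : R) : R[i] := (cos t +i* sin t)%C.

Definition fourierL1 f (xi : R * R) : R[i] :=
  cintegral (fun x => f x * expi (- (2 * pi * (x.1 * xi.1 + x.2 * xi.2)))).

(* [fourierL2 f g]: g represents the Fourier transform of f in L^2, where the
   transform on L^2 is the closure of the integral transform on L^1 `&` L^2.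
   L^2 elements are represented by functions, so g is determined a.e. only. *)
Definition fourierL2 f g : Prop :=
  [/\ in_Lp 2 f, in_Lp 2 g &
    exists F : nat -> R * R -> R[i],
      [/\ forall n, in_Lp 1 (F n) /\ in_Lp 2 (F n),
          Lpnorm 2 (F n \- f) @[n --> \oo] --> 0%E &
          Lpnorm 2 (fourierL1 (F n) \- g) @[n --> \oo] --> 0%E]].

Definition parseval_frame (J : choiceType) (e : J -> R * R -> R[i]) : Prop :=
  (forall j, in_Lp 2 (e j)) /\
  forall f, in_Lp 2 f ->
    (\esum_(j in [set: J]) ((Normc.normc (inner f (e j))) ^+ 2)%:E =
     Lpnorm 2 f ^+ 2)%E.

(* In dimension d = 2 the normalisation 2 ^ (n d / 2) is 2 ^ n. *)
Definition wavelet_system (psi : R * R -> R[i]) (j : int * (int * int))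
    (x : R * R) : R[i] :=
  let: (n, k) := j in
  ((2 : R) ^ n)%:C%C *
  psi ((2 : R) ^ n * x.1 - k.1%:~R, (2 : R) ^ n * x.2 - k.2%:~R).

End L2.

Section Regularity.
Context {R : realType}.

Definition smooth (u : R -> R) : Prop :=
  forall (n : nat) (x : R), derivable (derive1n n u) x 1.

(* In finite dimension, continuity of p |-> 'd u p amounts to continuity of
   all directional derivatives. *)
Definition C1 (u : R * R -> R) : Prop :=
  (forall p, differentiable u p) /\
  forall v : R * R, continuous (fun p => 'D_v u p).

Definition compact_support (f : R * R -> R[i]) : Prop :=
  compact (closure [set p | f p != 0]).

Definition in_Cc (f : R * R -> R[i]) : Prop :=
  [/\ continuous (fun p => complex.Re (f p)),
      continuous (fun p => complex.Im (f p)) & compact_support f].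

Definition in_Cc1 (f : R * R -> R[i]) : Prop :=
  [/\ C1 (fun p => complex.Re (f p)),
      C1 (fun p => complex.Im (f p)) & compact_support f].

End Regularity.

(* The smoothed indicator of L_a = [-2a, 2a]^2 minus [-a, a]^2, with smoothing
   width delta at the outer boundary and delta / 2 at the inner one. The pieces
   overlap only where their formulas agree, so the order of the tests is
   irrelevant when 0 < delta < a / 2 and theta is the given cut-off. *)
Definition f_La {R : realType} (theta : R -> R) (a delta : R)
    (p : R * R) : R :=
  let x := `|p.1| in let y := `|p.2| in
  if (x \in `[0, 2 * a - delta]) && (y \in `[2 * a - delta, 2 * a + delta])
  then theta ((2 * a - y) / delta)
  else if [&& x \in `[2 * a - delta, 2 * a + delta],
              y \in `[2 * a - delta, 2 * a + delta]
            & 4 * a - 2 * delta <= x + y <= 4 * a]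
  then theta ((4 * a - x - y - delta) / delta)
  else if (y \in `[0, 2 * a - delta]) && (x \in `[2 * a - delta, 2 * a + delta])
  then theta ((2 * a - x) / delta)
  else if ((x \in `[0, 2 * a - delta]) && (y \in `[0, 2 * a - delta])) &&
          ~~ ((x \in `[0, a + delta / 2]) && (y \in `[0, a + delta / 2]))
  then 1
  else if [&& x \in `[a - delta / 2, a + delta / 2],
              y \in `[a - delta / 2, a + delta / 2]
            & 2 * a <= x + y <= 2 * a + delta]
  then 1
  else if (x \in `[0, a - delta / 2]) && (y \in `[a - delta / 2, a + delta / 2])
  then theta ((y - a) / (delta / 2))
  else if [&& x \in `[a - delta / 2, a + delta / 2],
              y \in `[a - delta / 2, a + delta / 2]
            & 2 * a - delta <= x + y <= 2 * a]
  then theta ((x + y - 2 * a + delta / 2) / (delta / 2))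
  else if (y \in `[0, a - delta / 2]) && (x \in `[a - delta / 2, a + delta / 2])
  then theta ((x - a) / (delta / 2))
  else 0.

(* Main.v *)
(* Clamping the coordinates from below by 2a - delta merges the pieces of
   f = f_La into a product f = G N with N^2 = 1 - G(2 .)^2, and G = 1 wherever
   G(2 .) <> 0; hence f^2 = G^2 - G(2 .)^2 and the sum over n of f(2^-n .)^2
   telescopes to 1 away from the origin. Since 2a + delta < 1/2, f is supported
   in the unit square, so for each n Parseval's identity on the torus turns
   the sum over k of |<h, psi_(n,k)>|^2 into the integral of
   |hat h|^2 f(2^-n .)^2; summing over n and using Plancherel gives ||h||^2.
   Parseval on the torus is obtained from the totality of the trigonometric
   system, and Plancherel from it by periodization.

   Two Fourier transforms of psi agree almost everywhere, so one of class C^1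
   would be equal to the continuous f, which has a kink across x = 2a - delta
   because theta' does not vanish identically on ]-1, 1[. *)
Require Import Defs.
From HB Require Import structures.
From mathcomp Require Import ring lra zify measurable_realfun.
Set Implicit Arguments.
Unset Strict Implicit.
Unset Printing Implicit Defensive.
Import Order.TTheory GRing.Theory Num.Theory.
Import numFieldNormedType.Exports.
Local Open Scope classical_set_scope.
Local Open Scope ring_scope.

(** * Square-integrable complex functions on a measure space *)

(** The inner smoothing width is half the outer one because the hole of the annulus is the outer
    profile taken at the doubled point, with theta reflected. The identity theta(t)^2 + theta(-t)^2
    = 1 then makes consecutive dyadic scales match, and delta < a/2 keeps the two transition zones
    apart, since a + delta/2 <= 2a - delta.

    The function psi is known only as an L^2 limit, without a formula. Its inner products with h are
    therefore moved to the frequency side only for h in both L^1 and L^2, where hat h is a genuine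
    integral; Plancherel and Cauchy-Schwarz carry the identity to the limit. General h are reached
    by density. As the wavelet system need not be orthonormal, Bessel's inequality is not automatic
    at that point: it is first shown to survive limits for each finite subfamily, using a Young
    inequality whose leading constant tends to 1. *)

Section ComplexNumbers.
Context {R : realType}.
Implicit Types z w : R[i].

(** A polynomial in the two real coordinates, so that [ring] and [lra] apply where [Normc.normc]
    would bring in a square root. *)
Definition normsq z : R := complex.Re z ^+ 2 + complex.Im z ^+ 2.

Lemma ReD z w : complex.Re (z + w) = complex.Re z + complex.Re w.
Proof. by case: z; case: w. Qed.

Lemma ImD z w : complex.Im (z + w) = complex.Im z + complex.Im w.
Proof. by case: z; case: w. Qed.

Lemma ReB z w : complex.Re (z - w) = complex.Re z - complex.Re w.
Proof. by case: z; case: w. Qed.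

Lemma ImB z w : complex.Im (z - w) = complex.Im z - complex.Im w.
Proof. by case: z; case: w. Qed.

Lemma ReN z : complex.Re (- z) = - complex.Re z.
Proof. by case: z. Qed.

Lemma ImN z : complex.Im (- z) = - complex.Im z.
Proof. by case: z. Qed.

Lemma ReM z w : complex.Re (z * w) =
  complex.Re z * complex.Re w - complex.Im z * complex.Im w.
Proof. by case: z; case: w. Qed.

Lemma ImM z w : complex.Im (z * w) =
  complex.Re z * complex.Im w + complex.Im z * complex.Re w.
Proof. by case: z; case: w. Qed.

Lemma Re_conjc z : complex.Re (z^*)%C = complex.Re z.
Proof. by case: z. Qed.

Lemma Im_conjc z : complex.Im (z^*)%C = - complex.Im z.
Proof. by case: z. Qed.

Lemma Re_realc (x : R) : complex.Re (x%:C)%C = x. Proof. by []. Qed.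

Lemma Im_realc (x : R) : complex.Im (x%:C)%C = 0. Proof. by []. Qed.

Lemma Re1 : complex.Re (1 : R[i]) = 1. Proof. by []. Qed.

Lemma Im1 : complex.Im (1 : R[i]) = 0. Proof. by []. Qed.

Definition ReImE := (ReN, ImN, ReD, ImD, ReB, ImB, ReM, ImM, Re_conjc, Im_conjc).

Lemma Re_complex (a b : R) : complex.Re (a +i* b)%C = a. Proof. by []. Qed.

Lemma Im_complex (a b : R) : complex.Im (a +i* b)%C = b. Proof. by []. Qed.

Lemma Re_expi (t : R) : complex.Re (expi t) = cos t. Proof. by []. Qed.

Lemma Im_expi (t : R) : complex.Im (expi t) = sin t. Proof. by []. Qed.

Definition ReIm_realE := (Re1, Im1, Re_realc, Im_realc, Re_expi, Im_expi,
  Re_complex, Im_complex).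

Lemma complex_ext z w :
  complex.Re z = complex.Re w -> complex.Im z = complex.Im w -> z = w.
Proof. by case: z; case: w => /= ? ? ? ? -> ->. Qed.

Lemma normsq_ge0 z : 0 <= normsq z.
Proof. by rewrite addr_ge0 ?sqr_ge0. Qed.

Lemma normsqM z w : normsq (z * w) = normsq z * normsq w.
Proof. by rewrite /normsq !ReImE; ring. Qed.

Lemma normsq_conj z : normsq (z^*)%C = normsq z.
Proof. by rewrite /normsq !ReImE sqrrN. Qed.

Lemma normsq0 : normsq 0 = 0.
Proof. by rewrite /normsq /= expr0n addr0. Qed.

Lemma normsq_eq0 z : normsq z = 0 -> z = 0.
Proof.
move/eqP; rewrite paddr_eq0 ?sqr_ge0// !sqrf_eq0 => /andP[/eqP a /eqP b].
exact: complex_ext.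
Qed.

Lemma normsqE z : Normc.normc z ^+ 2 = normsq z.
Proof. by case: z => a b; rewrite sqr_sqrtr ?addr_ge0 ?sqr_ge0. Qed.

Lemma normsqC z : z * (z^*)%C = (normsq z)%:C%C.
Proof. by apply: complex_ext; rewrite /normsq !ReImE ?ReIm_realE; ring. Qed.

Lemma conjcM z w : ((z * w)^*)%C = (z^*)%C * (w^*)%C.
Proof. by apply: complex_ext; rewrite !ReImE; ring. Qed.

Lemma normsq_realc (x : R) : normsq x%:C%C = x ^+ 2.
Proof. by rewrite /normsq /= expr0n addr0. Qed.

Lemma normsqD_le z w : normsq (z + w) <= 2 * normsq z + 2 * normsq w.
Proof.
rewrite /normsq !ReImE -subr_ge0.
rewrite (_ : _ - _ = (complex.Re z - complex.Re w) ^+ 2 +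
                     (complex.Im z - complex.Im w) ^+ 2); last by ring.
by rewrite addr_ge0 ?sqr_ge0.
Qed.

(** The arithmetic-geometric mean inequality on the coordinates; it makes products of
    square-integrable functions integrable. *)
Lemma Re_mul_le z w : `|complex.Re (z * w)| <= normsq z + normsq w.
Proof.
case: z => a b; case: w => c d; rewrite /normsq /= ler_norml.
have := sqr_ge0 (a - c); have := sqr_ge0 (a + c).
have := sqr_ge0 (b - d); have := sqr_ge0 (b + d).
have := sqr_ge0 a; have := sqr_ge0 b; have := sqr_ge0 c; have := sqr_ge0 d.
by rewrite !sqrrD !sqrrN !mulrN => *; apply/andP; split; lra.
Qed.

Lemma Im_mul_le z w : `|complex.Im (z * w)| <= normsq z + normsq w.
Proof.
case: z => a b; case: w => c d.
(* The second factor is [- i w], so the real part of this product is the imaginary part of [z w]. *)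
have := Re_mul_le (a +i* b)%C (d -i* c)%C.
by rewrite /normsq /= mulrN opprK sqrrN (addrC (d ^+ 2)).
Qed.

Lemma normsq_expi (t : R) : normsq (expi t) = 1.
Proof. exact: cos2Dsin2. Qed.

Lemma expiD (s t : R) : expi (s + t) = expi s * expi t.
Proof. by apply: complex_ext; rewrite !ReImE /= ?cosD ?sinD //; ring. Qed.

Lemma expi0 : expi (0 : R) = 1.
Proof. by rewrite /expi cos0 sin0. Qed.

Lemma conj_expi (t : R) : ((expi t)^*)%C = expi (- t).
Proof. by rewrite /expi /= cosN sinN. Qed.

End ComplexNumbers.

Section ComplexIntegral.
Context d (T : measurableType d) (R : realType).
Variable m : {measure set T -> \bar R}.
Implicit Types (f g h : T -> R[i]) (c : R[i]).

(** Stated over an arbitrary measure space because the theory is used on the line and on the plane;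
    over [leb2] it unfolds to [cmeasurable], and [cint] to [cintegral]. *)
Definition cmfun f : Prop :=
  measurable_fun [set: T] (fun x => complex.Re (f x)) /\
  measurable_fun [set: T] (fun x => complex.Im (f x)).

Definition cintegrable f : Prop :=
  m.-integrable setT (EFin \o (fun x => complex.Re (f x))) /\
  m.-integrable setT (EFin \o (fun x => complex.Im (f x))).

Definition cint f : R[i] :=
  (Rintegral m setT (fun x => complex.Re (f x)) +i*
   Rintegral m setT (fun x => complex.Im (f x)))%C.

Lemma cmfunD f g : cmfun f -> cmfun g -> cmfun (f \+ g).
Proof.
move=> [rf jf] [rg jg]; split.
  by under eq_fun do rewrite ReD; exact: measurable_funD.
by under eq_fun do rewrite ImD; exact: measurable_funD.
Qed.

Lemma cmfunB f g : cmfun f -> cmfun g -> cmfun (f \- g).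
Proof.
move=> [rf jf] [rg jg]; split.
  by under eq_fun do rewrite ReB; exact: measurable_funB.
by under eq_fun do rewrite ImB; exact: measurable_funB.
Qed.

Lemma cmfunM f g : cmfun f -> cmfun g -> cmfun (f \* g).
Proof.
move=> [rf jf] [rg jg]; split.
  under eq_fun do rewrite ReM.
  by apply: measurable_funB; exact: measurable_funM.
under eq_fun do rewrite ImM.
by apply: measurable_funD; exact: measurable_funM.
Qed.

Lemma cmfun_cst c : cmfun (fun=> c).
Proof. by split; exact: measurable_cst. Qed.

Lemma cmfunZ c f : cmfun f -> cmfun (c \*o f).
Proof. by move=> mf; apply: cmfunM => //; exact: cmfun_cst. Qed.

Lemma cmfun_conj f : cmfun f -> cmfun (fun x => ((f x)^*)%C).
Proof.
move=> [rf jf]; split; first by under eq_fun do rewrite Re_conjc.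
by under eq_fun do rewrite Im_conjc; exact: measurable_funN.
Qed.

Lemma cmfun_normsq f : cmfun f -> measurable_fun setT (fun x => normsq (f x)).
Proof.
by move=> [rf jf]; apply: measurable_funD; exact: measurable_funX.
Qed.

Lemma cmfun_normsqE f : cmfun f ->
  measurable_fun setT (fun x => (normsq (f x))%:E).
Proof. by move=> mf; apply/measurable_EFinP; exact: cmfun_normsq. Qed.

Lemma cmfun_realc (u : T -> R) : measurable_fun setT u ->
  cmfun (fun x => (u x)%:C%C).
Proof. by move=> mu; split => //; exact: measurable_cst. Qed.

Lemma eq_cint f g : f =1 g -> cint f = cint g.
Proof. by move=> /funext ->. Qed.

Lemma cintegrable_cmfun f : cintegrable f -> cmfun f.
Proof.
by move=> [/measurable_int/measurable_EFinP ? /measurable_int/measurable_EFinP].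
Qed.

Lemma cintegrableD f g : cintegrable f -> cintegrable g -> cintegrable (f \+ g).
Proof.
move=> [rf jf] [rg jg]; split.
  rewrite (_ : _ \o _ = (EFin \o (fun x => complex.Re (f x))) \+
    (EFin \o (fun x => complex.Re (g x))))%E; first exact: integrableD.
  by apply/funext => x /=; rewrite ReD.
rewrite (_ : _ \o _ = (EFin \o (fun x => complex.Im (f x))) \+
  (EFin \o (fun x => complex.Im (g x))))%E; first exact: integrableD.
by apply/funext => x /=; rewrite ImD.
Qed.

Lemma integrableZ_EFin (u : T -> R) (k : R) :
  m.-integrable setT (EFin \o u) ->
  m.-integrable setT (EFin \o (fun x => k * u x)).
Proof.
by move=> iu; rewrite (_ : _ \o _ = (fun x => k%:E * (EFin \o u) x))%E //;
  exact: integrableZl.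
Qed.

Lemma integrableB_EFin (u v : T -> R) :
  m.-integrable setT (EFin \o u) -> m.-integrable setT (EFin \o v) ->
  m.-integrable setT (EFin \o (fun x => u x - v x)).
Proof.
move=> iu iv.
by rewrite (_ : _ \o _ = (EFin \o u) \- (EFin \o v))%E //; exact: integrableB.
Qed.

Lemma integrableD_EFin (u v : T -> R) :
  m.-integrable setT (EFin \o u) -> m.-integrable setT (EFin \o v) ->
  m.-integrable setT (EFin \o (fun x => u x + v x)).
Proof.
move=> iu iv.
by rewrite (_ : _ \o _ = (EFin \o u) \+ (EFin \o v))%E //; exact: integrableD.
Qed.

Lemma cintegrableZ c f : cintegrable f -> cintegrable (c \*o f).
Proof.
move=> [rf jf]; split.
  under eq_fun do rewrite ReM.
  by apply: integrableB_EFin; exact: integrableZ_EFin.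
under eq_fun do rewrite ImM.
by apply: integrableD_EFin; exact: integrableZ_EFin.
Qed.

Lemma cintD f g : cintegrable f -> cintegrable g ->
  cint (f \+ g) = cint f + cint g.
Proof.
move=> [rf jf] [rg jg]; apply: complex_ext; rewrite !ReImE /=.
  by rewrite -RintegralD//; apply: eq_Rintegral => x _ /=; rewrite ReD.
by rewrite -RintegralD//; apply: eq_Rintegral => x _ /=; rewrite ImD.
Qed.

Lemma cintZ c f : cintegrable f -> cint (c \*o f) = c * cint f.
Proof.
move=> [rf jf]; apply: complex_ext; rewrite !ReImE /=.
  rewrite -!RintegralZl// -RintegralB//; do ?exact: integrableZ_EFin.
  by apply: eq_Rintegral => x _ /=; rewrite ReM.
rewrite -!RintegralZl// -RintegralD//; do ?exact: integrableZ_EFin.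
by apply: eq_Rintegral => x _ /=; rewrite ImM.
Qed.

Lemma cint_conj f : cintegrable f -> cint (fun x => ((f x)^*)%C) = ((cint f)^*)%C.
Proof.
move=> [rf jf]; apply: complex_ext; rewrite !ReImE /=.
  by under eq_fun do rewrite Re_conjc.
under eq_fun do rewrite Im_conjc -mulN1r.
by rewrite RintegralZl// mulN1r.
Qed.

Lemma cint0 : cint (fun=> 0) = 0.
Proof.
by apply: complex_ext => /=; rewrite /Rintegral integral0.
Qed.

Lemma cintegrable_le f (u : T -> R) : cmfun f ->
  m.-integrable setT (EFin \o u) ->
  (forall x, `|complex.Re (f x)| <= u x) -> (forall x, `|complex.Im (f x)| <= u x) ->
  cintegrable f.
Proof.
move=> [rf jf] iu hr hi; split.
  apply: le_integrable iu => //; first exact/measurable_EFinP.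
  by move=> x _ /=; rewrite lee_fin; exact: le_trans (hr x) (ler_norm _).
apply: le_integrable iu => //; first exact/measurable_EFinP.
by move=> x _ /=; rewrite lee_fin; exact: le_trans (hi x) (ler_norm _).
Qed.

Lemma cint_ae_eq f g : cmfun f -> cmfun g ->
  {ae m, forall x, f x = g x} -> cint f = cint g.
Proof.
move=> [rf jf] [rg jg] fg; congr (_ +i* _)%C; congr fine;
  apply: ae_eq_integral => //; try exact/measurable_EFinP.
  by apply: filterS fg => x + _ => ->.
by apply: filterS fg => x + _ => ->.
Qed.

Definition normsqL2 f : \bar R := (\int[m]_x (normsq (f x))%:E)%E.

Definition L2 f : Prop := cmfun f /\ (normsqL2 f < +oo)%E.

Definition ip f g : R[i] := cint (fun x => f x * ((g x)^*)%C).

(** Real-valued for the sake of arithmetic; [fine] sends an infinite norm to 0, so the value is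
    meaningful under [L2]. *)
Definition n2 f : R := fine (normsqL2 f).

Lemma normsqL2_ge0 f : (0 <= normsqL2 f)%E.
Proof. by apply: integral_ge0 => x _; rewrite lee_fin normsq_ge0. Qed.

Lemma n2_ge0 f : 0 <= n2 f.
Proof. exact/fine_ge0/normsqL2_ge0. Qed.

Lemma n2N f : n2 (-1 \*o f) = n2 f.
Proof.
by congr fine; apply: eq_integral => x _; rewrite /= mulN1r /normsq !ReImE !sqrrN.
Qed.

Lemma n2E f : L2 f -> (n2 f)%:E = normsqL2 f.
Proof.
by move=> [_ ?]; rewrite fineK // ge0_fin_numE // normsqL2_ge0.
Qed.

Lemma L2_integrable f : L2 f -> m.-integrable setT (EFin \o (fun x => normsq (f x))).
Proof.
move=> [mf lf]; apply/integrableP; split; first exact: cmfun_normsqE.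
under eq_integral do rewrite /= ger0_norm ?normsq_ge0//.
by [].
Qed.

Lemma L2_le f (u : T -> R) : cmfun f ->
  m.-integrable setT (EFin \o u) -> (forall x, normsq (f x) <= u x) -> L2 f.
Proof.
move=> mf iu h; split => //.
apply: le_lt_trans (integrable_lty measurableT iu).
apply: ge0_le_integral => //.
- by move=> x _; rewrite lee_fin normsq_ge0.
- exact: cmfun_normsqE.
- exact: measurable_int iu.
- by move=> x _; rewrite lee_fin.
Qed.

Lemma L2D f g : L2 f -> L2 g -> L2 (f \+ g).
Proof.
move=> Lf Lg.
apply: (@L2_le _ (fun x => 2 * normsq (f x) + 2 * normsq (g x))).
- by apply: cmfunD; [case: Lf | case: Lg].
- by apply: integrableD_EFin; apply: integrableZ_EFin; exact: L2_integrable.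
- by move=> x; exact: normsqD_le.
Qed.

Lemma L2Z c f : L2 f -> L2 (c \*o f).
Proof.
move=> Lf; apply: (@L2_le _ (fun x => normsq c * normsq (f x))).
- by apply: cmfunZ; case: Lf.
- by apply: integrableZ_EFin; exact: L2_integrable.
- by move=> x; rewrite normsqM.
Qed.

Lemma sub_funE f g : f \- g = f \+ (-1 \*o g).
Proof. by apply/funext => x /=; rewrite mulN1r. Qed.

Lemma L2B f g : L2 f -> L2 g -> L2 (f \- g).
Proof. by move=> Lf Lg; rewrite sub_funE; apply: L2D => //; exact: L2Z. Qed.

Lemma L2_ip f g : L2 f -> L2 g -> cintegrable (fun x => f x * ((g x)^*)%C).
Proof.
move=> Lf Lg.
apply: (@cintegrable_le _ (fun x => normsq (f x) + normsq (g x))).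
- apply: cmfunM; first by case: Lf.
  by apply: cmfun_conj; case: Lg.
- by apply: integrableD_EFin; exact: L2_integrable.
- by move=> x; rewrite -(normsq_conj (g x)); exact: Re_mul_le.
- by move=> x; rewrite -(normsq_conj (g x)); exact: Im_mul_le.
Qed.

Lemma ipDl f g h : L2 f -> L2 g -> L2 h -> ip (f \+ g) h = ip f h + ip g h.
Proof.
move=> Lf Lg Lh; rewrite -cintD; do ?exact: L2_ip.
by apply: eq_cint => x /=; rewrite mulrDl.
Qed.

Lemma ipZl c f h : L2 f -> L2 h -> ip (c \*o f) h = c * ip f h.
Proof.
move=> Lf Lh; rewrite -cintZ; last exact: L2_ip.
by apply: eq_cint => x /=; rewrite mulrA.
Qed.

Lemma ip_conj f g : L2 f -> L2 g -> ip g f = ((ip f g)^*)%C.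
Proof.
move=> Lf Lg; rewrite -cint_conj; last exact: L2_ip.
by apply: eq_cint => x; apply: complex_ext; rewrite !ReImE; ring.
Qed.

Lemma ipBl f g h : L2 f -> L2 g -> L2 h -> ip (f \- g) h = ip f h - ip g h.
Proof.
move=> Lf Lg Lh; rewrite sub_funE ipDl ?ipZl ?mulN1r//; exact: L2Z.
Qed.

Lemma ipDr f g h : L2 f -> L2 g -> L2 h -> ip h (f \+ g) = ip h f + ip h g.
Proof.
move=> Lf Lg Lh; rewrite ip_conj ?ipDl ?(ip_conj Lf Lh) ?(ip_conj Lg Lh)//.
  by apply: complex_ext; rewrite !ReImE; ring.
exact: L2D.
Qed.

Lemma ipZr c f h : L2 f -> L2 h -> ip h (c \*o f) = (c^*)%C * ip h f.
Proof.
move=> Lf Lh; rewrite ip_conj ?ipZl ?(ip_conj Lf Lh)//.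
  by apply: complex_ext; rewrite !ReImE; ring.
exact: L2Z.
Qed.

Lemma ipBr f g h : L2 f -> L2 g -> L2 h -> ip h (f \- g) = ip h f - ip h g.
Proof.
move=> Lf Lg Lh; rewrite sub_funE ipDr ?ipZr//; last exact: L2Z.
by rewrite (_ : (-1)^*%C = -1) ?mulN1r// /conjc /= oppr0.
Qed.

Lemma ipff f : ip f f = (n2 f)%:C%C.
Proof.
apply: complex_ext => /=.
  by congr fine; apply: eq_integral => x _ /=; rewrite normsqC.
rewrite /Rintegral.
by under eq_integral do rewrite normsqC /=; rewrite integral0.
Qed.

Lemma Re_ipff f : complex.Re (ip f f) = n2 f.
Proof. by rewrite ipff. Qed.

Lemma n2D f g : L2 f -> L2 g ->
  n2 (f \+ g) = n2 f + n2 g + 2 * complex.Re (ip f g).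
Proof.
move=> Lf Lg; have LD := L2D Lf Lg.
rewrite -Re_ipff ipDl// !ipDr// !ipff (ip_conj Lf Lg).
by rewrite !ReImE !Re_realc; ring.
Qed.

Lemma n2Z c f : L2 f -> n2 (c \*o f) = normsq c * n2 f.
Proof.
move=> Lf; have LZ := L2Z c Lf.
rewrite -Re_ipff ipZl// ipZr// ipff.
by rewrite /normsq !ReImE Re_realc Im_realc; ring.
Qed.

Lemma n2B f g : L2 f -> L2 g ->
  n2 (f \- g) = n2 f + n2 g - 2 * complex.Re (ip f g).
Proof.
move=> Lf Lg; rewrite sub_funE n2D ?n2Z ?ipZr//; last exact: L2Z.
by rewrite !ReImE /normsq !ReImE !ReIm_realE; ring.
Qed.

Lemma normsq_ip_le f g : L2 f -> L2 g -> normsq (ip f g) <= n2 f * n2 g.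
Proof.
move=> Lf Lg; set s := normsq _.
have key (t : R) : 0 <= n2 f - 2 * t * s + t ^+ 2 * s * n2 g.
  (* Positivity of the squared norm of [f - t <f,g> g] for every real [t]; the best choice is
     [t = 1 / n2 g]. *)
  have := n2_ge0 (f \- ((t%:C%C * ip f g) \*o g)).
  rewrite n2B ?n2Z ?ipZr//; last exact: L2Z.
  rewrite normsqM normsq_realc -/s !ReImE Re_realc Im_realc => /le_trans; apply.
  by rewrite le_eqVlt; apply/orP; left; apply/eqP; rewrite /s /normsq; ring.
have s0 : 0 <= s by exact: normsq_ge0.
have [g0|g0] := eqVneq (n2 g) 0.
  rewrite g0 mulr0 leNgt; apply/negP => es.
  (* With [n2 g = 0] the bound is affine in [t], and this [t] would give it the negative value
     [- n2 f - 2]. *)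
  have := key ((n2 f + 1) / s); rewrite g0 mulr0 addr0 => h.
  have sN : s != 0 by rewrite gt_eqF.
  have : 2 * ((n2 f + 1) / s) * s = 2 * (n2 f + 1) by field.
  by have := n2_ge0 f; lra.
have g1 : 0 < n2 g by rewrite lt_neqAle eq_sym g0 n2_ge0.
have := key (n2 g)^-1.
have -> : n2 f - 2 * (n2 g)^-1 * s + (n2 g)^-1 ^+ 2 * s * n2 g =
  (n2 f * n2 g - s) / n2 g by field.
by rewrite pmulr_lge0 ?invr_gt0// subr_ge0.
Qed.

Definition L2norm f : R := Num.sqrt (n2 f).

Lemma L2norm_ge0 f : 0 <= L2norm f. Proof. exact: sqrtr_ge0. Qed.

Lemma sqr_L2norm f : L2norm f ^+ 2 = n2 f.
Proof. by rewrite sqr_sqrtr ?n2_ge0. Qed.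

Lemma Re_ip_le f g : L2 f -> L2 g -> `|complex.Re (ip f g)| <= L2norm f * L2norm g.
Proof.
move=> Lf Lg; rewrite -sqrtrM ?n2_ge0// -sqrtr_sqr ler_wsqrtr//.
by apply: le_trans (normsq_ip_le Lf Lg); rewrite lerDl sqr_ge0.
Qed.

Lemma L2normD_le f g : L2 f -> L2 g -> L2norm (f \+ g) <= L2norm f + L2norm g.
Proof.
move=> Lf Lg; rewrite -(@ler_pXn2r _ 2)// ?nnegrE ?addr_ge0 ?L2norm_ge0//.
rewrite sqrrD !sqr_L2norm n2D//.
have := le_trans (ler_norm _) (Re_ip_le Lf Lg); rewrite -mulr_natl; lra.
Qed.

Lemma L2normBC f g : L2 f -> L2 g -> L2norm (f \- g) = L2norm (g \- f).
Proof.
by move=> Lf Lg; rewrite /L2norm !n2B// (ip_conj Lf Lg) Re_conjc (addrC (n2 f)).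
Qed.

Lemma L2norm_le_add f g : L2 f -> L2 g -> L2norm f <= L2norm g + L2norm (f \- g).
Proof.
move=> Lf Lg; have := L2normD_le Lg (L2B Lf Lg).
by rewrite (_ : g \+ (f \- g) = f)//; apply/funext => x /=; rewrite addrC subrK.
Qed.

Lemma L2norm_dist_le f g : L2 f -> L2 g -> `|L2norm f - L2norm g| <= L2norm (f \- g).
Proof.
move=> Lf Lg; rewrite ler_norml.
have := L2norm_le_add Lf Lg; have := L2norm_le_add Lg Lf.
by rewrite (L2normBC Lg Lf); lra.
Qed.

Lemma n2_eq0 f : L2 f -> n2 f = 0 -> {ae m, forall x, f x = 0}.
Proof.
move=> Lf f0.
have : (\int[m]_x `|(normsq (f x))%:E| = 0)%E.
  under eq_integral do rewrite /= ger0_norm ?normsq_ge0//.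
  by rewrite -[LHS]/(normsqL2 f) -n2E// f0.
have mf : measurable_fun setT (fun x => (normsq (f x))%:E).
  by apply: cmfun_normsqE; case: Lf.
move/(ae_eq_integral_abs _ measurableT mf) => h.
by apply: filterS h => x /(_ I) [] /normsq_eq0.
Qed.

End ComplexIntegral.

Arguments L2 {d T R} m f.
Arguments n2 {d T R} m f.
(** * Parseval identities and approximation *)

(** Reduces unconditional sums to real sums over duplicate-free finite lists: an upper bound for all
    of them, approached by some. *)
Lemma esum_approx (R : realType) (J : choiceType) (a : J -> R) (c : R) :
  (forall j, 0 <= a j) ->
  (forall s : seq J, uniq s -> \sum_(j <- s) a j <= c) ->
  (forall e, 0 < e -> exists2 s : seq J, uniq s & c - e < \sum_(j <- s) a j) ->
  (\esum_(j in [set: J]) (a j)%:E = c%:E)%E.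
Proof.
move=> a0 ub lb; apply/eqP; rewrite eq_le; apply/andP; split.
  apply: ge_ereal_sup => _ [A [finA _] <-].
  by rewrite fsbig_finite//= sumEFin lee_fin; apply: ub.
apply/lee_subgt0Pr => e e0; have [s us hs] := lb _ e0.
apply: esum_ge; exists [set` s]; first by split.
by rewrite -fsbig_seq// sumEFin -EFinB lee_fin ltW.
Qed.

Lemma esum_real_ub (R : realType) (J : choiceType) (a : J -> R) (c : R) :
  (\esum_(j in [set: J]) (a j)%:E = c%:E)%E ->
  forall s : seq J, uniq s -> \sum_(j <- s) a j <= c.
Proof.
move=> h s us; rewrite -lee_fin -h -sumEFin; apply: esum_ge.
by exists [set` s]; [split | rewrite -fsbig_seq].
Qed.

Lemma esum_real_approx (R : realType) (J : choiceType) (a : J -> R) (c : R) :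
  (\esum_(j in [set: J]) (a j)%:E = c%:E)%E ->
  forall e, 0 < e -> exists2 s : seq J, uniq s & c - e < \sum_(j <- s) a j.
Proof.
move=> h e e0.
have : (c%:E - e%:E < \esum_(j in [set: J]) (a j)%:E)%E.
  by rewrite h -EFinB lte_fin ltrBlDr ltrDl.
move=> /ereal_sup_gt[_ [A [finA _] <-]].
rewrite fsbig_finite//= sumEFin -EFinB lte_fin => hA.
by exists (finmap.enum_fset (fset_set A)) => //; exact: finmap.fset_uniq.
Qed.

Section BesselDefect.
Context d (T : measurableType d) (R : realType).
Variable m : {measure set T -> \bar R}.
Variables (J : choiceType) (e : J -> T -> R[i]).
Hypothesis Le : forall j, L2 m (e j).
Implicit Types (f g u : T -> R[i]) (s t : seq J).

Definition energy s f : R := \sum_(j <- s) normsq (ip m f (e j)).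

(** Nonnegativity of the defect is Bessel's inequality; defects coming arbitrarily close to 0
    express Parseval's identity. *)
Definition defect s f : R := n2 m f - energy s f.

Lemma energy_ge0 s f : 0 <= energy s f.
Proof. by apply: sumr_ge0 => j _; exact: normsq_ge0. Qed.

(** The free parameter lets the constant of the main term tend to 1, which the factor 2 of
    [normsqD_le] does not allow; a limit of Bessel inequalities thus keeps the constant 1. *)
Lemma normsqD_young (x : R) (z w : R[i]) : 0 < x ->
  normsq (z + w) <= (1 + x) * normsq z + (1 + x^-1) * normsq w.
Proof.
move=> x0; have xN : x != 0 by rewrite gt_eqF.
rewrite -subr_ge0 /normsq !ReImE.
rewrite (_ : _ - _ = ((x * complex.Re z - complex.Re w) ^+ 2 +
                     (x * complex.Im z - complex.Im w) ^+ 2) / x); last by field.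
by rewrite divr_ge0 ?addr_ge0 ?sqr_ge0 // ltW.
Qed.

Lemma n2_young (x : R) f g : 0 < x -> L2 m f -> L2 m g ->
  n2 m (f \+ g) <= (1 + x) * n2 m f + (1 + x^-1) * n2 m g.
Proof.
move=> x0 Lf Lg; have xN : x != 0 by rewrite gt_eqF.
rewrite n2D//; have := n2_ge0 m ((x%:C%C \*o f) \- g).
rewrite n2B ?n2Z ?ipZl//; last exact: L2Z.
rewrite normsq_realc !ReImE Re_realc Im_realc mul0r subr0 => h.
rewrite -subr_ge0 (_ : _ - _ =
  (x ^+ 2 * n2 m f + n2 m g - 2 * (x * complex.Re (ip m f g))) / x); last by field.
by rewrite divr_ge0// ltW.
Qed.

Lemma energy_young s (x : R) f g : 0 < x -> L2 m f -> L2 m g ->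
  energy s (f \+ g) <= (1 + x) * energy s f + (1 + x^-1) * energy s g.
Proof.
move=> x0 Lf Lg; rewrite !mulr_sumr -big_split; apply: ler_sum => j _ /=.
by rewrite ipDl//; exact: normsqD_young.
Qed.

(* The defect is a quadratic form, hence obeys the parallelogram law. *)
Lemma defectD_le s f g : L2 m f -> L2 m g -> 0 <= defect s (f \- g) ->
  defect s (f \+ g) <= 2 * defect s f + 2 * defect s g.
Proof.
move=> Lf Lg h.
suff : defect s (f \+ g) + defect s (f \- g) = 2 * defect s f + 2 * defect s g.
  by lra.
rewrite /defect n2D// n2B//.
have : energy s (f \+ g) + energy s (f \- g) = 2 * energy s f + 2 * energy s g.
  rewrite -big_split !mulr_sumr -big_split; apply: eq_bigr => j _ /=.
  by rewrite ipDl// ipBl// /normsq !ReImE; ring.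
by lra.
Qed.

Lemma defectZ s c f : L2 m f -> defect s (c \*o f) = normsq c * defect s f.
Proof.
move=> Lf; rewrite /defect n2Z// mulrBr; congr (_ - _).
by rewrite mulr_sumr; apply: eq_bigr => j _; rewrite ipZl// normsqM.
Qed.

Lemma energy_mono s t f : uniq s -> {subset s <= t} -> energy s f <= energy t f.
Proof.
move=> us st; rewrite /energy.
have h0 : perm_eq s [seq x <- undup t | x \in s].
  apply: uniq_perm => //; first by rewrite filter_uniq ?undup_uniq.
  move=> x; rewrite mem_filter mem_undup; apply/idP/andP => [xs|[]//].
  by split => //; exact: st.
rewrite (perm_big _ h0) /= big_filter big_mkcond /=.
have h : \sum_(j <- undup t) normsq (ip m f (e j)) <= \sum_(j <- t) normsq (ip m f (e j)).
  elim: t {st h0} => //= x t IH; case: ifP => _; rewrite !big_cons.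
    by rewrite (le_trans IH)// lerDr normsq_ge0.
  by rewrite lerD2l.
apply: le_trans h; apply: ler_sum => j _; case: ifP => // _.
exact: normsq_ge0.
Qed.

Lemma defect_mono s t f : uniq s -> {subset s <= t} -> defect t f <= defect s f.
Proof. by move=> us st; rewrite lerD2l lerN2; exact: energy_mono. Qed.

(** For an orthonormal family this says that [f] lies in its closed span. *)
Definition total f : Prop :=
  L2 m f /\ forall x, 0 < x -> exists2 s, uniq s & defect s f < x.

Lemma esum_total f : (forall s, uniq s -> 0 <= defect s f) -> total f ->
  (\esum_(j in [set: J]) (normsq (ip m f (e j)))%:E = (n2 m f)%:E)%E.
Proof.
move=> bf [Lf tf]; apply: esum_approx.
- by move=> j; exact: normsq_ge0.
- by move=> s us; rewrite -subr_ge0; exact: bf.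
- by move=> x /tf[s us hs]; exists s => //; rewrite ltrBlDl -ltrBlDr.
Qed.

Lemma total_parseval f :
  (\esum_(j in [set: J]) (normsq (ip m f (e j)))%:E = (n2 m f)%:E)%E ->
  L2 m f -> total f.
Proof.
move=> h Lf; split => // x x0; have [s us hs] := esum_real_approx h x0.
by exists s => //; rewrite /defect; rewrite /energy; lra.
Qed.

(** * Extension of Parseval's identity by density *)

Section Dense.
Variable D : (T -> R[i]) -> Prop.
Hypothesis D_L2 : forall u, D u -> L2 m u.
Hypothesis DB : forall u v, D u -> D v -> D (u \- v).
Hypothesis D_parseval : forall u, D u ->
  (\esum_(j in [set: J]) (normsq (ip m u (e j)))%:E = (n2 m u)%:E)%E.
Let adherent f := L2 m f /\ forall x, 0 < x -> exists2 u, D u & n2 m (f \- u) < x.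

(** For a fixed finite [s], Cauchy-Schwarz bounds the energy by a multiple of the squared norm, so
    the error [f - u] is controlled; Bessel holds for [u] in [D], and the Young parameter is then
    sent to 0. *)
Lemma adherent_bessel s f : uniq s -> adherent f -> energy s f <= n2 m f.
Proof.
move=> us [Lf hf].
pose C := \sum_(j <- s) n2 m (e j).
have C0 : 0 <= C by apply: sumr_ge0 => j _; exact: n2_ge0.
have enC g : L2 m g -> energy s g <= n2 m g * C.
  by move=> Lg; rewrite mulr_sumr; apply: ler_sum => j _; exact: normsq_ip_le.
have step x : 0 < x -> energy s f <= (1 + x) * ((1 + x) * n2 m f) + x.
  (* [K] collects all the coefficients that [n2 m (f - u)] receives in the estimates [e1] to
     [e4]. *)
  move=> x0; pose K := (1 + x) * (1 + x^-1) + (1 + x^-1) * C.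
  have x1 : 0 < x^-1 by rewrite invr_gt0.
  have K0 : 0 < K by rewrite ltr_pwDl ?mulr_gt0 ?mulr_ge0 //; lra.
  have [u Du hu] := hf (x / K) (divr_gt0 x0 K0).
  have Lu := D_L2 Du; have Lw := L2B Lf Lu.
  have e1 : energy s f <= (1 + x) * energy s u + (1 + x^-1) * energy s (f \- u).
    rewrite {1}(_ : f = u \+ (f \- u)); first exact: energy_young.
    by apply/funext => y /=; rewrite addrC subrK.
  have e2 : energy s u <= n2 m u := esum_real_ub (D_parseval Du) us.
  have e3 : n2 m u <= (1 + x) * n2 m f + (1 + x^-1) * n2 m (f \- u).
    have := n2_young x0 Lf (L2Z (-1) Lw).
    rewrite n2N (_ : f \+ _ = u)//; apply/funext => y /=; ring.
  have e4 := enC _ Lw.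
  have e5 : K * n2 m (f \- u) <= x.
    by rewrite mulrC -ler_pdivlMr// ltW.
  apply: (le_trans e1); apply: (@le_trans _ _
    ((1 + x) * ((1 + x) * n2 m f + (1 + x^-1) * n2 m (f \- u)) +
     (1 + x^-1) * (n2 m (f \- u) * C))).
    by apply: lerD; rewrite ler_pM2l ?(le_trans e2)//; lra.
  rewrite (_ : _ + _ = (1 + x) * ((1 + x) * n2 m f) + K * n2 m (f \- u)).
    by rewrite lerD2l.
  by rewrite /K; ring.
rewrite -subr_ge0 leNgt; apply/negP => h.
have f0 := n2_ge0 m f.
pose b := energy s f - n2 m f; have b0 : 0 < b by rewrite /b; lra.
(* With [x <= 1], [(1 + x)^2 n2 f + x] is at most [n2 f + x (3 n2 f + 1)], hence at most
   [n2 f + b / 2], against the assumed excess [b]. *)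
pose x := Num.min 1 (b / (2 * (3 * n2 m f + 1))).
have q0 : 0 < 2 * (3 * n2 m f + 1) by lra.
have x0 : 0 < x by rewrite /x lt_min ltr01 divr_gt0.
have xb : x * (2 * (3 * n2 m f + 1)) <= b by rewrite -ler_pdivlMr// /x ge_min lexx orbT.
have x1 : x <= 1 by rewrite /x ge_min lexx.
have := step _ x0.
have x2 : x * x <= x by rewrite ger_pMr.
have : (x * x) * n2 m f <= x * n2 m f by rewrite ler_wpM2r.
move: xb b0 x0; rewrite /b; nra.
Qed.

(** By [defectD_le] the defect of [f] is at most twice that of a close [u] in [D], which is small
    for a suitable [s], plus twice that of [f - u], which is at most the squared norm of [f - u]. *)
Lemma dense_parseval f : L2 m f ->
  (forall x, 0 < x -> exists2 u, D u & n2 m (f \- u) < x) ->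
  (\esum_(j in [set: J]) (normsq (ip m f (e j)))%:E = (n2 m f)%:E)%E.
Proof.
move=> Lf hf.
have adhB u : D u -> adherent (f \- u).
  move=> Du; split=> [|x x0]; first by apply: L2B => //; exact: D_L2.
  have [v Dv hv] := hf _ x0; exists (v \- u); first exact: DB.
  by rewrite (_ : _ \- _ = f \- v)//; apply/funext => y /=; ring.
apply: esum_total.
  by move=> s us; rewrite subr_ge0; exact: adherent_bessel.
split => // x x0.
have [u Du hu] := hf (x / 4) ltac:(lra).
have Lu := D_L2 Du.
have [_ /(_ (x / 4) ltac:(lra)) [s us hs]] := total_parseval (D_parseval Du) Lu.
exists s => //.
have Lw := L2B Lf Lu.
rewrite (_ : f = u \+ (f \- u)); last by apply/funext => y /=; rewrite addrC subrK.
apply: le_lt_trans (defectD_le Lu Lw _) _.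
  rewrite subr_ge0; apply: adherent_bessel => //; split; first exact: L2B.
  move=> y y0; have [v Dv hv] := hf _ y0.
  (* This approximates [u - (f - u)] exactly as well as [v] approximates [f]. *)
  exists (u \- (v \- u)); first by do !apply: DB.
  rewrite (_ : _ \- _ = -1 \*o (f \- v)) ?n2N//.
  by apply/funext => z /=; rewrite mulN1r; ring.
have : defect s (f \- u) <= n2 m (f \- u) by rewrite gerBl energy_ge0.
by lra.
Qed.

End Dense.

(** * Orthonormal families: Bessel's inequality and totality *)

Section Orthonormal.
Hypothesis ortho : forall i j, ip m (e i) (e j) = if i == j then 1 else 0.

(** The defect is the squared norm of the residual left after removing the components along [s] one
    at a time; the coefficients outside [s] do not change in the process. *)
Lemma orthonormal_bessel s f : uniq s -> L2 m f -> 0 <= defect s f.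
Proof.
move=> us Lf.
suff [r [Lr <- _]] : exists r, [/\ L2 m r, n2 m r = defect s f &
    forall j, j \notin s -> ip m r (e j) = ip m f (e j)] by exact: n2_ge0.
elim: s us => [_|j s IH /= /andP[js us]].
  by exists f; split => //; rewrite /defect /energy big_nil subr0.
have [r [Lr nr hr]] := IH us.
exists (r \- (ip m f (e j) \*o e j)); split.
- by apply: L2B => //; exact: L2Z.
- rewrite n2B ?n2Z ?ipZr ?hr//; last exact: L2Z.
  rewrite -(Re_ipff _ (e j)) ortho eqxx nr /defect /energy big_cons /normsq.
  by rewrite !ReImE Re1; ring.
- move=> k; rewrite inE negb_or => /andP[kj ks].
  rewrite ipBl//; last exact: L2Z.
  by rewrite ipZl// hr// ortho eq_sym (negbTE kj) mulr0 subr0.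
Qed.

Lemma defect_undup s f : L2 m f -> 0 <= defect (undup s) f.
Proof. by move=> Lf; apply: orthonormal_bessel => //; exact: undup_uniq. Qed.

Lemma totalD f g : total f -> total g -> total (f \+ g).
Proof.
move=> [Lf tf] [Lg tg]; split => [|x x0]; first exact: L2D.
have [s us hs] := tf (x / 4) ltac:(lra).
have [t ut ht] := tg (x / 4) ltac:(lra).
exists (undup (s ++ t)); first exact: undup_uniq.
apply: le_lt_trans (defectD_le Lf Lg _) _; first exact/defect_undup/L2B.
have h1 : defect (undup (s ++ t)) f <= defect s f.
  by apply: defect_mono => // y ys; rewrite mem_undup mem_cat ys.
have h2 : defect (undup (s ++ t)) g <= defect t g.
  by apply: defect_mono => // y ys; rewrite mem_undup mem_cat ys orbT.
by lra.
Qed.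

Lemma totalZ c f : total f -> total (c \*o f).
Proof.
move=> [Lf tf]; split => [|x x0]; first exact: L2Z.
have c1 : 0 < normsq c + 1 by rewrite ltr_wpDl ?normsq_ge0.
have [s us hs] := tf (x / (normsq c + 1)) (divr_gt0 x0 c1).
exists s => //; rewrite defectZ//; move: hs; rewrite ltr_pdivlMr//.
by have := orthonormal_bessel us Lf; have := normsq_ge0 c; nra.
Qed.

Lemma total_closed f : L2 m f ->
  (forall x, 0 < x -> exists2 u, total u & n2 m (f \- u) < x) -> total f.
Proof.
move=> Lf h; split => // x x0.
have [u [Lu tu] hu] := h (x / 4) ltac:(lra).
have [s us hs] := tu (x / 4) ltac:(lra).
exists s => //.
have Lw := L2B Lf Lu.
rewrite (_ : f = u \+ (f \- u)); last by apply/funext => y /=; rewrite addrC subrK.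
apply: le_lt_trans (defectD_le Lu Lw _) _.
  by apply: orthonormal_bessel => //; exact: L2B.
have : defect s (f \- u) <= n2 m (f \- u) by rewrite gerBl energy_ge0.
by lra.
Qed.

Lemma total_basis j : total (e j).
Proof.
split => // x x0; exists [:: j] => //.
rewrite /defect /energy big_seq1 -(Re_ipff _ (e j)) ortho eqxx /normsq !ReIm_realE.
by rewrite expr1n expr0n addr0 subrr.
Qed.

Lemma orthonormal_parseval f : total f ->
  (\esum_(j in [set: J]) (normsq (ip m f (e j)))%:E = (n2 m f)%:E)%E.
Proof.
move=> tf; apply: esum_total => // s us; apply: orthonormal_bessel => //.
by case: tf.
Qed.

End Orthonormal.

End BesselDefect.
Lemma n2_dominated d (T : measurableType d) (R : realType)
    (m : {measure set T -> \bar R}) (u : T -> R[i]) (u_ : nat -> T -> R[i])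
    (g : T -> R) :
  cmfun u -> (forall n, cmfun (u_ n)) -> m.-integrable setT (EFin \o g) ->
  (forall n x, normsq (u x - u_ n x) <= g x) ->
  (forall x, normsq (u x - u_ n x) @[n --> \oo] --> 0) ->
  n2 m (u \- u_ n) @[n --> \oo] --> 0.
Proof.
move=> mu mu_ ig ug cu.
pose F n x := (normsq (u x - u_ n x))%:E.
have mF n : measurable_fun setT (F n) by exact/cmfun_normsqE/cmfunB.
have FF x : setT x -> F ^~ x @ \oo --> (cst 0%E : T -> \bar R) x.
  by move=> _; apply/fine_cvgP; split; [exact: nearW | exact: cu].
have fg x : setT x -> (EFin \o g) x \is a fin_num by [].
have gF n x : setT x -> (`|F n x| <= (EFin \o g) x)%E.
  by move=> _; rewrite /= lee_fin ger0_norm ?normsq_ge0.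
have := dominated_cvg measurableT mF FF fg ig gF.
by rewrite integral_cst// mul0e => /fine_cvg.
Qed.

Lemma cvg0_exists_lt (R : realType) (a : nat -> R) : a n @[n --> \oo] --> 0 ->
  forall x, 0 < x -> exists n, a n < x.
Proof.
move=> /cvgrPdist_lt h x x0; have [N _ hN] := h _ x0.
exists N; have := hN N (leqnn N); rewrite /= sub0r normrN.
exact/le_lt_trans/ler_norm.
Qed.

(** * The trigonometric system on an interval of length one *)

Section TrigSystem.
Context {R : realType}.
Local Notation mu := (@lebesgue_measure R).
Local Notation Rm := (measurableTypeR R).
Implicit Types (u w : Rm -> R) (v f : Rm -> R[i]).

Definition unit_itv : set Rm := `]-(1/2), 1/2[%classic.

Definition chi : Rm -> R := \1_unit_itv.

(** A character of the circle cut off to the interval, so that inner products are taken over the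
    whole line. The sign of the exponent is the one produced by the Fourier transform of a translate
    by [k]. *)
Definition trig (k : int) (x : Rm) : R[i] :=
  (chi x)%:C%C * expi (- (2 * pi * (k%:~R * x))).

Lemma measurable_unit_itv : measurable unit_itv.
Proof. exact: measurable_itv. Qed.

Lemma chi_in x : unit_itv x -> chi x = 1.
Proof. by move=> h; rewrite /chi indicE mem_set. Qed.

Lemma chi_out x : ~ unit_itv x -> chi x = 0.
Proof. by move=> h; rewrite /chi indicE memNset. Qed.

Lemma chi_sqr x : chi x * chi x = chi x.
Proof. by rewrite /chi indicE; case: (_ \in _); rewrite ?mulr0 ?mulr1. Qed.

Lemma chi_ge0 x : 0 <= chi x. Proof. by rewrite /chi indicE. Qed.

Lemma chi_le1 x : chi x <= 1.
Proof. by rewrite /chi indicE lern1; case: (_ \in _). Qed.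

Lemma measurable_chi : measurable_fun [set: Rm] chi.
Proof. exact: measurable_indic measurable_unit_itv. Qed.

Lemma integrable_chi : mu.-integrable setT (EFin \o chi).
Proof. exact: integrable_indic_itv. Qed.

Lemma measurable_cosM (c : R) : measurable_fun [set: Rm] (fun x => cos (c * x)).
Proof.
apply: continuous_measurable_fun => x; apply: continuous_comp.
  exact: mulrl_continuous.
exact: continuous_cos.
Qed.

Lemma measurable_sinM (c : R) : measurable_fun [set: Rm] (fun x => sin (c * x)).
Proof.
apply: continuous_measurable_fun => x; apply: continuous_comp.
  exact: mulrl_continuous.
exact: continuous_sin.
Qed.

Lemma cmfun_trig k : cmfun (trig k).
Proof.
apply: cmfunM; first exact: cmfun_realc measurable_chi.
split => /=.
  rewrite (_ : (fun _ => _) = (fun x => cos ((- (2 * pi * k%:~R)) * x))).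
    exact: measurable_cosM.
  by apply/funext => x; congr cos; ring.
rewrite (_ : (fun _ => _) = (fun x => sin ((- (2 * pi * k%:~R)) * x))).
  exact: measurable_sinM.
by apply/funext => x; congr sin; ring.
Qed.

Lemma normsq_trig k x : normsq (trig k x) = chi x.
Proof. by rewrite normsqM normsq_expi normsq_realc expr2 chi_sqr mulr1. Qed.

Lemma L2_trig k : L2 mu (trig k).
Proof.
apply: (L2_le (cmfun_trig k) integrable_chi) => x.
by rewrite normsq_trig.
Qed.

Lemma sin_pi_int (k : int) : sin (pi * k%:~R) = 0 :> R.
Proof.
have h (n : nat) : sin (pi * n%:R) = 0 :> R.
  by rewrite mulr_natr -(add0r (pi *+ n)) (alternatingn (@sinDpi R)) sin0 mulr0.
case: k => n; first exact: h.
by rewrite NegzE mulrNz mulrN sinN h oppr0.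
Qed.

Lemma Rintegral_oo_FTC (F f : R -> R) (a b : R) : a < b ->
  (forall x, is_derive x (1 : R) F (f x)) -> continuous f ->
  Rintegral mu `]a, b[%classic f = F b - F a.
Proof.
move=> ab dF cf.
have cF : continuous F.
  move=> x; apply: differentiable_continuous; apply/derivable1_diffP.
  by have [] := dF x.
rewrite /Rintegral -(@integral_itv_bndoo _ a b _ true false); last first.
  apply/measurable_EFinP; apply: measurable_funTS.
  exact: continuous_measurable_fun.
rewrite (@continuous_FTC2 _ f F)//.
- exact: continuous_subspaceT.
- split.
  + by move=> x _; have [] := dF x.
  + exact/cvg_at_right_filter/cF.
  + exact/cvg_at_left_filter/cF.
- by move=> x _; rewrite derive1E; have [_ ->] := dF x.
Qed.

Lemma is_derive_sinM (c x : R) : c != 0 ->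
  is_derive x (1 : R) (fun y => c^-1 * sin (c * y)) (cos (c * x)).
Proof.
move=> c0.
have h : is_derive x (1 : R) ( *%R c) c.
  by have := is_deriveZ c (is_derive_id x (1 : R)); rewrite [_ *: 1]mulr1.
have := is_deriveZ c^-1 (is_derive1_comp (is_derive_sin _) h).
by rewrite [_ *: _]mulrCA mulVf// mulr1.
Qed.

Lemma is_derive_cosM (c x : R) : c != 0 ->
  is_derive x (1 : R) (fun y => (- c^-1) * cos (c * y)) (sin (c * x)).
Proof.
move=> c0.
have h : is_derive x (1 : R) ( *%R c) c.
  by have := is_deriveZ c (is_derive_id x (1 : R)); rewrite [_ *: 1]mulr1.
have := is_deriveZ (- c^-1) (is_derive1_comp (is_derive_cos _) h).
have E : (- c^-1) * (- sin (c * x) * c) = sin (c * x) by field.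
by rewrite [_ *: _]E.
Qed.

Lemma continuous_cosM (c : R) : continuous (fun x : R => cos (c * x)).
Proof.
by move=> x; apply: continuous_comp; [exact: mulrl_continuous | exact: continuous_cos].
Qed.

Lemma continuous_sinM (c : R) : continuous (fun x : R => sin (c * x)).
Proof.
by move=> x; apply: continuous_comp; [exact: mulrl_continuous | exact: continuous_sin].
Qed.

Lemma trig_mul_conj i j x :
  trig i x * ((trig j x)^*)%C = (chi x)%:C%C * expi (2 * pi * (j - i)%:~R * x).
Proof.
rewrite /trig (_ : expi (2 * pi * (j - i)%:~R * x) =
  expi (- (2 * pi * (i%:~R * x))) * ((expi (- (2 * pi * (j%:~R * x))))^*)%C).
  rewrite -[in RHS](chi_sqr x).
  by apply: complex_ext; rewrite !ReImE !ReIm_realE; ring.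
rewrite conj_expi -expiD; congr expi; rewrite rmorphB /=; ring.
Qed.

Lemma ip_trig i j : ip mu (trig i) (trig j) = if i == j then 1 else 0.
Proof.
rewrite /ip /cint.
under eq_Rintegral do rewrite trig_mul_conj ReM Re_realc Im_realc mul0r subr0.
under [X in (_ +i* X)%C]eq_Rintegral do
  rewrite trig_mul_conj ImM Re_realc Im_realc mul0r addr0.
have E (g : R -> R) : Rintegral mu setT (fun x => chi x * g x) =
    Rintegral mu unit_itv g.
  rewrite [RHS]Rintegral_mkcond; apply: eq_Rintegral => x _.
  rewrite patchE /chi indicE; case: ifP => _; first by rewrite mul1r.
  by rewrite mul0r.
rewrite !E /=; set c : R := 2 * pi * (j - i)%:~R.
have lt12 : - (1 / 2) < 1 / 2 :> R by lra.
have [ij|ij] := eqVneq i j.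
  rewrite /c ij subrr mulr0.
  under eq_Rintegral do rewrite mul0r cos0.
  under [X in (_ +i* X)%C]eq_Rintegral do rewrite mul0r sin0.
  rewrite !Rintegral_cst; try exact: measurable_unit_itv.
  rewrite [X in fine X](_ : _ = 1%:E); last first.
    by rewrite [LHS]lebesgue_measure_itv /= lte_fin lt12 -EFinD; congr EFin; field.
  by apply: complex_ext => /=; ring.
have c0 : c != 0.
  apply: mulf_neq0; last by rewrite intr_eq0 subr_eq0 eq_sym.
  by apply: mulf_neq0; [rewrite pnatr_eq0 | rewrite gt_eqF ?pi_gt0].
rewrite (Rintegral_oo_FTC lt12 (fun x => is_derive_sinM x c0) (@continuous_cosM c)).
rewrite (Rintegral_oo_FTC lt12 (fun x => is_derive_cosM x c0) (@continuous_sinM c)).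
have -> : c * (1 / 2) = pi * (j - i)%:~R by rewrite /c; field.
have -> : c * - (1 / 2) = - (pi * (j - i)%:~R) by rewrite /c; field.
by rewrite sinN cosN sin_pi_int subrr; apply: complex_ext => /=; ring.
Qed.

Local Notation tot := (total mu trig).

(* The multipliers form an algebra closed under bounded pointwise limits and
   containing the trigonometric polynomials, hence the indicator of every Borel
   set; since [trig 0] is the indicator of the interval, this yields totality. *)
Definition multiplier u : Prop :=
  [/\ measurable_fun [set: Rm] u, exists C, forall x, `|u x| <= C &
    forall v, (forall x, ~ unit_itv x -> v x = 0) -> tot v ->
      tot (fun x => (u x)%:C%C * v x)].

(** Multipliers act on functions that vanish off the interval, so only the values there matter. *)
Lemma multiplier_ext u w : (forall x, unit_itv x -> u x = w x) ->
  measurable_fun [set: Rm] w -> (exists C, forall x, `|w x| <= C) ->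
  multiplier u -> multiplier w.
Proof.
move=> uw mw bw [_ _ hu]; split; [exact: mw | exact: bw | move=> v v0 tv].
rewrite (_ : (fun _ => _) = (fun x => (u x)%:C%C * v x)); first exact: hu.
apply/funext => x; have [/uw->//|/v0 ->] := pselect (unit_itv x).
by rewrite !mulr0.
Qed.

Lemma multiplierM u w : multiplier u -> multiplier w ->
  multiplier (fun x => u x * w x).
Proof.
move=> [mu [C hC] hu] [mw [D hD] hw]; split; first exact: measurable_funM.
  exists (C * D) => x; rewrite normrM ler_pM//.
move=> v v0 tv; rewrite (_ : (fun _ => _) =
  (fun x => (u x)%:C%C * ((w x)%:C%C * v x))).
  by apply: hu; [move=> x /v0 ->; rewrite mulr0 | exact: hw].
by apply/funext => x; rewrite rmorphM mulrA.
Qed.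

Lemma multiplierD u w : multiplier u -> multiplier w ->
  multiplier (fun x => u x + w x).
Proof.
move=> [mu [C hC] hu] [mw [D hD] hw]; split; first exact: measurable_funD.
  by exists (C + D) => x; rewrite (le_trans (ler_normD _ _))// lerD.
move=> v v0 tv; rewrite (_ : (fun _ => _) =
  (fun x => (u x)%:C%C * v x) \+ (fun x => (w x)%:C%C * v x)).
  by apply: (totalD L2_trig ip_trig); [exact: hu | exact: hw].
by apply/funext => x /=; rewrite rmorphD mulrDl.
Qed.

Lemma multiplier_cst (c : R) : multiplier (fun=> c).
Proof.
split; first exact: measurable_cst.
  by exists `|c|.
by move=> v v0 tv; exact: (totalZ L2_trig ip_trig).
Qed.

Lemma multiplierZ (c : R) u : multiplier u -> multiplier (fun x => c * u x).
Proof. exact: multiplierM (multiplier_cst c). Qed.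

Lemma multiplier_lim (u_ : nat -> Rm -> R) u (C : R) :
  (forall n, multiplier (u_ n)) -> (forall n x, `|u_ n x| <= C) ->
  measurable_fun [set: Rm] u -> (forall x, `|u x| <= C) ->
  (forall x, unit_itv x -> u_ n x @[n --> \oo] --> u x) -> multiplier u.
Proof.
move=> hu_ bu_ mu' bu cu; split => //; first by exists C.
move=> v v0 tv; have [Lv _] := tv.
have mprod w : measurable_fun [set: Rm] w -> cmfun (fun x => (w x)%:C%C * v x).
  move=> mw; apply: cmfunM; last by case: Lv.
  exact: cmfun_realc.
(* The dominating function: two values bounded by [C] differ by at most [2 * C]. *)
have iv : mu.-integrable setT (EFin \o (fun x => (2 * C) ^+ 2 * normsq (v x))).
  exact/integrableZ_EFin/L2_integrable.
have bsub (a b : R) : `|a| <= C -> `|b| <= C -> (a - b) ^+ 2 <= (2 * C) ^+ 2.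
  by rewrite !ler_norml => /andP[? ?] /andP[? ?]; nra.
have Ew (a b : R) z : normsq (a%:C%C * z - b%:C%C * z) = (a - b) ^+ 2 * normsq z.
  by rewrite -mulrBl normsqM -rmorphB normsq_realc.
apply: (total_closed L2_trig ip_trig).
  apply: (L2_le (mprod _ mu') iv) => x.
  rewrite normsqM normsq_realc ler_wpM2r ?normsq_ge0//.
  by have := bu x; rewrite ler_norml => /andP[? ?]; nra.
have /cvg0_exists_lt h : n2 mu ((fun x => (u x)%:C%C * v x) \-
    (fun x => (u_ n x)%:C%C * v x)) @[n --> \oo] --> 0.
  apply: (n2_dominated (u_ := fun n x => (u_ n x)%:C%C * v x) _ _ iv).
  - exact: mprod.
  - by move=> n; apply: mprod; case: (hu_ n).
  - by move=> n x; rewrite Ew ler_wpM2r ?normsq_ge0// bsub.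
  - move=> x; have [xI|/v0 ->] := pselect (unit_itv x); last first.
      by under eq_fun do rewrite !mulr0 subrr normsq0; exact: cvg_cst.
    under eq_fun do rewrite Ew.
    suff : (u x - u_ n x) ^+ 2 * normsq (v x) @[n --> \oo] -->
        (u x - u x) ^+ 2 * normsq (v x) by rewrite subrr expr0n mul0r.
    apply: cvgM; last exact: cvg_cst.
    under eq_fun do rewrite expr2.
    by rewrite expr2; apply: cvgM; apply: cvgB; do ?[exact: cvg_cst | exact: cu].
move=> x /h[n hn]; exists (fun x => (u_ n x)%:C%C * v x) => //.
by have [_ _] := hu_ n; apply.
Qed.

Definition modulate (k : int) v : Rm -> R[i] :=
  fun x => expi (- (2 * pi * (k%:~R * x))) * v x.

Lemma cmfun_modulate k v : cmfun v -> cmfun (modulate k v).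
Proof.
apply: cmfunM; split => /=.
  rewrite (_ : (fun _ => _) = (fun x => cos ((- (2 * pi * k%:~R)) * x))).
    exact: measurable_cosM.
  by apply/funext => x; congr cos; ring.
rewrite (_ : (fun _ => _) = (fun x => sin ((- (2 * pi * k%:~R)) * x))).
  exact: measurable_sinM.
by apply/funext => x; congr sin; ring.
Qed.

Lemma normsqL2_modulate k v : normsqL2 mu (modulate k v) = normsqL2 mu v.
Proof.
by apply: eq_integral => x _; rewrite normsqM normsq_expi mul1r.
Qed.

(** Modulation by [k] shifts the trigonometric coefficients by [k], so shifting the index list
    leaves the defect unchanged. *)
Lemma total_modulate k v : tot v -> tot (modulate k v).
Proof.
move=> [[mv fv] tv].
have Lm : L2 mu (modulate k v).
  by split; [exact: cmfun_modulate | rewrite normsqL2_modulate].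
split => // x /tv[s us hs]; exists [seq j + k | j <- s].
  by rewrite map_inj_uniq//; exact: addIr.
rewrite /defect /n2 normsqL2_modulate /energy big_map.
rewrite (eq_bigr (fun j => normsq (ip mu v (trig j))))// => j _.
congr normsq; apply: eq_cint => y; rewrite /modulate /trig.
have -> : expi (- (2 * pi * ((j + k)%:~R * y))) =
    expi (- (2 * pi * (k%:~R * y))) * expi (- (2 * pi * (j%:~R * y))).
  by rewrite -expiD rmorphD /=; congr expi; ring.
rewrite !conjcM; set E := expi _; set a := (_^*)%C; set F := (_^*)%C.
set G := (_^*)%C.
rewrite (_ : _ * _ = (E * F) * (v y * (a * G))); last by ring.
by rewrite normsqC normsq_expi mul1r.
Qed.

Lemma multiplier_cos (k : int) : multiplier (fun x => cos (2 * pi * k%:~R * x)).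
Proof.
split; first exact: measurable_cosM.
  by exists 1 => x; exact: cos_max.
move=> v v0 tv; have tZ := totalZ L2_trig ip_trig; have tD := totalD L2_trig ip_trig.
rewrite (_ : (fun _ => _) =
  ((1 / 2)%:C%C \*o (modulate k v \+ modulate (- k) v))).
  by apply: tZ; apply: tD; exact: total_modulate.
apply/funext => x; rewrite /modulate /=.
have -> : - (2 * pi * (k%:~R * x)) = - (2 * pi * k%:~R * x) by ring.
have -> : - (2 * pi * ((- k)%:~R * x)) = 2 * pi * k%:~R * x by rewrite rmorphN; ring.
by apply: complex_ext; rewrite !ReImE !ReIm_realE cosN sinN; field.
Qed.

Lemma multiplier_sin (k : int) : multiplier (fun x => sin (2 * pi * k%:~R * x)).
Proof.
split; first exact: measurable_sinM.
  by exists 1 => x; exact: sin_max.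
move=> v v0 tv; have tZ := totalZ L2_trig ip_trig; have tD := totalD L2_trig ip_trig.
rewrite (_ : (fun _ => _) =
  (* [modulate k] carries the exponent with a minus sign, so the difference is [- 2 i sin] times [v]
     and the coefficient is [i / 2]. *)
  ((0 +i* (1 / 2))%C \*o (modulate k v \- modulate (- k) v))).
  by apply: (tZ); rewrite sub_funE; apply: tD; [|apply: tZ]; exact: total_modulate.
apply/funext => x; rewrite /modulate /=.
have -> : - (2 * pi * (k%:~R * x)) = - (2 * pi * k%:~R * x) by ring.
have -> : - (2 * pi * ((- k)%:~R * x)) = 2 * pi * k%:~R * x by rewrite rmorphN; ring.
by apply: complex_ext; rewrite !ReImE !ReIm_realE cosN sinN; field.
Qed.

(* Iterating [s |-> (3 s - s^3) / 2] on [-1, 1] converges to the sign of [s]. *)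
Definition sign_step (s : R) : R := (3 * s - s ^+ 3) / 2.

Lemma sign_step_itv (s : R) : -1 <= s <= 1 -> -1 <= sign_step s <= 1.
Proof.
rewrite /sign_step => /andP[s1 s2]; apply/andP; split; rewrite -subr_ge0.
  rewrite (_ : _ - _ = (1 + s) ^+ 2 * (2 - s) / 2); last by field.
  by rewrite divr_ge0// mulr_ge0 ?sqr_ge0//; lra.
rewrite (_ : _ - _ = (1 - s) ^+ 2 * (2 + s) / 2); last by field.
by rewrite divr_ge0// mulr_ge0 ?sqr_ge0//; lra.
Qed.

Lemma sign_iter_itv n (s : R) : -1 <= s <= 1 -> -1 <= iter n sign_step s <= 1.
Proof. by move=> hs; elim: n => //= n; exact: sign_step_itv. Qed.

Lemma sign_iterN n (s : R) : iter n sign_step (- s) = - iter n sign_step s.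
Proof. by elim: n => //= n ->; rewrite /sign_step; field. Qed.

Lemma sign_iter_gt0 (s : R) : 0 < s <= 1 -> iter n sign_step s @[n --> \oo] --> (1 : R).
Proof.
move=> /andP[s0 s1].
(* The iterates never fall below [s], so each step multiplies the distance to 1 by at most
   [1 - s / 2]. *)
have rate n : s <= iter n sign_step s <= 1 /\
    1 - iter n sign_step s <= (1 - s / 2) ^+ n.
  elim: n => [|n] /=; first by rewrite lexx s1 expr0; split => //; lra.
  set t := iter n _ _ => -[/andP[st t1] ht].
  have E : 1 - sign_step t = (1 - t) * (1 - (t + t ^+ 2) / 2).
    by rewrite /sign_step; field.
  have st' : s <= sign_step t.
    have : t <= sign_step t by rewrite /sign_step; nra.
    exact: le_trans.
  have := @sign_step_itv t; rewrite t1 => /(_ ltac:(lra)) /andP[_ ss].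
  split; first by rewrite st' ss.
  by rewrite -/(sign_step t) E [in leRHS]exprSr; apply: ler_pM => //; nra.
apply/cvgrPdist_le => e e0.
have : (1 - s / 2) ^+ n @[n --> \oo] --> (0 : R).
  by apply: cvg_expr; rewrite ger0_norm; lra.
move=> /cvgrPdist_le /(_ _ e0); apply: filterS => n /=.
have [/andP[_ t1] ht] := rate n.
rewrite sub0r normrN !ger0_norm ?subr_ge0// ?exprn_ge0//; last by lra.
exact: le_trans.
Qed.

Lemma multiplier_gt0 w : multiplier w -> (forall x, -1 <= w x <= 1) ->
  multiplier (fun x => (0 < w x)%R%:R).
Proof.
move=> hw bw; have [mw _ _] := hw.
have hstep u : multiplier u -> multiplier (fun x => sign_step (u x)).
  move=> hu; rewrite (_ : (fun _ => _) =
    (fun x => (3 / 2) * u x + (- (1 / 2)) * (u x * (u x * u x)))).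
    exact: multiplierD (multiplierZ _ hu)
      (multiplierZ _ (multiplierM hu (multiplierM hu hu))).
  by apply/funext => x; rewrite /sign_step; field.
have hiter n : multiplier (fun x => iter n sign_step (w x)).
  by elim: n => [|n IH] /=; [exact: hw | exact: hstep IH].
have cvs x : iter n sign_step (w x) @[n --> \oo] --> Num.sg (w x).
  have /andP[w1 w2] := bw x.
  have [w0|w0|w0] := ltrgt0P (w x).
  - by rewrite gtr0_sg//; apply: sign_iter_gt0; rewrite w0.
  - rewrite ltr0_sg//.
    under eq_fun do rewrite -[w x]opprK sign_iterN.
    by apply: cvgN; apply: sign_iter_gt0; rewrite oppr_gt0 w0; lra.
  - rewrite w0 sgr0 (_ : (fun _ => _) = (fun=> 0)); first exact: cvg_cst.
    by apply/funext => n; elim: n => //= n ->; rewrite /sign_step; field.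
have msg : measurable_fun [set: Rm] (fun x => Num.sg (w x)).
  apply: (@measurable_fun_cvg _ _ _ _ (fun n x => iter n sign_step (w x))).
    by move=> n; have [] := hiter n.
  by move=> x _; exact: cvs.
have hsg : multiplier (fun x => Num.sg (w x)).
  apply: (multiplier_lim (C := 1) hiter) => //.
  - by move=> n x; rewrite ler_norml sign_iter_itv.
  - by move=> x; rewrite normr_sg; case: (_ != _).
(* For a sign [s], [(s + s^2) / 2] is 1 when [s = 1] and 0 when [s] is 0 or -1. *)
rewrite (_ : (fun _ => _) =
    (fun x => (1 / 2) * (Num.sg (w x) + Num.sg (w x) * Num.sg (w x)))).
  exact: multiplierZ (multiplierD hsg (multiplierM hsg hsg)).
apply/funext => x; have [w0|w0|->] := ltrgt0P (w x).
- by rewrite gtr0_sg//=; field.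
- by rewrite ltr0_sg//=; field.
- by rewrite sgr0 /=; field.
Qed.

(* On the interval, [t < x] is decided by the signs of [sin (2 pi x)] and of
   [cos (2 pi t) - cos (2 pi x)]. *)
Lemma multiplier_ray (t : R) : multiplier \1_(`]t, +oo[%classic : set Rm).
Proof.
have mray : measurable_fun [set: Rm] (\1_(`]t, +oo[%classic : set Rm) : Rm -> R).
  by apply: measurable_indic; exact: measurable_itv.
have bray : exists C, forall x, `|\1_(`]t, +oo[%classic : set Rm) x| <= C :> R.
  by exists 1 => x; rewrite indicE; case: (_ \in _); rewrite ?normr1 ?normr0.
have rayE (x : R) : (\1_(`]t, +oo[%classic : set Rm) x = (t < x)%R%:R :> R).
  rewrite indicE; have [tx|tx] := ltP t x.
    by rewrite mem_set//= in_itv/= tx.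
  by rewrite memNset//= in_itv/= andbT; apply/negP; rewrite -leNgt.
have pi0 := @pi_gt0 R.
have sgt0 (x : R) : 0 < x -> x < 1 / 2 -> 0 < sin (2 * pi * 1%:~R * x).
  by move=> x0 x1; apply: sin_gt0_pi; apply/andP; split; nra.
have slt0 (x : R) : x < 0 -> - (1 / 2) < x -> sin (2 * pi * 1%:~R * x) < 0.
  move=> x0 x1; rewrite -oppr_gt0 -sinN -mulrN; apply: sgt0; lra.
have cmono (x y : R) : 0 <= x <= 1 / 2 -> 0 <= y <= 1 / 2 ->
    (cos (2 * pi * 1%:~R * x) < cos (2 * pi * 1%:~R * y)) = (y < x).
  move=> /andP[x0 x1] /andP[y0 y1]; rewrite ltr_cos; first by rewrite ltr_pM2l; nra.
    by rewrite in_itv /=; apply/andP; split; nra.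
  by rewrite in_itv /=; apply/andP; split; nra.
have cosb (x : R) : -1 <= cos x <= 1 by rewrite cos_geN1 cos_le1.
have sinb (x : R) : -1 <= sin x <= 1 by rewrite sin_geN1 sin_le1.
have mS := multiplier_sin 1; have mC := multiplier_cos 1.
(* A threshold outside the interval gives a ray that is constant on it. *)
have [t1|t1] := leP (1 / 2) t.
  apply: (multiplier_ext _ mray bray (multiplier_cst 0)) => x.
  rewrite /unit_itv /= in_itv /= => /andP[x1 x2]; rewrite rayE.
  by rewrite ltNge (le_trans (ltW x2) t1).
have [t2|t2] := leP t (- (1 / 2)).
  apply: (multiplier_ext _ mray bray (multiplier_cst 1)) => x.
  rewrite /unit_itv /= in_itv /= => /andP[x1 x2]; rewrite rayE.
  by rewrite (le_lt_trans t2 x1).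
(* For [t >= 0], [t < x] means that [x] is positive and [cos (2 pi x) < cos (2 pi t)], the cosine
   being decreasing there. The factor 1/2 keeps the argument in [-1, 1], as [multiplier_gt0]
   requires. *)
have [t0|t0] := leP 0 t.
  have mP := multiplier_gt0 mS (fun x => sinb _).
  have mW : multiplier (fun x => (0 < 1 / 2 * (cos (2 * pi * 1%:~R * t) +
      -1 * cos (2 * pi * 1%:~R * x)))%R%:R).
    apply: multiplier_gt0.
      exact: multiplierZ (multiplierD (multiplier_cst _) (multiplierZ _ mC)).
    move=> x; have /andP[? ?] := cosb (2 * pi * 1%:~R * t).
    by have /andP[? ?] := cosb (2 * pi * 1%:~R * x); apply/andP; split; lra.
  apply: (multiplier_ext _ mray bray (multiplierM mP mW)) => x.
  rewrite /unit_itv /= in_itv /= => /andP[x1 x2]; rewrite rayE.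
  have -> : (0 < 1 / 2 * (cos (2 * pi * 1%:~R * t) + -1 * cos (2 * pi * 1%:~R * x)))
    = (cos (2 * pi * 1%:~R * x) < cos (2 * pi * 1%:~R * t)).
    by apply/idP/idP; lra.
  have [x0|x0] := ltP 0 x; last first.
    rewrite [t < x]ltNge (le_trans x0 t0) /= (_ : (0 < _) = false) ?mul0r//.
    apply/negbTE; rewrite -leNgt; move: x0; rewrite le_eqVlt => /predU1P[->|x0].
      by rewrite mulr0 sin0.
    by rewrite ltW// slt0.
  by rewrite sgt0// mul1r cmono//; apply/andP; split; lra.
(* For [t < 0] the complement is the product: [x <= t] means that [x] is negative and not
   [cos (2 pi t) < cos (2 pi x)]. *)
have mP : multiplier (fun x => (0 < -1 * sin (2 * pi * 1%:~R * x))%R%:R).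
  apply: (multiplier_gt0 (multiplierZ _ mS)) => x.
  by have /andP[? ?] := sinb (2 * pi * 1%:~R * x); apply/andP; split; lra.
have mW : multiplier (fun x => (0 < 1 / 2 * (- cos (2 * pi * 1%:~R * t) +
    cos (2 * pi * 1%:~R * x)))%R%:R).
  apply: multiplier_gt0.
    exact: multiplierZ (multiplierD (multiplier_cst _) mC).
  move=> x; have /andP[? ?] := cosb (2 * pi * 1%:~R * t).
  by have /andP[? ?] := cosb (2 * pi * 1%:~R * x); apply/andP; split; lra.
apply: (multiplier_ext _ mray bray (multiplierD (multiplier_cst 1) (multiplierZ (-1)
  (multiplierM mP (multiplierD (multiplier_cst 1) (multiplierZ (-1) mW)))))) => x.
rewrite /unit_itv /= in_itv /= => /andP[x1 x2]; rewrite rayE.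
have -> : (0 < 1 / 2 * (- cos (2 * pi * 1%:~R * t) + cos (2 * pi * 1%:~R * x)))
  = (cos (2 * pi * 1%:~R * t) < cos (2 * pi * 1%:~R * x)).
  by apply/idP/idP; lra.
have [x0|x0] := leP 0 x.
  rewrite (lt_le_trans t0 x0) (_ : (0 < _) = false) ?mul0r ?mulr0 ?addr0//.
  apply/negbTE; rewrite -leNgt mulN1r oppr_le0; move: x0.
  rewrite le_eqVlt => /predU1P[<-|x0]; first by rewrite mulr0 sin0.
  by rewrite ltW// sgt0.
have -> : 0 < -1 * sin (2 * pi * 1%:~R * x) by rewrite mulN1r oppr_gt0 slt0.
rewrite -[cos (_ * t)]cosN -[cos (_ * x)]cosN -!mulrN cmono; first last.
- by apply/andP; split; lra.
- by apply/andP; split; lra.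
by rewrite ltrN2; case: (t < x) => /=; ring.
Qed.

Lemma multiplier_indic (E : set Rm) : measurable E -> multiplier \1_E.
Proof.
move=> mE; suff [] : measurable E /\ multiplier \1_E by [].
(* The open rays generate the Borel sets, so it is enough that the measurable sets whose indicator
   is a multiplier form a sigma-algebra containing the rays. *)
have hE : (RGenOInfty.G (R:=R)).-sigma.-measurable E.
  by rewrite -RGenOInfty.measurableE.
have mI (A : set Rm) : measurable A ->
    measurable_fun [set: Rm] (\1_A : Rm -> R) /\
    (forall x, `|\1_A x| <= 1 :> R).
  move=> mA; split; first exact: measurable_indic.
  by move=> x; rewrite indicE; case: (_ \in _); rewrite ?normr1 ?normr0.
apply: (hE (fun E : set Rm => measurable E /\ multiplier \1_E)); split; last first.
  by move=> _ [t ->]; split; [exact: measurable_itv | exact: multiplier_ray].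
have U A B : multiplier \1_A -> multiplier \1_B -> multiplier \1_(A `|` B : set Rm).
  move=> hA hB; rewrite (_ : (\1_(A `|` B) : Rm -> R) =
    (fun x => (\1_A x + \1_B x) + (-1) * (\1_A x * \1_B x))).
    exact: multiplierD (multiplierD hA hB) (multiplierZ _ (multiplierM hA hB)).
  apply/funext => x; rewrite !indicE in_setU.
  by case: (x \in A); case: (x \in B) => /=; ring.
split.
- split; first exact: measurable0.
  by rewrite indic0; exact: multiplier_cst.
- move=> A [mA hA]; split; first exact: measurableD.
  rewrite (_ : \1__ = (fun x => 1 + (-1) * \1_A x)).
    exact: multiplierD (multiplier_cst 1) (multiplierZ _ hA).
  apply/funext => x; rewrite !indicE in_setD in_setT /=.
  by case: (x \in A) => /=; ring.
- move=> A hA.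
  have mA n : measurable (A n) by case: (hA n).
  have mU : measurable (\bigcup_k A k) by exact: bigcupT_measurable.
  split => //.
  have mUn n : measurable (\big[setU/set0]_(k < n) A k).
    by apply: bigsetU_measurable.
  have hUn n : multiplier \1_(\big[setU/set0]_(k < n) A k).
    elim: n => [|n IH]; first by rewrite big_ord0 indic0; exact: multiplier_cst.
    by rewrite big_ord_recr /=; apply: U IH _; case: (hA n).
  apply: (multiplier_lim (C := 1) hUn).
  + by move=> n; exact: (mI _ (mUn n)).2.
  + exact: (mI _ mU).1.
  + exact: (mI _ mU).2.
  + move=> x _; have [[k _ Akx]|nx] := pselect ((\bigcup_k A k) x).
      rewrite (_ : \1_(\bigcup_k A k) x = 1); last by rewrite indicE mem_set//; exists k.
      apply: cvg_near_cst; exists k.+1 => // n /= kn.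
      rewrite indicE mem_set// -bigcup_mkord; exists k => //.
    rewrite (_ : \1_(\bigcup_k A k) x = 0); last by rewrite indicE memNset.
    apply: cvg_near_cst; exists 0%N => // n _ /=.
    rewrite indicE memNset// -bigcup_mkord => -[j _ Ajx]; apply: nx; by exists j.
Qed.

Import HBNNSimple.

Lemma multiplier_nnsfun (h : {nnsfun Rm >-> R}) : multiplier (h : Rm -> R).
Proof.
rewrite (_ : (h : Rm -> R) = (fun x => \sum_(y <- finmap.enum_fset (fset_set (range h)))
   y * \1_(h @^-1` [set y]) x)); last first.
  by apply/funext => x; rewrite fimfunE fsbig_finite.
elim: finmap.enum_fset => [|y s IH].
  under eq_fun do rewrite big_nil; exact: multiplier_cst.
under eq_fun do rewrite big_cons.
apply: multiplierD IH; apply: multiplierZ; apply: multiplier_indic.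
exact: measurable_sfunP.
Qed.

Lemma trig0 x : trig 0 x = (chi x)%:C%C.
Proof. by rewrite /trig mul0r mulr0 oppr0 expi0 mulr1. Qed.

(** Simple functions times [trig 0] are total by the multiplier property, and those increasing to
    [f] converge in L^2, dominated by [f^2]. *)
Lemma total_trig_ge0 (f : Rm -> R) : measurable_fun [set: Rm] f ->
  (forall x, 0 <= f x) -> (forall x, ~ unit_itv x -> f x = 0) ->
  L2 mu (fun x => (f x)%:C%C) -> tot (fun x => (f x)%:C%C).
Proof.
move=> mf f0 fI Lf.
have mfE : measurable_fun [set: Rm] (EFin \o f) by exact/measurable_EFinP.
pose h n : Rm -> R := nnsfun_approx measurableT mfE n.
have h0 n x : 0 <= h n x by exact: fun_ge0.
have hf n x : h n x <= f x.
  rewrite -lee_fin /h nnsfun_approxE.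
  by apply: (@le_approx _ _ _ setT (EFin \o f)) => // y _; rewrite lee_fin.
have hc x : h n x @[n --> \oo] --> f x.
  have fE y : [set: Rm] y -> (0 <= (EFin \o f) y)%E by rewrite lee_fin.
  exact: fine_cvg (cvg_nnsfun_approx measurableT mfE fE I).
have th n : tot (fun x => (h n x)%:C%C * trig 0 x).
  have [_ _ H] := multiplier_nnsfun (nnsfun_approx measurableT mfE n).
  apply: H; last exact: total_basis L2_trig ip_trig 0.
  by move=> x /chi_out x0; rewrite trig0 x0.
apply: (total_closed L2_trig ip_trig Lf).
have E n x : normsq ((f x)%:C%C - (h n x)%:C%C * trig 0 x) = (f x - h n x * chi x) ^+ 2.
  by rewrite trig0 -rmorphM -rmorphB normsq_realc.
have /cvg0_exists_lt H : n2 mu ((fun x => (f x)%:C%C) \-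
    (fun x => (h n x)%:C%C * trig 0 x)) @[n --> \oo] --> 0.
  apply: (n2_dominated (u_ := fun n x => (h n x)%:C%C * trig 0 x) _ _ (L2_integrable Lf)).
  - by case: Lf.
  - by move=> n; have [[]] := th n.
  - move=> n x; rewrite E normsq_realc.
    have := h0 n x; have := hf n x; have := chi_ge0 x; have := chi_le1 x.
    have := f0 x => a1 a2 a3 a4 a5.
    have b1 : 0 <= h n x * chi x by exact: mulr_ge0.
    have b2 : h n x * chi x <= h n x by rewrite ler_piMr.
    by nra.
  - move=> x; under eq_fun do rewrite E.
    have [/chi_in ->|xI] := pselect (unit_itv x); last first.
      rewrite (fI _ xI) (chi_out xI); under eq_fun do rewrite mulr0 subrr expr0n.
      exact: cvg_cst.
    under eq_fun do rewrite mulr1 expr2.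
    suff : (f x - h n x) * (f x - h n x) @[n --> \oo] --> (f x - f x) * (f x - f x).
      by rewrite subrr mul0r.
    by apply: cvgM; apply: cvgB; do ?[exact: cvg_cst | exact: hc].
by move=> x /H[n hn]; exists (fun x => (h n x)%:C%C * trig 0 x).
Qed.

Lemma total_trig_real (f : Rm -> R) : measurable_fun [set: Rm] f ->
  (forall x, ~ unit_itv x -> f x = 0) ->
  L2 mu (fun x => (f x)%:C%C) -> tot (fun x => (f x)%:C%C).
Proof.
move=> mf fI Lf.
(* The signs [s = 1] and [s = -1] give the positive and the negative part. *)
have key (s : R) : s * s = 1 -> tot (fun x => (Num.max (s * f x) 0)%:C%C).
  move=> s1; have mg : measurable_fun [set: Rm] (fun x => Num.max (s * f x) 0).
    by apply: measurable_maxr; [exact: measurable_funM | exact: measurable_cst].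
  apply: total_trig_ge0 => //.
  - by move=> x; rewrite le_max lexx orbT.
  - by move=> x /fI ->; rewrite mulr0 maxxx.
  - apply: (L2_le (cmfun_realc mg) (L2_integrable Lf)) => x.
    rewrite !normsq_realc; have : f x ^+ 2 = (s * f x) ^+ 2.
      by rewrite exprMn (expr2 s) s1 mul1r.
    move=> ->; have [h|h] := leP (s * f x) 0; last by [].
    by rewrite expr0n sqr_ge0.
rewrite (_ : (fun _ => _) = (fun x => (Num.max (1 * f x) 0)%:C%C) \+
    ((-1) \*o (fun x => (Num.max (-1 * f x) 0)%:C%C))).
  apply: (totalD L2_trig ip_trig); first by apply: key; rewrite mulr1.
  by apply: (totalZ L2_trig ip_trig); apply: key; rewrite mulrNN mulr1.
apply/funext => x; rewrite /= mul1r mulN1r.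
rewrite mulN1r -rmorphN -rmorphD /=; congr (_ %:C)%C.
by have [h|h] := leP (f x) 0; [rewrite (max_l _) | rewrite (max_r _)]; lra.
Qed.

Lemma total_trig v : L2 mu v -> (forall x, ~ unit_itv x -> v x = 0) -> tot v.
Proof.
move=> Lv v0; have [[mr mi] _] := Lv.
have tr : tot (fun x => (complex.Re (v x))%:C%C).
  apply: total_trig_real => //; first by move=> x /v0 ->.
  apply: (L2_le (cmfun_realc mr) (L2_integrable Lv)) => x.
  by rewrite normsq_realc lerDl sqr_ge0.
have ti : tot (fun x => (complex.Im (v x))%:C%C).
  apply: total_trig_real => //; first by move=> x /v0 ->.
  apply: (L2_le (cmfun_realc mi) (L2_integrable Lv)) => x.
  by rewrite normsq_realc lerDr sqr_ge0.
rewrite (_ : v = (fun x => (complex.Re (v x))%:C%C) \+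
    ((0 +i* 1)%C \*o (fun x => (complex.Im (v x))%:C%C))).
  by apply: (totalD L2_trig ip_trig) => //; exact: (totalZ L2_trig ip_trig).
by apply/funext => x; rewrite [LHS]complexE.
Qed.

Lemma trig_parseval v : L2 mu v -> (forall x, ~ unit_itv x -> v x = 0) ->
  (\esum_(k in [set: int]) (normsq (ip mu v (trig k)))%:E = normsqL2 mu v)%E.
Proof.
move=> Lv v0; rewrite -n2E//.
exact: (orthonormal_parseval L2_trig ip_trig (total_trig Lv v0)).
Qed.

End TrigSystem.
(** * Fubini and changes of variables *)

Section CountableSums.
Local Open Scope ereal_scope.
Context {R : realType}.

(** Enumerating the index type turns the sum into a series, to which monotone convergence for series
    applies. *)
Lemma esum_countE (J : countType) (a : J -> \bar R) : (forall j, 0 <= a j) ->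
  \esum_(j in [set: J]) a j =
  \sum_(n <oo) (if @pickle_inv J n is Some j then a j else 0).
Proof.
move=> a0; pose b (n : nat) : \bar R := if @pickle_inv J n is Some j then a j else 0.
have b0 n : 0 <= b n by rewrite /b; case: pickle_inv.
rewrite [RHS](nneseries_esumT b0).
have -> : \esum_(n in [set: nat]) b n = \esum_(n in range (@pickle J)) b n.
  rewrite [RHS]esum_mkcond; apply: eq_esum => n _; case: ifPn => //.
  rewrite notin_setE /b => hn; have := @pickle_invK J n.
  by case: pickle_inv => //= j hj; exfalso; apply: hn; exists j.
rewrite (reindex_esum [set: J] _ (@pickle J)).
  by apply: eq_esum => j _; rewrite /b pickleK_inv.
split; [by move=> j _; exists j | | by move=> n [j _ <-]; exists j].
by move=> x y _ _; exact: (pcan_inj (@pickleK J)).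
Qed.

Lemma measurable_esum (J : countType) d (T : measurableType d) (a : J -> T -> \bar R) :
  (forall j, measurable_fun setT (a j)) -> (forall j x, 0 <= a j x) ->
  measurable_fun setT (fun x => \esum_(j in [set: J]) a j x).
Proof.
move=> ma a0; under eq_fun do rewrite esum_countE//.
apply: ge0_emeasurable_sum => [n x _ _|n _]; first by case: pickle_inv.
by case: pickle_inv => //; exact: measurable_cst.
Qed.

Lemma integral_esum (J : countType) d (T : measurableType d)
    (m : {measure set T -> \bar R}) (a : J -> T -> \bar R) :
  (forall j, measurable_fun setT (a j)) -> (forall j x, 0 <= a j x) ->
  \int[m]_x (\esum_(j in [set: J]) a j x) = \esum_(j in [set: J]) (\int[m]_x a j x).
Proof.
move=> ma a0; under eq_integral do rewrite esum_countE//.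
rewrite esum_countE; last by move=> j; exact: integral_ge0.
rewrite integral_nneseries//.
- by apply: eq_eseriesr => n _; case: pickle_inv => // ; rewrite integral0.
- by move=> n; case: pickle_inv => //; exact: measurable_cst.
- by move=> n x _; case: pickle_inv.
Qed.

Lemma esum_pair (J K : choiceType) (a : J * K -> \bar R) : (forall p, 0 <= a p) ->
  \esum_(p in [set: J * K]) a p =
  \esum_(j in [set: J]) \esum_(k in [set: K]) a (j, k).
Proof.
move=> a0; rewrite (@esum_esum _ _ _ setT (fun=> setT) (fun j k => a (j, k)))//.
rewrite (_ : setT `*`` _ = setT); last by apply/seteqP; split.
by apply: eq_esum => -[].
Qed.

Lemma esum_single (J : choiceType) (a : J -> \bar R) (j0 : J) :
  0 <= a j0 -> (forall j, j != j0 -> a j = 0) -> \esum_(j in [set: J]) a j = a j0.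
Proof.
move=> a0 aj; rewrite -[RHS](esum_set1 a0) [RHS]esum_mkcond.
apply: eq_esum => j _; case: ifPn => //; rewrite notin_setE => h.
by apply: aj; apply/eqP.
Qed.

End CountableSums.

Section ComplexFubini.
Context d1 d2 (T1 : measurableType d1) (T2 : measurableType d2) (R : realType).

(** Sections need not be integrable, so the positive and negative parts are handled separately by
    Tonelli. This covers Fourier coefficients of sections and the Fourier integral as functions of a
    parameter. *)
Lemma measurable_fine_fubini (m2 : {sigma_finite_measure set T2 -> \bar R})
    (g : T1 * T2 -> R) : measurable_fun setT g ->
  measurable_fun setT (fun x => Rintegral m2 setT (fun y => g (x, y))).
Proof.
move=> mg; have mgE : measurable_fun setT (EFin \o g) by exact/measurable_EFinP.
apply: (measurableT_comp (fine_measurable measurableT)).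
under eq_fun do rewrite integralE.
apply: emeasurable_funB.
  rewrite (_ : (fun _ => _) = fubini_F m2 (EFin \o g)^\+%E).
    apply: measurable_fun_fubini_tonelli_F; first exact: measurable_funepos.
    by move=> x; exact: funepos_ge0.
  by apply/funext => x; apply: eq_integral => y _;
    rewrite -[LHS]/(((EFin \o g) \o pair x)^\+%E y) funepos_comp.
rewrite (_ : (fun _ => _) = fubini_F m2 (EFin \o g)^\-%E).
  apply: measurable_fun_fubini_tonelli_F; first exact: measurable_funeneg.
  by move=> x; exact: funeneg_ge0.
by apply/funext => x; apply: eq_integral => y _;
  rewrite -[LHS]/(((EFin \o g) \o pair x)^\-%E y) funeneg_comp.
Qed.

Lemma cmfun_fubini (m2 : {sigma_finite_measure set T2 -> \bar R})
    (f : T1 * T2 -> R[i]) : cmfun f ->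
  cmfun (fun x => cint m2 (fun y => f (x, y))).
Proof.
move=> [mr mi]; split => /=.
  exact: (measurable_fine_fubini m2 mr).
exact: (measurable_fine_fubini m2 mi).
Qed.

Variables (m1 : {sigma_finite_measure set T1 -> \bar R})
  (m2 : {sigma_finite_measure set T2 -> \bar R}).

Lemma Rintegral_fubini (g : T1 * T2 -> R) :
  (m1 \x m2)%E.-integrable setT (EFin \o g) ->
  Rintegral (m1 \x m2)%E setT g =
  Rintegral m1 setT (fun x => Rintegral m2 setT (fun y => g (x, y))).
Proof.
move=> ig; rewrite /Rintegral -(integral12_prod_meas1 ig); congr fine.
(* The inner integral is finite only almost everywhere; on the exceptional null set [fine] returns
   its default value. *)
have iF := integrable_fubini_F ig.
have mF := measurable_int _ iF.
apply: ae_eq_integral => //.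
  by apply/measurable_EFinP; exact: (measurableT_comp (fine_measurable measurableT)).
have := integrable_ae measurableT iF.
by apply: filterS => x /(_ I) h _; rewrite /fubini_F /= fineK.
Qed.

Lemma cint_fubini (f : T1 * T2 -> R[i]) : cintegrable (m1 \x m2)%E f ->
  cint (m1 \x m2)%E f = cint m1 (fun x => cint m2 (fun y => f (x, y))).
Proof. by move=> [ir ii]; rewrite /cint /= !Rintegral_fubini. Qed.

End ComplexFubini.

(** * Parseval's identity on the two-dimensional torus *)

Section Torus.
Context {R : realType}.
Local Notation mu := (@lebesgue_measure R).
Local Notation Rm := (measurableTypeR R).
Local Notation mu2 := (@leb2 R).
Implicit Types f : Rm * Rm -> R[i].

Definition trig2 (k : int * int) (p : Rm * Rm) : R[i] :=
  trig k.1 p.1 * trig k.2 p.2.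

Lemma cmfun_fst (u : Rm -> R[i]) : cmfun u -> cmfun (fun p : Rm * Rm => u p.1).
Proof.
by move=> [mr mi]; split; [exact: (measurableT_comp mr measurable_fst) |
  exact: (measurableT_comp mi measurable_fst)].
Qed.

Lemma cmfun_snd (u : Rm -> R[i]) : cmfun u -> cmfun (fun p : Rm * Rm => u p.2).
Proof.
by move=> [mr mi]; split; [exact: (measurableT_comp mr measurable_snd) |
  exact: (measurableT_comp mi measurable_snd)].
Qed.

Lemma cmfun_trig2 k : cmfun (trig2 k).
Proof.
by apply: cmfunM; [exact/cmfun_fst/cmfun_trig | exact/cmfun_snd/cmfun_trig].
Qed.

Lemma normsq_trig2 k p : normsq (trig2 k p) = chi p.1 * chi p.2.
Proof. by rewrite normsqM !normsq_trig. Qed.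

Lemma normsqL2_fubini f : cmfun f ->
  normsqL2 mu2 f = (\int[mu]_x normsqL2 mu (fun y => f (x, y)))%E.
Proof.
move=> mf; rewrite /normsqL2 /leb2 fubini_tonelli1//.
  exact: cmfun_normsqE.
by move=> x; rewrite lee_fin normsq_ge0.
Qed.

Lemma L2_trig2 k : L2 mu2 (trig2 k).
Proof.
split; first exact: cmfun_trig2.
rewrite normsqL2_fubini; last exact: cmfun_trig2.
have E x : normsqL2 mu (fun y => trig2 k (x, y)) = (chi x)%:E.
  rewrite /normsqL2; under eq_integral do rewrite normsq_trig2 /= EFinM.
  rewrite ge0_integralZl_EFin//.
  - rewrite (_ : (\int[_]_x _)%E = 1%E) ?mule1//.
    have h : normsqL2 mu (trig 0) = 1%E by rewrite -(n2E (L2_trig 0)) -Re_ipff ip_trig.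
    by rewrite -[RHS]h; apply: eq_integral => y _; rewrite normsq_trig.
  - by move=> y _; rewrite lee_fin; exact: chi_ge0.
  - by apply/measurable_EFinP; exact: measurable_chi.
under eq_integral do rewrite E.
exact: integrable_lty integrable_chi.
Qed.

Lemma cmfun_section f x : cmfun f -> cmfun (fun y => f (x, y)).
Proof.
by move=> [mr mi]; split; [exact: measurable_fun_pair2 mr | exact: measurable_fun_pair2 mi].
Qed.

(** The one-dimensional identity is used twice: in the second variable on almost every section, then
    in the first variable on each coefficient function [c k2]. *)
Theorem torus_parseval f : L2 mu2 f ->
  (forall p, ~ (unit_itv p.1 /\ unit_itv p.2) -> f p = 0) ->
  (\esum_(k in [set: int * int]) (normsq (ip mu2 f (trig2 k)))%:E = normsqL2 mu2 f)%E.
Proof.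
move=> Lf f0; have [mf ff] := Lf.
have ae_L2 : {ae mu, forall x, L2 mu (fun y => f (x, y))}.
  have := ae_integrable1 (L2_integrable Lf); apply: filterS => x ix.
  split; first exact: cmfun_section.
  by apply: integrable_lty ix.
pose c k2 : Rm -> R[i] := fun x => ip mu (fun y => f (x, y)) (trig k2).
have mc k2 : cmfun (c k2).
  apply: (cmfun_fubini _ (f := fun p => f p * ((trig k2 p.2)^*)%C)).
  by apply: cmfunM => //; apply: cmfun_conj; exact/cmfun_snd/cmfun_trig.
have f0y x y : ~ unit_itv y -> f (x, y) = 0 by move=> hy; apply: f0 => -[].
have parc : {ae mu, forall x, (\esum_(k2 in [set: int]) (normsq (c k2 x))%:E =
    normsqL2 mu (fun y => f (x, y)))%E}.
  apply: filterS ae_L2 => x Lx; apply: trig_parseval => // y; exact: f0y.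
(* A single coefficient is bounded by the whole Parseval sum of its section, whose integral is the
   squared norm of [f]. *)
have Lc k2 : L2 mu (c k2).
  split; first exact: mc.
  apply: le_lt_trans ff; rewrite normsqL2_fubini//.
  apply: ae_ge0_le_integral => //.
  - by move=> x _; rewrite lee_fin normsq_ge0.
  - exact: cmfun_normsqE.
  - by move=> x _; exact: normsqL2_ge0.
  - apply: (measurable_fun_fubini_tonelli_F (fun p => (normsq (f p))%:E)).
      exact: cmfun_normsqE.
    by move=> p; rewrite lee_fin normsq_ge0.
  apply: filterS parc => x <- _.
  by apply: esum_ge; exists [set k2]; [split | rewrite fsbig_set1].
have c0 k2 x : ~ unit_itv x -> c k2 x = 0.
  move=> hx; rewrite /c /ip (eq_cint _ (g := fun=> 0)) ?cint0// => y.
  by rewrite f0 ?mul0r// => -[].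
have E k : ip mu2 f (trig2 k) = ip mu (c k.2) (trig k.1).
  rewrite /ip /leb2 cint_fubini; last exact: L2_ip Lf (L2_trig2 k).
  apply: cint_ae_eq.
  - apply: (cmfun_fubini _ (f := fun p => f p * ((trig2 k p)^*)%C)).
    by apply: cmfunM => //; apply: cmfun_conj; exact: cmfun_trig2.
  - by apply: cmfunM => //; apply: cmfun_conj; exact: cmfun_trig.
  apply: filterS ae_L2 => x Lx; rewrite /c /ip mulrC -cintZ; last exact: L2_ip Lx (L2_trig _).
  by apply: eq_cint => y; rewrite /trig2 conjcM; exact: mulrCA.
under eq_esum do rewrite E.
(* Exchanging the indices makes the inner sum run over the first frequency with [k2] fixed, which is
   the identity for [c k2]. *)
have swap_bij : set_bij [set: int * int] [set: int * int] (fun k => (k.2, k.1)).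
  split; [by [] | by move=> [a b] [c' d] _ _ [-> ->] | by move=> [a b] _; exists (b, a)].
rewrite (reindex_esum _ _ _ _ swap_bij) /=.
rewrite (esum_pair (a := fun k => (normsq (ip mu (c k.1) (trig k.2)))%:E)); last first.
  by move=> k; rewrite lee_fin normsq_ge0.
under eq_esum do rewrite /= (trig_parseval (Lc _) (c0 _)).
rewrite /normsqL2 -integral_esum.
- rewrite [RHS]normsqL2_fubini//; apply: ge0_ae_eq_integral => //.
  + apply: measurable_esum => [k|k x]; first exact: cmfun_normsqE.
    by rewrite lee_fin normsq_ge0.
  + apply: (measurable_fun_fubini_tonelli_F (fun p => (normsq (f p))%:E)).
      exact: cmfun_normsqE.
    by move=> p; rewrite lee_fin normsq_ge0.
  + by move=> x _; apply: esum_ge0 => k _; rewrite lee_fin normsq_ge0.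
  + by move=> x _; exact: normsqL2_ge0.
  + by apply: filterS parc => x h _; exact: h.
- by move=> k; exact: cmfun_normsqE.
- by move=> k x; rewrite lee_fin normsq_ge0.
Qed.

End Torus.

(** * Affine changes of variables *)

Section AffineChange.
Context {R : realType}.
Local Notation mu := (@lebesgue_measure R).
Local Notation Rm := (measurableTypeR R).
Local Notation mu2 := (@leb2 R).

Lemma measurable_affine (c b : R) : measurable_fun [set: Rm] (fun x : Rm => c * x + b : Rm).
Proof.
apply: measurable_funD; last exact: measurable_cst.
exact: mulrl_measurable.
Qed.

(** The pushforward of Lebesgue measure under the affine map, scaled by [c], has the right value on
    half-open intervals, hence is Lebesgue measure by uniqueness. *)
Lemma ge0_integral_affine (c b : R) (F : Rm -> \bar R) : 0 < c ->
  measurable_fun setT F -> (forall x, 0 <= F x)%E ->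
  (\int[mu]_x F (c * x + b)%R = (c^-1)%:E * \int[mu]_x F x)%E.
Proof.
move=> c0 mF F0; have cN : c != 0 by rewrite gt_eqF.
pose phi (x : Rm) : Rm := c * x + b.
have mphi : measurable_fun setT phi by exact: measurable_affine.
have ci0 : 0 <= c^-1 by rewrite invr_ge0 ltW.
have [nu0 nu0E] : exists nu0 : {measure set Rm -> \bar R},
    forall A, nu0 A = pushforward mu phi A.
  by unshelve eexists (pushforward mu phi : {measure set Rm -> \bar R}).
have -> : (\int[mu]_x F (c * x + b)%R = \int[nu0]_x F x)%E.
  rewrite -[LHS](ge0_integral_pushforward mphi mu (D := setT) (f := F))//.
  by apply: eq_measure_integral => A _ _; rewrite nu0E.
pose nu : {measure set Rm -> \bar R} := mscale (NngNum (ltW c0)) nu0.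
have muE A : measurable A -> mu A = nu A.
  apply: (lebesgue_measure_unique (mu := nu)) => _ [[u v] _ <-].
  rewrite /nu /= /mscale nu0E /pushforward /=.
  have -> : phi @^-1` `]u, v]%classic = `](u - b) / c, (v - b) / c]%classic.
    apply/seteqP; split => x /=; rewrite !in_itv /= /phi => /andP[h1 h2];
    apply/andP; split.
    - by rewrite ltr_pdivrMr// ltrBlDr mulrC.
    - by rewrite ler_pdivlMr// lerBrDr mulrC.
    - by move: h1; rewrite ltr_pdivrMr// ltrBlDr mulrC.
    - by move: h2; rewrite ler_pdivlMr// lerBrDr mulrC.
  rewrite !lebesgue_measure_itv /= !lte_fin ltr_pM2r ?invr_gt0// ltrD2r.
  case: ifPn => uv; last by rewrite mule0.
  by rewrite -!EFinD -EFinM; congr EFin; field.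
have -> : (\int[mu]_x F x = \int[nu]_x F x)%E.
  by apply: eq_measure_integral => A mA _; exact: muE.
by rewrite ge0_integral_mscale//= muleA -EFinM mulVf// mul1e.
Qed.

Definition affine (c : R) (b : R * R) (p : Rm * Rm) : Rm * Rm :=
  (c * p.1 + b.1, c * p.2 + b.2).

Lemma measurable_fun_affine (c : R) b : measurable_fun setT (affine c b).
Proof.
apply: measurable_fun_pair.
  exact: (measurableT_comp (measurable_affine c b.1) measurable_fst).
exact: (measurableT_comp (measurable_affine c b.2) measurable_snd).
Qed.

Lemma ge0_integral_affine2 (c : R) b (F : Rm * Rm -> \bar R) : 0 < c ->
  measurable_fun setT F -> (forall x, 0 <= F x)%E ->
  (\int[mu2]_p F (affine c b p) = (c ^- 2)%:E * \int[mu2]_p F p)%E.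
Proof.
move=> c0 mF F0.
have ci0 : 0 <= c^-1 by rewrite invr_ge0 ltW.
rewrite /leb2 fubini_tonelli1//; last first.
  exact: (measurableT_comp mF (measurable_fun_affine c b)).
rewrite [in RHS]fubini_tonelli1//.
have mG := measurable_fun_fubini_tonelli_F (m2 := mu) F mF F0.
have E x : fubini_F mu (F \o affine c b) x = ((c^-1)%:E * fubini_F mu F (c * x + b.1)%R)%E.
  rewrite /fubini_F /affine /=.
  rewrite (ge0_integral_affine b.2 (F := fun y => F (c * x + b.1, y)%R))//.
  exact: measurable_fun_pair2.
have G0 x : (0 <= fubini_F mu F x)%E by apply: integral_ge0.
rewrite -[LHS]/(\int[mu]_x fubini_F mu (F \o affine c b) x)%E.
under eq_integral do rewrite E.
have mGa : measurable_fun [set: Rm] (fun x => fubini_F mu F (c * x + b.1)).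
  exact: (measurableT_comp mG (measurable_affine c b.1)).
rewrite (ge0_integralZl_EFin mu measurableT (fun x _ => G0 _) mGa ci0).
by rewrite (ge0_integral_affine b.1 c0 mG G0) muleA -EFinM -invfM.
Qed.

Lemma cmfun_affine (f : Rm * Rm -> R[i]) c b : cmfun f -> cmfun (f \o affine c b).
Proof.
by move=> [mr mi]; split; [exact: (measurableT_comp mr (measurable_fun_affine c b)) |
  exact: (measurableT_comp mi (measurable_fun_affine c b))].
Qed.

Lemma normsqL2_affine (f : Rm * Rm -> R[i]) c b : 0 < c -> cmfun f ->
  normsqL2 mu2 (f \o affine c b) = ((c ^- 2)%:E * normsqL2 mu2 f)%E.
Proof.
move=> c0 mf.
rewrite /normsqL2 -(ge0_integral_affine2 b (F := fun p => (normsq (f p))%:E))//.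
  exact: cmfun_normsqE.
by move=> p; rewrite lee_fin normsq_ge0.
Qed.

Lemma integrable_affine (g : Rm * Rm -> R) c b : 0 < c ->
  mu2.-integrable setT (EFin \o g) -> mu2.-integrable setT (EFin \o (g \o affine c b)).
Proof.
move=> c0 /integrableP[mg ig]; apply/integrableP; split.
  exact: (measurableT_comp mg (measurable_fun_affine c b)).
rewrite [ltLHS](ge0_integral_affine2 b (F := abse \o (EFin \o g)))//.
  by rewrite lte_mul_pinfty// lee_fin invr_ge0 exprn_ge0// ltW.
  exact: measurableT_comp.
by move=> p; exact: abse_ge0.
Qed.

Lemma Rintegral_affine (g : Rm * Rm -> R) c b : 0 < c ->
  mu2.-integrable setT (EFin \o g) ->
  Rintegral mu2 setT (g \o affine c b) = c ^- 2 * Rintegral mu2 setT g.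
Proof.
move=> c0 ig; have mg := measurable_int _ ig.
rewrite /Rintegral; have E : (\int[mu2]_p ((g \o affine c b) p)%:E =
    (c ^- 2)%:E * \int[mu2]_p (g p)%:E)%E.
  rewrite [in LHS]integralE [in RHS]integralE.
  have h1 := ge0_integral_affine2 b c0 (measurable_funepos mg) (funepos_ge0 _).
  have h2 := ge0_integral_affine2 b c0 (measurable_funeneg mg) (funeneg_ge0 _).
  rewrite -[(fun x => ((g \o affine c b) x)%:E)]/((EFin \o g) \o affine c b).
  rewrite funepos_comp funeneg_comp [X in (X - _)%E]h1 [X in (_ - X)%E]h2.
  rewrite [RHS]muleBr//; apply: fin_num_adde_defr.
  exact: integrable_pos_fin_num.
by rewrite E fineM// ?integrable_fin_num.
Qed.

Lemma cint_affine (f : Rm * Rm -> R[i]) c b : 0 < c -> cintegrable mu2 f ->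
  cint mu2 (f \o affine c b) = (c ^- 2)%:C%C * cint mu2 f.
Proof.
move=> c0 [ir ii]; apply: complex_ext.
  rewrite ReM Re_realc Im_realc mul0r subr0 /=.
  exact: (Rintegral_affine b c0 ir).
rewrite ImM Re_realc Im_realc mul0r addr0 /=.
exact: (Rintegral_affine b c0 ii).
Qed.

Lemma cintegrable_affine (f : Rm * Rm -> R[i]) c b : 0 < c ->
  cintegrable mu2 f -> cintegrable mu2 (f \o affine c b).
Proof.
by move=> c0 [ir ii]; split; [exact: (integrable_affine b c0 ir) |
  exact: (integrable_affine b c0 ii)].
Qed.

(** Allows [leb2] itself to be a factor in Fubini arguments, as in [cmfun_fourierL1]. *)
Lemma sigma_finite_leb2 : sigma_finite setT mu2.
Proof.
exists (fun n => `[- n%:R, n%:R]%classic `*` `[- n%:R, n%:R]%classic).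
  apply/seteqP; split => // -[x y] _.
  exists (Num.truncn (Num.max `|x| `|y|)).+1 => //=.
  have := @truncnS_gt R (Num.max `|x| `|y|).
  rewrite gt_max => /andP[hx hy]; split; rewrite in_itv /= -ler_norml; exact: ltW.
move=> n; split; first by apply: measurableX; exact: measurable_itv.
have -> : mu2 (`[- n%:R, n%:R]%classic `*` `[- n%:R, n%:R]%classic) =
    (mu `[(- n%:R)%R, n%:R%R]%classic * mu `[(- n%:R)%R, n%:R%R]%classic)%E.
  by rewrite /leb2 product_measure1E//; exact: measurable_itv.
rewrite lebesgue_measure_itv /=; case: ifP => _; last by rewrite mule0 ltry.
by rewrite -EFinD -EFinM ltry.
Qed.

HB.instance Definition _ := Measure.on (@leb2 R).
HB.instance Definition _ := Measure_isSigmaFinite.Build _ _ _ (@leb2 R) sigma_finite_leb2.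

End AffineChange.
(** * The Plancherel identity on R^2 *)

Section Plancherel.
Context {R : realType}.
Local Notation mu := (@lebesgue_measure R).
Local Notation Rm := (measurableTypeR R).
Local Notation mu2 := (@leb2 R).
Implicit Types (f g h : Rm * Rm -> R[i]) (p xi : Rm * Rm).

Definition dot p xi : R := p.1 * xi.1 + p.2 * xi.2.

Lemma cmfun_expi d (T : measurableType d) (u : T -> R) : measurable_fun setT u ->
  cmfun (fun t => expi (u t)).
Proof.
move=> mu_; split => /=.
  by apply: (measurableT_comp _ mu_); apply: continuous_measurable_fun; exact: continuous_cos.
by apply: (measurableT_comp _ mu_); apply: continuous_measurable_fun; exact: continuous_sin.
Qed.

Lemma measurable_dot xi : measurable_fun [set: Rm * Rm] (fun p => dot p xi).
Proof.
by apply: measurable_funD; apply: measurable_funM;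
  do ?[exact: measurable_fst | exact: measurable_snd | exact: measurable_cst].
Qed.

Lemma cmfun_modulation (c : R) xi : cmfun (fun p => expi (c * dot p xi)).
Proof.
apply: cmfun_expi; apply: measurable_funM; first exact: measurable_cst.
exact: measurable_dot.
Qed.

Lemma fourierL1E f xi :
  fourierL1 f xi = cint mu2 (fun p => f p * expi (- (2 * pi) * dot p xi)).
Proof. by apply: eq_cint => p; rewrite mulNr. Qed.

Lemma cmfun_fourierL1 f : cmfun f -> cmfun (fourierL1 f : Rm * Rm -> R[i]).
Proof.
move=> [mr mi].
apply: (cmfun_fubini (@leb2 R) (f := fun q : (Rm * Rm) * (Rm * Rm) =>
  f q.2 * expi (- (2 * pi * (q.2.1 * q.1.1 + q.2.2 * q.1.2))))).
apply: cmfunM.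
  by split; [exact: (measurableT_comp mr measurable_snd) |
    exact: (measurableT_comp mi measurable_snd)].
have m11 : measurable_fun [set: (Rm * Rm) * (Rm * Rm)] (fun q => q.1.1).
  exact: (measurableT_comp measurable_fst measurable_fst).
have m12 : measurable_fun [set: (Rm * Rm) * (Rm * Rm)] (fun q => q.1.2).
  exact: (measurableT_comp measurable_snd measurable_fst).
have m21 : measurable_fun [set: (Rm * Rm) * (Rm * Rm)] (fun q => q.2.1).
  exact: (measurableT_comp measurable_fst measurable_snd).
have m22 : measurable_fun [set: (Rm * Rm) * (Rm * Rm)] (fun q => q.2.2).
  exact: (measurableT_comp measurable_snd measurable_snd).
apply: cmfun_expi; apply: measurable_funN; apply: measurable_funM.
  exact: measurable_cst.
by apply: measurable_funD; apply: measurable_funM.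
Qed.

Lemma cintegrable_modulation f (t : Rm * Rm -> R) :
  measurable_fun setT t -> cintegrable mu2 f ->
  cintegrable mu2 (fun p => f p * expi (t p)).
Proof.
move=> mt If; have mf := cintegrable_cmfun If; have [ir ii] := If.
have b (x y : R) (s : R) : `|x * cos s| + `|y * sin s| <= `|x| + `|y|.
  by rewrite !normrM; apply: lerD; rewrite ler_piMr ?normr_ge0// ?cos_max// sin_max.
apply: (@cintegrable_le _ _ _ _ _
    (fun p => `|complex.Re (f p)| + `|complex.Im (f p)|)).
- by apply: cmfunM => //; exact: cmfun_expi.
- by apply: integrableD_EFin; exact: integrable_norm.
- move=> p; rewrite ReM Re_expi Im_expi (le_trans (ler_normB _ _))//.
- move=> p; rewrite ImM Re_expi Im_expi (le_trans (ler_normD _ _))// addrC.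
  by rewrite [leRHS]addrC; have := b (complex.Im (f p)) (complex.Re (f p)) (t p).
Qed.

Lemma cintegrable_fourier f xi : cintegrable mu2 f ->
  cintegrable mu2 (fun p => f p * expi (- (2 * pi) * dot p xi)).
Proof.
apply: cintegrable_modulation; apply: measurable_funM; first exact: measurable_cst.
exact: measurable_dot.
Qed.

Lemma fourierL1D f g : cintegrable mu2 f -> cintegrable mu2 g ->
  fourierL1 (f \+ g) = fourierL1 f \+ fourierL1 g.
Proof.
move=> If Ig; apply/funext => xi /=; rewrite !fourierL1E.
rewrite -cintD; do ?exact: cintegrable_fourier.
by apply: eq_cint => p /=; rewrite mulrDl.
Qed.

Lemma fourierL1Z (c : R[i]) f : cintegrable mu2 f ->
  fourierL1 (c \*o f) = c \*o fourierL1 f.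
Proof.
move=> If; apply/funext => xi /=; rewrite !fourierL1E.
rewrite -cintZ; last exact: cintegrable_fourier.
by apply: eq_cint => p /=; rewrite mulrA.
Qed.

Lemma fourierL1B f g : cintegrable mu2 f -> cintegrable mu2 g ->
  fourierL1 (f \- g) = fourierL1 f \- fourierL1 g.
Proof.
move=> If Ig; rewrite !sub_funE fourierL1D ?fourierL1Z//; exact: cintegrableZ.
Qed.

Lemma fourierL1_affine f (c : R) b xi : 0 < c -> cintegrable mu2 f ->
  fourierL1 (f \o affine c b) xi =
  (c ^- 2)%:C%C * (expi (2 * pi * (dot b xi / c)) * fourierL1 f (affine c^-1 (0, 0) xi)).
Proof.
move=> c0 If; have cN : c != 0 by rewrite gt_eqF.
rewrite !fourierL1E; pose g p := expi (2 * pi * (dot b xi / c)) *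
  (f p * expi (- (2 * pi) * dot p (affine c^-1 (0, 0) xi))).
rewrite (_ : cint _ _ = cint mu2 (g \o affine c b)).
  rewrite cint_affine//.
    by congr (_ * _); rewrite -cintZ//; exact: cintegrable_fourier.
  exact/cintegrableZ/cintegrable_fourier.
apply: eq_cint => p; rewrite /g /= mulrCA -expiD; congr (_ * expi _).
by rewrite /dot /affine /=; field.
Qed.

Definition L1L2 f : Prop := cintegrable mu2 f /\ L2 mu2 f.

Definition unit_cell : set (Rm * Rm) := `[0, 1[%classic `*` `[0, 1[%classic.

(** The value of hat f at [s - k] is the trigonometric coefficient of index [k] of [f] modulated by
    [s], and modulation preserves the norm. *)
Lemma fourier_shift_sum f : L2 mu2 f -> cintegrable mu2 f ->
  (forall p, ~ (unit_itv p.1 /\ unit_itv p.2) -> f p = 0) -> forall s : Rm * Rm,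
  (\esum_(k in [set: int * int])
    (normsq (fourierL1 f (affine 1 (- k.1%:~R, - k.2%:~R) s)))%:E = normsqL2 mu2 f)%E.
Proof.
move=> Lf If f0 s; pose g p := f p * expi (- (2 * pi) * dot p s).
have mg : cmfun g by apply: cmfunM; [by case: Lf | exact: cmfun_modulation].
have Eg : normsqL2 mu2 g = normsqL2 mu2 f.
  by apply: eq_integral => p _; rewrite normsqM normsq_expi mulr1.
have Lg : L2 mu2 g by split => //; rewrite Eg; case: Lf.
have g0 p : ~ (unit_itv p.1 /\ unit_itv p.2) -> g p = 0.
  by move=> /f0; rewrite /g => ->; rewrite mul0r.
rewrite -Eg -(torus_parseval Lg g0); apply: eq_esum => k _; congr (normsq _)%:E.
rewrite fourierL1E; apply: eq_cint => p.
have [[h1 h2]|/[dup] /f0 -> /g0 ->] := pselect (unit_itv p.1 /\ unit_itv p.2); last first.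
  by rewrite !mul0r.
rewrite /g /trig2 /trig !conjcM !conj_expi (chi_in h1) (chi_in h2).
rewrite -mulrA; congr (_ * _).
have -> : (1%:C^*)%C = 1 :> R[i] by rewrite /conjc /= oppr0.
rewrite !mul1r -!expiD; congr expi; rewrite /dot /affine /=; ring.
Qed.

(** The integer translates of the half-open cell partition the plane; floors single out the one that
    counts. *)
Lemma cell_sum (p : Rm * Rm) (c : R) : 0 <= c ->
  (\esum_(k in [set: int * int])
    (c * \1_unit_cell (affine 1 (k.1%:~R, k.2%:~R) p))%:E = c%:E)%E.
Proof.
move=> c0.
have cellE (x : R) (k : int) : (0 <= 1 * x + k%:~R < 1) = (k == - Num.floor x).
  rewrite mul1r -eqr_oppLR eq_sym floor_eq rmorphD /= rmorphN /=.
  by apply/idP/idP => /andP[? ?]; apply/andP; split; lra.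
have indE k : \1_unit_cell (affine 1 (k.1%:~R, k.2%:~R) p) =
    ((k.1 == - Num.floor p.1) && (k.2 == - Num.floor p.2))%:R :> R.
  rewrite indicE; congr (_%:R); congr nat_of_bool; rewrite -!cellE.
  by apply/idP/idP; rewrite in_setE /unit_cell /affine /= !in_itv /= => /andP.
rewrite (esum_single (j0 := (- Num.floor p.1, - Num.floor p.2))).
- by rewrite indE /= !eqxx mulr1.
- by rewrite lee_fin mulr_ge0.
- move=> [k1 k2]; rewrite xpair_eqE negb_and indE /= => h.
  by rewrite -negb_and in h; rewrite (negbTE h) mulr0.
Qed.

Lemma measurable_unit_cell : measurable unit_cell.
Proof. by apply: measurableX; exact: measurable_itv. Qed.

(* Parseval for the modulations of [f] computes the sum of |hat f|^2 over each
   translate of the integer lattice; integrate it over the unit cell. *)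
Lemma plancherel_unit f : L2 mu2 f -> cintegrable mu2 f ->
  (forall p, ~ (unit_itv p.1 /\ unit_itv p.2) -> f p = 0) ->
  normsqL2 mu2 (fourierL1 f) = normsqL2 mu2 f.
Proof.
move=> Lf If f0; have mf := cintegrable_cmfun If.
pose H p := normsq (fourierL1 f p).
have mH : measurable_fun setT H by exact/cmfun_normsq/cmfun_fourierL1.
have mC : measurable_fun setT (\1_unit_cell : Rm * Rm -> R).
  exact: measurable_indic measurable_unit_cell.
have H0 p : 0 <= H p by exact: normsq_ge0.
pose sh (k : int * int) : R * R := (k.1%:~R, k.2%:~R).
pose shN (k : int * int) : R * R := (- k.1%:~R, - k.2%:~R).
pose F (k : int * int) p : \bar R := (H (affine 1 (shN k) p) * \1_unit_cell p)%:E.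
have mF k : measurable_fun setT (F k).
  apply/measurable_EFinP; apply: measurable_funM => //.
  exact: (measurableT_comp mH (measurable_fun_affine 1 (shN k))).
have F0 k p : (0 <= F k p)%E by rewrite lee_fin mulr_ge0.
transitivity (\esum_(k in [set: int * int]) (\int[mu2]_p F k p))%E.
  (* Translation moves the lattice shift from |hat f|^2 onto the cell, whose translates then add up
     to 1. *)
  have E k : (\int[mu2]_p F k p =
      \int[mu2]_p (H p * \1_unit_cell (affine 1 (sh k) p))%:E)%E.
    have := ge0_integral_affine2 (sh k) ltr01 (mF k) (F0 k).
    rewrite expr1n invr1 mul1e => <-; apply: eq_integral => p _.
    rewrite /F; congr (H _ * _)%:E.
    by case: p => p1 p2; rewrite /affine /=; congr pair; ring.
  under eq_esum do rewrite E.
  rewrite -integral_esum.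
  - by apply: eq_integral => p _; rewrite cell_sum.
  - move=> k; apply/measurable_EFinP; apply: measurable_funM => //.
    exact: (measurableT_comp mC (measurable_fun_affine 1 (sh k))).
  - by move=> k p; rewrite lee_fin mulr_ge0.
rewrite -integral_esum//.
transitivity (\int[mu2]_p ((n2 mu2 f)%:E * (\1_unit_cell p)%:E))%E.
  apply: eq_integral => p _; rewrite /F indicE; case: (p \in _).
    by rewrite mule1 n2E// -(fourier_shift_sum Lf If f0 p);
      apply: eq_esum => k _; rewrite mulr1.
  by rewrite mule0; apply: esum1 => k _; rewrite mulr0.
rewrite ge0_integralZl_EFin//; first last.
- exact: n2_ge0.
- exact/measurable_EFinP.
rewrite integral_indic ?setIT//; last exact: measurable_unit_cell.
rewrite [X in (_ * X)%E](_ : _ = (mu `[0%R, 1%R[%classic * mu `[0%R, 1%R[%classic)%E);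
  last first.
  exact: (product_measure1E mu mu (measurable_itv _) (measurable_itv _)).
by rewrite lebesgue_measure_itv /= lte_fin ltr01 oppr0 adde0 mule1 mule1 n2E.
Qed.

(** Dilation by [c] brings the support into the unit square, and the squared norms on both sides
    scale by [c ^- 2]. *)
Lemma plancherel_bounded f (c : R) : 0 < c -> L2 mu2 f -> cintegrable mu2 f ->
  (forall p, ~ (unit_itv (p.1 / c) /\ unit_itv (p.2 / c)) -> f p = 0) ->
  normsqL2 mu2 (fourierL1 f) = normsqL2 mu2 f.
Proof.
move=> c0 Lf If f0; have cN : c != 0 by rewrite gt_eqF.
have mf := cintegrable_cmfun If.
pose g := f \o affine c (0, 0).
have Ig : cintegrable mu2 g by exact: cintegrable_affine.
have Ng : normsqL2 mu2 g = ((c ^- 2)%:E * normsqL2 mu2 f)%E by exact: normsqL2_affine.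
have Lg : L2 mu2 g.
  split; first exact: cmfun_affine.
  by rewrite Ng -n2E// -EFinM ltry.
have g0 p : ~ (unit_itv p.1 /\ unit_itv p.2) -> g p = 0.
  move=> hp; apply: f0; rewrite /affine /= !addr0.
  by rewrite ![c * _]mulrC !mulfK.
have := plancherel_unit Lg Ig g0.
have -> : normsqL2 mu2 (fourierL1 g) = ((c ^- 2)%:E * normsqL2 mu2 (fourierL1 f))%E.
  have ci0 : 0 < c^-1 by rewrite invr_gt0.
  have := normsqL2_affine (0, 0) ci0 (cmfun_fourierL1 mf).
  rewrite exprVn invrK => h.
  (* The transform of [g] is [c ^- 2] times hat f at [xi / c]: squaring gives the fourth power, and
     the change of variables returns [c ^+ 2]. *)
  transitivity ((c ^- 2 * c ^- 2)%:E * (c ^+ 2)%:E * normsqL2 mu2 (fourierL1 f))%E; last first.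
    by rewrite -EFinM; congr (_%:E * _)%E; field.
  rewrite -muleA -h /normsqL2 -ge0_integralZl_EFin//; first last.
  - by rewrite mulr_ge0// invr_ge0 sqr_ge0.
  - exact/cmfun_normsqE/cmfun_affine/cmfun_fourierL1.
  - by move=> p _; rewrite lee_fin normsq_ge0.
  apply: eq_integral => p _; rewrite fourierL1_affine// !normsqM normsq_expi mul1r.
  by rewrite normsq_realc -EFinM expr2.
rewrite Ng => /(congr1 (fun z => (c ^+ 2)%:E * z)%E).
by rewrite !muleA -!EFinM mulfV ?expf_neq0// !mul1e.
Qed.

(** The indicator of the open centred square of side [n.+1]; the successor avoids a division by 0 at
    the first index. *)
Definition box (n : nat) : Rm * Rm -> R := fun p => chi (p.1 / n.+1%:R) * chi (p.2 / n.+1%:R).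

Lemma measurable_box n : measurable_fun setT (box n).
Proof.
have h : measurable_fun [set: Rm] (fun x : Rm => chi (x / n.+1%:R)).
  apply: (measurableT_comp measurable_chi).
  rewrite (_ : (fun _ => _) = (fun x : Rm => (n.+1%:R^-1 * x + 0)%R : Rm)).
    exact: measurable_affine.
  by apply/funext => x; rewrite addr0 mulrC.
by apply: measurable_funM; [exact: (measurableT_comp h measurable_fst) |
  exact: (measurableT_comp h measurable_snd)].
Qed.

Lemma box_ge0 n p : 0 <= box n p. Proof. by rewrite mulr_ge0 ?chi_ge0. Qed.

Lemma box_le1 n p : box n p <= 1.
Proof. by rewrite mulr_ile1 ?chi_ge0 ?chi_le1. Qed.

Lemma box_near p : \forall n \near \oo, box n p = 1.
Proof.
exists (Num.truncn (2 * `|p.1| + 2 * `|p.2|)) => // n /= hn.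
have : 2 * `|p.1| + 2 * `|p.2| < n.+1%:R.
  by apply: lt_le_trans (truncnS_gt _) _; rewrite ler_nat ltnS.
have n0 : 0 < n.+1%:R :> R by [].
have a1 := normr_ge0 p.1; have a2 := normr_ge0 p.2 => h.
have in_chi (x : R) : 2 * `|x| < n.+1%:R -> chi (x / n.+1%:R) = 1.
  move=> hx; apply: chi_in; rewrite /unit_itv /= in_itv /=.
  rewrite ltr_pdivlMr// ltr_pdivrMr//.
  have : `|x| < 1 / 2 * n.+1%:R by lra.
  by rewrite ltr_norml mulNr.
by rewrite /box !in_chi ?mulr1//; lra.
Qed.

Definition truncate n f : Rm * Rm -> R[i] := fun p => (box n p)%:C%C * f p.

Lemma cmfun_truncate n f : cmfun f -> cmfun (truncate n f).
Proof. by move=> mf; apply: cmfunM mf; exact: cmfun_realc (measurable_box n). Qed.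

Lemma L1L2_truncate n f : L1L2 f -> L1L2 (truncate n f).
Proof.
move=> [If Lf]; have mf := cintegrable_cmfun If; split; last first.
  apply: (L2_le (cmfun_truncate n mf) (L2_integrable Lf)) => p.
  rewrite normsqM normsq_realc ler_piMl ?normsq_ge0// expr2.
  by rewrite mulr_ile1 ?box_ge0 ?box_le1.
have [ir ii] := If; have [mr mi] := cmfun_truncate n mf; split.
  apply: le_integrable ir => //; first exact/measurable_EFinP.
  move=> p _ /=; rewrite ReM Re_realc Im_realc mul0r subr0 lee_fin normrM.
  by rewrite ler_piMl// ger0_norm ?box_ge0 ?box_le1.
apply: le_integrable ii => //; first exact/measurable_EFinP.
move=> p _ /=; rewrite ImM Re_realc Im_realc mul0r addr0 lee_fin normrM.
by rewrite ler_piMl// ger0_norm ?box_ge0 ?box_le1.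
Qed.

Lemma plancherel_truncate n f : L1L2 f ->
  normsqL2 mu2 (fourierL1 (truncate n f)) = normsqL2 mu2 (truncate n f).
Proof.
move=> /(L1L2_truncate n)[If Lf]; apply: (plancherel_bounded (c := n.+1%:R)) => //.
move=> p /not_andP[] /chi_out h; rewrite /truncate /box h ?mul0r ?mulr0 ?mul0r//.
Qed.

Lemma n2_truncate f : L2 mu2 f -> n2 mu2 (f \- truncate n f) @[n --> \oo] --> (0 : R).
Proof.
move=> Lf; have [mf _] := Lf.
have E n p : normsq (f p - truncate n f p) = (1 - box n p) ^+ 2 * normsq (f p).
  rewrite /truncate -{1}[f p]mul1r -mulrBl normsqM.
  by rewrite (_ : 1 - _ = (1 - box n p)%:C%C) ?normsq_realc// rmorphB.
apply: (n2_dominated mf _ (L2_integrable Lf)).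
- by move=> n; exact: cmfun_truncate.
- move=> n p; rewrite E ler_piMl ?normsq_ge0// expr2.
  by have := box_ge0 n p; have := box_le1 n p => *; rewrite mulr_ile1; lra.
- move=> p; apply: cvg_near_cst; apply: filterS (box_near p) => n h.
  by rewrite E h subrr expr0n mul0r.
Qed.

Lemma cvg_fourierL1_truncate f xi : cintegrable mu2 f ->
  normsq (fourierL1 (truncate n f) xi) @[n --> \oo] --> normsq (fourierL1 f xi).
Proof.
move=> If; have mf := cintegrable_cmfun If.
pose g p := f p * expi (- (2 * pi) * dot p xi).
have [ir ii] : cintegrable mu2 g by exact: cintegrable_fourier.
have E n p : truncate n f p * expi (- (2 * pi) * dot p xi) = (box n p)%:C%C * g p.
  by rewrite /truncate mulrA.
have key (u : Rm * Rm -> R) : mu2.-integrable setT (EFin \o u) ->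
    Rintegral mu2 setT (fun p => box n p * u p) @[n --> \oo] --> Rintegral mu2 setT u.
  move=> iu; have mu_ := measurable_int _ iu.
  pose F n p := (box n p * u p)%:E.
  have mF n : measurable_fun setT (F n).
    apply/measurable_EFinP; apply: measurable_funM; first exact: measurable_box.
    exact/measurable_EFinP.
  have FF p : setT p -> F ^~ p @ \oo --> (EFin \o u) p.
    move=> _; apply: cvg_near_cst; apply: filterS (box_near p) => n h.
    by rewrite /F h mul1r.
  have gf p : setT p -> (EFin \o (Num.norm \o u)) p \is a fin_num by [].
  have gF n p : setT p -> (`|F n p| <= (EFin \o (Num.norm \o u)) p)%E.
    move=> _; rewrite /= lee_fin normrM ler_piMl// ger0_norm ?box_ge0//.
    exact: box_le1.
  have := dominated_cvg measurableT mF FF gf (integrable_norm iu) gF.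
  by rewrite -(fineK (integrable_fin_num measurableT iu)) => /fine_cvg.
have cr : complex.Re (fourierL1 (truncate n f) xi) @[n --> \oo] -->
    complex.Re (fourierL1 f xi).
  rewrite fourierL1E; apply: cvg_trans (key _ ir); apply: near_eq_cvg.
  apply: nearW => n; rewrite fourierL1E; apply: eq_Rintegral => p _ /=.
  by rewrite E; move: (g p) => z; rewrite ReM Re_realc Im_realc mul0r subr0.
have ci : complex.Im (fourierL1 (truncate n f) xi) @[n --> \oo] -->
    complex.Im (fourierL1 f xi).
  rewrite fourierL1E; apply: cvg_trans (key _ ii); apply: near_eq_cvg.
  apply: nearW => n; rewrite fourierL1E; apply: eq_Rintegral => p _ /=.
  by rewrite E; move: (g p) => z; rewrite ImM Re_realc Im_realc mul0r addr0.
by apply: cvgD; under eq_fun do rewrite expr2; rewrite expr2; exact: cvgM.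
Qed.

(** Transforms of truncations converge pointwise and have norm at most that of [f], so Fatou's lemma
    gives one half of Plancherel and shows that hat f is in L^2. *)
Lemma fourierL1_L2_le f : L1L2 f -> (normsqL2 mu2 (fourierL1 f) <= normsqL2 mu2 f)%E.
Proof.
move=> Hf; have [If Lf] := Hf; have mf := cintegrable_cmfun If.
have mF n : measurable_fun setT (fun p => (normsq (fourierL1 (truncate n f) p))%:E).
  by apply/cmfun_normsqE/cmfun_fourierL1; exact: cmfun_truncate.
have F0 n p : setT p -> (0 <= (normsq (fourierL1 (truncate n f) p))%:E)%E.
  by rewrite lee_fin normsq_ge0.
have := fatou mu2 measurableT mF F0.
rewrite (_ : (\int[mu2]_x _)%E = normsqL2 mu2 (fourierL1 f)); last first.
  apply: eq_integral => p _; rewrite is_cvg_limn_einfE.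
    apply/cvg_lim => //; apply: cvg_EFin; first exact: nearW.
    exact: cvg_fourierL1_truncate.
  apply/cvg_ex; exists (normsq (fourierL1 f p))%:E.
  by apply: cvg_EFin; [exact: nearW | exact: cvg_fourierL1_truncate].
move=> /le_trans; apply.
have N n : (normsqL2 mu2 (fourierL1 (truncate n f)) <= normsqL2 mu2 f)%E.
  rewrite plancherel_truncate//; have [_ Lt] := L1L2_truncate n Hf.
  apply: ge0_le_integral => //.
  - by move=> p _; rewrite lee_fin normsq_ge0.
  - by apply: cmfun_normsqE; case: Lt.
  - exact: cmfun_normsqE.
  - move=> p _; rewrite lee_fin normsqM normsq_realc ler_piMl ?normsq_ge0// expr2.
    by rewrite mulr_ile1 ?box_ge0 ?box_le1.
rewrite limn_einf_lim; apply: lime_le; first exact: is_cvg_einfs.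
apply: nearW => n; apply: le_trans (N n); apply: ereal_inf_lbound.
by exists n => //=.
Qed.

Lemma L2_fourierL1 f : L1L2 f -> L2 mu2 (fourierL1 f).
Proof.
move=> Hf; have [If [mf ff]] := Hf; split; first exact: cmfun_fourierL1.
exact: le_lt_trans (fourierL1_L2_le Hf) ff.
Qed.

Lemma L1L2B f g : L1L2 f -> L1L2 g -> L1L2 (f \- g).
Proof.
move=> [If Lf] [Ig Lg]; split; last exact: L2B.
by rewrite sub_funE; apply: cintegrableD => //; exact: cintegrableZ.
Qed.

Lemma L1L2D f g : L1L2 f -> L1L2 g -> L1L2 (f \+ g).
Proof. by move=> [If Lf] [Ig Lg]; split; [exact: cintegrableD | exact: L2D]. Qed.

Lemma L1L2Z c f : L1L2 f -> L1L2 (c \*o f).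
Proof. by move=> [If Lf]; split; [exact: cintegrableZ | exact: L2Z]. Qed.

Lemma plancherel f : L1L2 f -> n2 mu2 (fourierL1 f) = n2 mu2 f.
Proof.
move=> Hf; have [If Lf] := Hf; have LF := L2_fourierL1 Hf.
suff E : L2norm mu2 (fourierL1 f) = L2norm mu2 f by rewrite -!sqr_L2norm E.
apply/eqP; rewrite -subr_eq0 -normr_eq0 eq_le normr_ge0 andbT.
rewrite leNgt; apply/negP; set d := `|_| => d0.
(* If the norms differed by [d], a truncation within [d / 2] of [f] would contradict it: the
   inequality applied to the remainder puts both norms within [d / 2] of the common norm of the
   truncation and its transform. *)
have [n hn] := cvg0_exists_lt (n2_truncate Lf) (exprn_gt0 2 (divr_gt0 d0 (ltr0n R 2))).
have Ht := L1L2_truncate n Hf; have [It Lt] := Ht.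
have h1 : L2norm mu2 (f \- truncate n f) < d / 2.
  by rewrite -(@ltr_pXn2r _ 2)// ?nnegrE ?L2norm_ge0 ?divr_ge0 ?ltW// sqr_L2norm.
have h2 : L2norm mu2 (fourierL1 f \- fourierL1 (truncate n f)) <= L2norm mu2 (f \- truncate n f).
  rewrite -fourierL1B// ler_wsqrtr// -lee_fin !n2E; first exact/fourierL1_L2_le/L1L2B.
    exact: L2B.
  exact/L2_fourierL1/L1L2B.
have h3 := L2norm_dist_le LF (L2_fourierL1 Ht).
have h4 := L2norm_dist_le Lf Lt.
have h5 : L2norm mu2 (fourierL1 (truncate n f)) = L2norm mu2 (truncate n f).
  by rewrite /L2norm /n2 plancherel_truncate.
have : d <= `|L2norm mu2 (fourierL1 f) - L2norm mu2 (fourierL1 (truncate n f))| +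
    `|L2norm mu2 f - L2norm mu2 (truncate n f)|.
  rewrite h5 /d; apply: le_trans (ler_distD (L2norm mu2 (truncate n f)) _ _) _.
  by rewrite (distrC (L2norm mu2 f)).
lra.
Qed.

(** Polarization: [n2] of a sum gives the real part, and replacing [g] by [i g] gives the imaginary
    part. *)
Lemma plancherel_ip f g : L1L2 f -> L1L2 g ->
  ip mu2 (fourierL1 f) (fourierL1 g) = ip mu2 f g.
Proof.
move=> Hf Hg.
have reP u v : L1L2 u -> L1L2 v ->
    complex.Re (ip mu2 (fourierL1 u) (fourierL1 v)) = complex.Re (ip mu2 u v).
  move=> Hu Hv; have := plancherel (L1L2D Hu Hv).
  rewrite fourierL1D; [|by case: Hu|by case: Hv].
  rewrite !n2D; [|by case: Hu|by case: Hv|exact: L2_fourierL1|exact: L2_fourierL1].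
  by rewrite !plancherel//; lra.
apply: complex_ext; first exact: reP.
have := reP _ _ Hf (L1L2Z (0 +i* 1)%C Hg).
rewrite fourierL1Z; last by case: Hg.
rewrite !ipZr; [|by case: Hg|by case: Hf|exact: L2_fourierL1|exact: L2_fourierL1].
by rewrite !ReImE !ReIm_realE !mul0r !mulN1r !sub0r !opprK.
Qed.

End Plancherel.
(** * The smoothed indicator of the square annulus *)

Section SmoothedAnnulus.
Context {R : realType}.
Variables (theta : R -> R) (a delta : R).
Hypothesis theta_lo : forall x : R, x <= -1 -> theta x = 0.
Hypothesis theta_hi : forall x : R, 1 <= x -> theta x = 1.
Hypothesis theta_sq : forall x : R, theta x ^+ 2 + theta (- x) ^+ 2 = 1.
Hypotheses (a_gt0 : 0 < a) (delta_gt0 : 0 < delta) (delta_lt : delta < a / 2).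

(* The argument of theta in all outer pieces of [f_La]: clamping the coordinates
   from below at [2 a - delta] merges the edge and corner formulas. *)
Definition outer_arg (u v : R) : R :=
  (4 * a - delta - Num.max u (2 * a - delta) - Num.max v (2 * a - delta)) / delta.

Definition outer_cutoff (p : R * R) : R := theta (outer_arg `|p.1| `|p.2|).

Definition inner_cutoff (p : R * R) : R := theta (- outer_arg (2 * `|p.1|) (2 * `|p.2|)).

Let dN : delta != 0. Proof. by rewrite gt_eqF. Qed.

Lemma theta_outer_hi u v : u <= 2 * a - delta -> v <= 2 * a - delta ->
  theta (outer_arg u v) = 1.
Proof.
move=> hu hv; apply: theta_hi; rewrite /outer_arg ler_pdivlMr// !max_r//; lra.
Qed.

Lemma theta_outer_lo u v :
  4 * a <= Num.max u (2 * a - delta) + Num.max v (2 * a - delta) ->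
  theta (outer_arg u v) = 0.
Proof. by move=> h; apply: theta_lo; rewrite /outer_arg ler_pdivrMr//; lra. Qed.

Lemma theta_inner_hi u v :
  4 * a <= Num.max u (2 * a - delta) + Num.max v (2 * a - delta) ->
  theta (- outer_arg u v) = 1.
Proof. by move=> h; apply: theta_hi; rewrite /outer_arg lerNr ler_pdivrMr//; lra. Qed.

Lemma theta_inner_lo u v : u <= 2 * a - delta -> v <= 2 * a - delta ->
  theta (- outer_arg u v) = 0.
Proof.
move=> hu hv; apply: theta_lo; rewrite /outer_arg lerNl ler_pdivlMr// !max_r//; lra.
Qed.

(** The bounds handed to [lra], which treats maxima as atoms. *)
Let max_ge (u v : R) : u <= Num.max u v /\ v <= Num.max u v.
Proof. by rewrite !le_max !lexx orbT. Qed.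

(** In every outer piece the inner factor is 1 and in every inner piece the outer factor is 1, since
    [delta < a / 2] separates the transition zones. *)
Lemma f_LaE p : f_La theta a delta p = outer_cutoff p * inner_cutoff p.
Proof.
have a0 := a_gt0; have d0 := delta_gt0; have da := delta_lt.
rewrite /f_La /outer_cutoff /inner_cutoff.
pose u : R := `|p.1|; pose v : R := `|p.2|; rewrite -/u -/v.
have u0 : 0 <= u by exact: normr_ge0.
have v0 : 0 <= v by exact: normr_ge0.
clearbody u v.
have [mu1 mu2] := max_ge u (2 * a - delta).
have [mv1 mv2] := max_ge v (2 * a - delta).
have [nu1 nu2] := max_ge (2 * u) (2 * a - delta).
have [nv1 nv2] := max_ge (2 * v) (2 * a - delta).
rewrite !in_itv /= !u0 !v0 /=.
case: ifPn => [/and3P[h1 h2 h3]|H1].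
  rewrite theta_inner_hi ?mulr1; last by lra.
  rewrite /outer_arg max_r// max_l//; congr (theta (_ / _)); ring.
case: ifPn => [/and3P[/andP[h1 h2] /andP[h3 h4] /andP[h5 h6]]|H2].
  rewrite theta_inner_hi ?mulr1; last by lra.
  rewrite /outer_arg !max_l//; congr (theta (_ / _)); ring.
case: ifPn => [/and3P[h1 h2 h3]|H3].
  rewrite theta_inner_hi ?mulr1; last by lra.
  rewrite /outer_arg max_l// max_r//; congr (theta (_ / _)); ring.
case: ifPn => [/andP[/andP[h1 h2] h3]|H4].
  rewrite theta_outer_hi// theta_inner_hi ?mulr1//.
  by move: h3; rewrite negb_and -!ltNge => /orP[h|h]; lra.
case: ifPn => [/and3P[/andP[h1 h2] /andP[h3 h4] /andP[h5 h6]]|H5].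
  rewrite theta_outer_hi; [|by lra|by lra].
  by rewrite theta_inner_hi ?mulr1//; lra.
case: ifPn => [/and3P[h1 h2 h3]|H6].
  rewrite theta_outer_hi; [|by lra|by lra].
  rewrite mul1r /outer_arg max_r; last by lra.
  by rewrite max_l; [congr theta; field | lra].
case: ifPn => [/and3P[/andP[h1 h2] /andP[h3 h4] /andP[h5 h6]]|H7].
  rewrite theta_outer_hi; [|by lra|by lra].
  rewrite mul1r /outer_arg max_l; last by lra.
  by rewrite max_l; [congr theta; field | lra].
case: ifPn => [/and3P[h1 h2 h3]|H8].
  rewrite theta_outer_hi; [|by lra|by lra].
  rewrite mul1r /outer_arg max_l; last by lra.
  by rewrite max_r; [congr theta; field | lra].
(* No piece applies: the point lies in the hole, where the inner factor is 0, or beyond the outer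
   boundary, where the outer factor is 0. *)
have [uc|uc] := leP u (2 * a - delta); have [vc|vc] := leP v (2 * a - delta).
- have [h1 h2] : u <= a + delta / 2 /\ v <= a + delta / 2.
    by apply/andP; apply: contraNT H4 => ->; rewrite uc vc.
  have [h4 h5] : u <= a - delta / 2 /\ v <= a - delta / 2.
    have [h4|h4] := leP v (a - delta / 2).
      split=> //; rewrite leNgt; apply/negP => h5.
      by case/negP: H8; rewrite h4 h1 andbT ltW.
    have [h5|h5] := leP u (a - delta / 2).
      by case/negP: H6; rewrite h5 h2 andbT ltW.
    have h6 : 2 * a - delta <= u + v by clear H1 H2 H3 H4 H5 H6 H7 H8; lra.
    have [h7|h7] := leP (u + v) (2 * a).
      by case/negP: H7; rewrite h1 h2 (ltW h4) (ltW h5) h6.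
    case/negP: H5; rewrite h1 h2 (ltW h4) (ltW h5) (ltW h7) /=; clear H1 H2 H3 H4 H6 H7 H8; lra.
  by rewrite theta_inner_lo ?mulr0//; clear H1 H2 H3 H4 H5 H6 H7 H8; lra.
- rewrite theta_outer_lo ?mul0r//; rewrite leNgt; apply/negP => h.
  by case/negP: H1; rewrite uc (ltW vc) /=; clear H2 H3 H4 H5 H6 H7 H8; lra.
- rewrite theta_outer_lo ?mul0r//; rewrite leNgt; apply/negP => h.
  by case/negP: H3; rewrite vc (ltW uc) /=; clear H1 H2 H4 H5 H6 H7 H8; lra.
- rewrite theta_outer_lo ?mul0r//; rewrite leNgt; apply/negP => h.
  by case/negP: H2; apply/and3P; split; apply/andP; split;
    clear H1 H3 H4 H5 H6 H7 H8; lra.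
Qed.

Lemma outer_double p :
  outer_cutoff (2 * p.1, 2 * p.2) = theta (outer_arg (2 * `|p.1|) (2 * `|p.2|)).
Proof. by rewrite /outer_cutoff /= !normrM ger0_norm. Qed.

(** A nonzero value at the doubled point forces both coordinates below [a + delta / 2] in absolute
    value, which is within the plateau bound [2 * a - delta]. *)
Lemma outer_gt_le x : outer_cutoff (2 * x.1, 2 * x.2) != 0 -> outer_cutoff x = 1.
Proof.
have a0 := a_gt0; have d0 := delta_gt0; have da := delta_lt.
rewrite outer_double /outer_cutoff.
pose u : R := `|x.1|; pose v : R := `|x.2|; rewrite -/u -/v => h.
have h1 : Num.max (2 * u) (2 * a - delta) + Num.max (2 * v) (2 * a - delta) < 4 * a.
  by rewrite ltNge; apply: contra h => h; rewrite theta_outer_lo.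
have [nu1 nu2] := max_ge (2 * u) (2 * a - delta).
have [nv1 nv2] := max_ge (2 * v) (2 * a - delta).
clearbody u v.
by apply: theta_outer_hi; lra.
Qed.

Lemma f_La_sqr p : f_La theta a delta p ^+ 2 =
  outer_cutoff p ^+ 2 - outer_cutoff (2 * p.1, 2 * p.2) ^+ 2.
Proof.
rewrite f_LaE exprMn; have := theta_sq (outer_arg (2 * `|p.1|) (2 * `|p.2|)).
rewrite -outer_double -/(inner_cutoff p) => h.
have -> : inner_cutoff p ^+ 2 = 1 - outer_cutoff (2 * p.1, 2 * p.2) ^+ 2 by lra.
have [->|/outer_gt_le ->] := eqVneq (outer_cutoff (2 * p.1, 2 * p.2)) 0; last by ring.
by rewrite expr0n subr0 mulr1 subr0.
Qed.

(** Each clamped coordinate is at least [2 * a - delta] while their sum is below [4 * a], so the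
    other one stays below [2 * a + delta]. *)
Lemma outer_support p : outer_cutoff p != 0 ->
  `|p.1| < 2 * a + delta /\ `|p.2| < 2 * a + delta.
Proof.
have a0 := a_gt0; have d0 := delta_gt0; have da := delta_lt.
move=> h.
have h1 : Num.max `|p.1| (2 * a - delta) + Num.max `|p.2| (2 * a - delta) < 4 * a.
  by rewrite ltNge; apply: contra h => h; rewrite /outer_cutoff theta_outer_lo.
have [nu1 nu2] := max_ge `|p.1| (2 * a - delta).
have [nv1 nv2] := max_ge `|p.2| (2 * a - delta).
by split; lra.
Qed.

Lemma f_La_support p : f_La theta a delta p != 0 ->
  `|p.1| < 2 * a + delta /\ `|p.2| < 2 * a + delta.
Proof. by rewrite f_LaE mulf_eq0 negb_or => /andP[/outer_support]. Qed.

Lemma esum_telescope (G : int -> R) (N : nat) :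
  (forall n, 0 <= G n - G (n - 1)) ->
  (forall n : int, n <= - N%:Z -> G n = 0) -> (forall n : int, N%:Z <= n -> G n = 1) ->
  (\esum_(n in [set: int]) (G n - G (n - 1))%:E = 1%:E)%E.
Proof.
move=> G0 Glo Ghi.
(* The integers from [- M] to [M]; over them the sum telescopes to [G M - G (- M - 1)]. *)
pose rg (M : nat) : seq int := [seq (i%:Z - M%:Z)%R | i <- iota 0 (M.*2.+1)].
have urg M : uniq (rg M).
  by rewrite map_inj_uniq ?iota_uniq// => i j /addIr [].
have mem_rg M (n : int) : `|n| <= M%:Z -> n \in rg M.
  move=> h; have h' : 0 <= n + M%:Z by lia.
  apply/mapP; exists `|(n + M%:Z)%R|%N; first by rewrite mem_iota; lia.
  lia.
have sum_rg M : (N < M)%N -> \sum_(n <- rg M) (G n - G (n - 1)) = 1.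
  move=> NM; rewrite big_map.
  have tele (K : nat) : \sum_(i <- iota 0 K) (G (i%:Z - M%:Z) - G (i%:Z - M%:Z - 1)) =
      G (K%:Z - M%:Z - 1) - G (- M%:Z - 1).
    elim: K => [|K IH]; first by rewrite big_nil sub0r subrr.
    rewrite -[K.+1]addn1 iotaD big_cat /= IH add0n big_seq1.
    have -> : (K + 1)%N%:Z - M%:Z - 1 = K%:Z - M%:Z by lia.
    by ring.
  by rewrite tele Ghi ?Glo ?subr0//; lia.
apply: esum_approx => //.
(* The sum of the absolute values bounds every index in [s], so a symmetric range contains [s]. *)
- move=> s us; pose M := (N + \sum_(n <- s) `|n|)%N.
  have sub : {subset s <= rg M.+1}.
    move=> n ns; apply: mem_rg.
    have : (`|n| <= \sum_(n <- s) `|n|)%N by rewrite (big_rem n ns) /= leq_addr.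
    rewrite /M; lia.
  rewrite -(sum_rg M.+1); last by rewrite /M ltnS leq_addr.
  have -> : \sum_(j <- s) (G j - G (j - 1)) =
      \sum_(j <- rg M.+1 | j \in s) (G j - G (j - 1)).
    rewrite -[RHS]big_filter; apply: perm_big; apply: uniq_perm => //.
      by rewrite filter_uniq.
    by move=> n; rewrite mem_filter; apply/idP/andP => [h|[]//]; split => //; exact: sub.
  rewrite [leRHS](bigID (fun j => j \in s)) /= lerDl.
  by apply: sumr_ge0 => j _.
- move=> e e0; exists (rg N.+1) => //; rewrite sum_rg//; lra.
Qed.

Lemma f_La_dyadic_sum (p : R * R) : p != (0, 0) ->
  (\esum_(n in [set: int])
    (f_La theta a delta ((2 ^ (- n)) * p.1, (2 ^ (- n)) * p.2)%R ^+ 2)%:E = 1%:E)%E.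
Proof.
have absP (N : nat) (n : int) : N%:Z <= n -> n = `|n|%N /\ (N <= `|n|)%N by lia.
have absN (N : nat) (n : int) : n <= - N%:Z -> - n = `|n|%N /\ (N <= `|n|)%N by lia.
have a0 := a_gt0; have d0 := delta_gt0; have da := delta_lt.
move=> p0; pose G (n : int) := outer_cutoff (2 ^ (- n) * p.1, 2 ^ (- n) * p.2) ^+ 2.
have E (n : int) : f_La theta a delta (2 ^ (- n) * p.1, 2 ^ (- n) * p.2) ^+ 2 =
    G n - G (n - 1).
  rewrite f_La_sqr /G /= !mulrA -[2 * _]/(2 ^ 1 * 2 ^ (- n)) -expfzDr ?pnatr_eq0//.
  by rewrite opprB.
under eq_esum do rewrite E.
pose u : R := `|p.1|; pose v : R := `|p.2|; pose t : R := Num.max u v.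
have [t1 t2] := max_ge u v.
have t0 : 0 < t.
  rewrite /t lt_max !normr_gt0 -negb_and; apply: contra p0 => /andP[/eqP h1 /eqP h2].
  by rewrite [p]surjective_pairing h1 h2.
(* A power of 2 above both quotients carries [p] outside the support when it multiplies and into the
   plateau when it divides. The exponent [truncn b] is large enough because [2 ^ n] is at least
   [n + 1]. *)
pose b := (2 * a + delta) / t + t / (2 * a - delta).
have c0 : 0 < 2 * a - delta by lra.
have b1 : 0 <= (2 * a + delta) / t by rewrite divr_ge0 ?ltW//; lra.
have b2 : 0 <= t / (2 * a - delta) by rewrite divr_ge0 ?ltW.
pose N := Num.truncn b.
have pow2 (n : nat) : (N <= n)%N -> b <= 2 ^+ n.
  move=> Nn; apply: le_trans (ltW (truncnS_gt b)) _.
  rewrite -natrX ler_nat; apply: leq_ltn_trans Nn _; exact: ltn_expl.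
apply: (esum_telescope (N := N)).
- by move=> n; rewrite -E sqr_ge0.
- move=> n /absN[hn Nn]; rewrite /G hn.
  rewrite -exprnP /outer_cutoff theta_outer_lo ?expr0n//= !normrM.
  have hb := pow2 _ Nn.
  rewrite ger0_norm ?exprn_ge0//; set q := 2 ^+ _ in hb *.
  rewrite -/u -/v; have [nu1 nu2] := max_ge (q * u) (2 * a - delta).
  have [nv1 nv2] := max_ge (q * v) (2 * a - delta).
  have : 2 * a + delta <= q * t.
    rewrite -ler_pdivrMr//; apply: le_trans hb; rewrite /b; lra.
  by rewrite /t; have [h|h] := leP u v => hq; lra.
- move=> n /absP[hn Nn]; rewrite /G hn; set m := absz n in Nn *.
  rewrite -exprnN /outer_cutoff theta_outer_hi ?expr1n//= !normrM.
    all: have hb := pow2 _ Nn.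
    all: have q0 : 0 < 2 ^+ m :> R by rewrite exprn_gt0.
    all: have -> : `|2 ^- m| = (2 ^+ m)^-1 :> R
      by rewrite ger0_norm ?invr_ge0 ?exprn_ge0.
    all: rewrite mulrC ler_pdivrMr//.
    all: have ht : t <= (2 * a - delta) * 2 ^+ m
      by rewrite mulrC -ler_pdivrMr//; apply: le_trans hb; rewrite /b; lra.
    all: exact: le_trans ht.
Qed.

Section Continuity.
Hypothesis theta_cont : continuous theta.

(** Read off from the product form, which composes theta with maxima and absolute values, so no
    gluing of pieces is involved. *)
Lemma continuous_f_La : continuous (f_La theta a delta : R * R -> R).
Proof.
have -> : f_La theta a delta = (fun p => outer_cutoff p * inner_cutoff p).
  by apply/funext => p; exact: f_LaE.
have carg (c : R) : continuous (fun p : R * R => outer_arg (c * `|p.1|) (c * `|p.2|)).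
  move=> p; rewrite /outer_arg; apply: cvgMl.
  have h1 : Num.max (c * `|q.1|) (2 * a - delta) @[q --> p] -->
      Num.max (c * `|p.1|) (2 * a - delta).
    apply: (continuous_max (f := fun q : R * R => c * `|q.1|)
      (g := fun=> 2 * a - delta)); last exact: cvg_cst.
    by apply: cvgMr; apply: cvg_norm; exact: cvg_fst.
  have h2 : Num.max (c * `|q.2|) (2 * a - delta) @[q --> p] -->
      Num.max (c * `|p.2|) (2 * a - delta).
    apply: (continuous_max (f := fun q : R * R => c * `|q.2|)
      (g := fun=> 2 * a - delta)); last exact: cvg_cst.
    by apply: cvgMr; apply: cvg_norm; exact: cvg_snd.
  by apply: cvgB h2; apply: cvgB h1; exact: cvg_cst.
move=> p; apply: cvgM.
  have -> : outer_cutoff = theta \o (fun p => outer_arg (1 * `|p.1|) (1 * `|p.2|)).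
    by apply/funext => q /=; rewrite !mul1r.
  by apply: continuous_comp; [exact: carg | exact: theta_cont].
have -> : inner_cutoff = theta \o (fun p => - outer_arg (2 * `|p.1|) (2 * `|p.2|)) by [].
apply: continuous_comp; last exact: theta_cont.
by apply: cvgN; exact: carg.
Qed.

End Continuity.

Lemma compact_support_f_La :
  compact_support (fun p : R * R => (f_La theta a delta p)%:C%C).
Proof.
rewrite /compact_support; set b := 2 * a + delta.
apply: (subclosed_compact (B := `[- b, b]%classic `*` `[- b, b]%classic)).
- exact: closed_closure.
- by apply: compact_setX; exact: segment_compact.
- apply: (subset_trans (B := closure (`[- b, b]%classic `*` `[- b, b]%classic))).
    apply: closure_subset => p /= hp.
    have /f_La_support[h1 h2] : f_La theta a delta p != 0.
      by apply: contra hp => /eqP ->.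
    by split; rewrite /= in_itv /= -ler_norml ltW.
  rewrite -(proj1 (closure_id _))//.
  by apply: compact_closed; [exact: norm_hausdorff|
    apply: compact_setX; exact: segment_compact].
Qed.

End SmoothedAnnulus.
(** * The Fourier transform on L^2 *)

Section FourierL2.
Context {R : realType}.
Local Notation mu := (@lebesgue_measure R).
Local Notation Rm := (measurableTypeR R).
Local Notation mu2 := (@leb2 R).
Implicit Types (f g h psi : Rm * Rm -> R[i]) (p xi : Rm * Rm).

Lemma ler_cvg0 (u : nat -> R) (x : R) : u n @[n --> \oo] --> (0 : R) ->
  (forall n, x <= u n) -> x <= 0.
Proof.
by move=> hu h; apply: (ler_cvg_to (cvg_cst x) hu); exact: nearW.
Qed.

Lemma Lpnorm2_sqr f : (Lpnorm 2 f ^+ 2 = normsqL2 mu2 f)%E.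
Proof.
have h (x : \bar R) : (0 <= x)%E -> (x ^+ 2 = x `^ 2)%E.
  case: x => [r|_|//]; last by rewrite poweRyr// expe2 mulyy.
  by rewrite lee_fin => r0; rewrite poweR_EFin powR_mulrn// EFin_expe.
rewrite /Lpnorm h ?Lnorm_ge0// poweR_Lnorm//; apply: eq_integral => p _ /=.
rewrite powR_mulrn ?normr_ge0// ger0_norm ?normsqE//.
by case: (f p) => x y /=; exact: sqrtr_ge0.
Qed.

Lemma in_Lp2P f : in_Lp 2 f <-> L2 mu2 f.
Proof.
rewrite /in_Lp /L2 -Lpnorm2_sqr; have := Lnorm_ge0 mu2 2%:E (EFin \o (fun x => Normc.normc (f x))).
rewrite -/(Lpnorm 2 f) => N0; split=> -[mf h]; split => //.
  by rewrite expe2 lte_mul_pinfty// ge0_fin_numE.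
by move: h N0; case: (Lpnorm 2 f) => [r|//|//]; rewrite ?ltry// expe2 mulyy.
Qed.

Lemma normc_Re_Im (z : R[i]) :
  `|complex.Re z| <= Normc.normc z /\ `|complex.Im z| <= Normc.normc z.
Proof.
case: z => x y /=; rewrite -!sqrtr_sqr; split; apply: ler_wsqrtr.
  by rewrite lerDl sqr_ge0.
by rewrite lerDr sqr_ge0.
Qed.

Lemma in_Lp1_cintegrable f : in_Lp 1 f -> cintegrable mu2 f.
Proof.
move=> [mf]; rewrite /Lpnorm Lnorm1 => hf.
apply: (cintegrable_le (u := fun p => Normc.normc (f p))) => //;
  [|by move=> p; case: (normc_Re_Im (f p))|by move=> p; case: (normc_Re_Im (f p))].
apply/integrableP; split => //; apply/measurable_EFinP.
rewrite (_ : (fun _ => _) = Num.sqrt \o (fun p => normsq (f p))).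
  apply: measurableT_comp; last exact: cmfun_normsq.
  by apply: continuous_measurable_fun; exact: sqrt_continuous.
by apply/funext => p /=; rewrite /normsq; case: (f p).
Qed.

Lemma n2_Lpnorm f : n2 mu2 f = fine (Lpnorm 2 f) ^+ 2.
Proof.
rewrite /n2 -Lpnorm2_sqr; case: (Lpnorm 2 f) => [r|//|//] /=;
  by rewrite ?expe2 ?mulyy ?mulNyNy /= ?expr0n.
Qed.

(** [fourierL2] recast with real squared distances, so that the Hilbert space lemmas on [n2]
    apply. *)
Definition fourier_limit f g : Prop :=
  [/\ L2 mu2 f, L2 mu2 g & exists F : nat -> Rm * Rm -> R[i],
    [/\ forall n, L1L2 (F n), n2 mu2 (F n \- f) @[n --> \oo] --> (0 : R)
      & n2 mu2 (fourierL1 (F n) \- g) @[n --> \oo] --> (0 : R)]].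

Lemma fourierL2_limit f g : fourierL2 f g -> fourier_limit f g.
Proof.
have cv (u : nat -> Rm * Rm -> R[i]) : Lpnorm 2 (u n) @[n --> \oo] --> 0%E ->
    n2 mu2 (u n) @[n --> \oo] --> (0 : R).
  move=> /fine_cvg h; under eq_fun do rewrite n2_Lpnorm expr2.
  by have := cvgM h h; rewrite mulr0; exact.
move=> [/in_Lp2P Lf /in_Lp2P Lg [F [HF h1 h2]]]; split => //; exists F; split.
- by move=> n; have [/in_Lp1_cintegrable ? /in_Lp2P ?] := HF n.
- exact: cv.
- exact: cv.
Qed.

Lemma cvg_L2norm (u : nat -> Rm * Rm -> R[i]) : n2 mu2 (u n) @[n --> \oo] --> (0 : R) ->
  L2norm mu2 (u n) @[n --> \oo] --> (0 : R).
Proof.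
move=> h; rewrite -[X in _ --> X](sqrtr0 R).
exact: (continuous_cvg _ (@sqrt_continuous R 0) h).
Qed.

(** By Plancherel the transforms of two approximating sequences are as close to each other as the
    sequences themselves, which have the common limit [f]. *)
Lemma fourier_limit_unique f g g' : fourier_limit f g -> fourier_limit f g' ->
  {ae mu2, forall p, g p = g' p}.
Proof.
move=> [Lf Lg [F [HF f1 f2]]] [_ Lg' [F' [HF' g1 g2]]].
suff h : n2 mu2 (g \- g') = 0.
  by apply: filterS (n2_eq0 (L2B Lg Lg') h) => p /= /eqP; rewrite subr_eq0 => /eqP.
have LF n := (HF n).2; have LF' n := (HF' n).2.
have LT n := L2_fourierL1 (HF n); have LT' n := L2_fourierL1 (HF' n).
rewrite -sqr_L2norm; apply/eqP; rewrite sqrf_eq0 eq_le L2norm_ge0 andbT.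
have ub n : L2norm mu2 (g \- g') <=
    L2norm mu2 (fourierL1 (F n) \- g) + (L2norm mu2 (F n \- f) + L2norm mu2 (F' n \- f))
    + L2norm mu2 (fourierL1 (F' n) \- g').
  have E : g \- g' = ((g \- fourierL1 (F n)) \+ (fourierL1 (F n) \- fourierL1 (F' n)))
      \+ (fourierL1 (F' n) \- g').
    by apply/funext => p /=; ring.
  rewrite {1}E; apply: le_trans (L2normD_le _ _) _; [|exact: L2B|].
    by apply: L2D; exact: L2B.
  rewrite lerD2r; apply: le_trans (L2normD_le _ _) _; [exact: L2B|exact: L2B|].
  rewrite (L2normBC Lg (LT n)) lerD2l -fourierL1B; [|exact: (HF n).1|exact: (HF' n).1].
  rewrite /L2norm plancherel; last exact: L1L2B.
  rewrite -/(L2norm _ _).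
  have -> : F n \- F' n = (F n \- f) \+ (f \- F' n) by apply/funext => p /=; ring.
  apply: le_trans (L2normD_le _ _) _; [exact: L2B|exact: L2B|].
  by rewrite (L2normBC Lf (LF' n)).
apply: ler_cvg0 ub; have := cvgD (cvgD (cvg_L2norm f2) (cvgD (cvg_L2norm f1) (cvg_L2norm g1)))
  (cvg_L2norm g2).
by rewrite !addr0; exact.
Qed.

Lemma n2_affine f c b : 0 < c -> cmfun f -> n2 mu2 (f \o affine c b) = c ^- 2 * n2 mu2 f.
Proof.
move=> c0 mf; rewrite /n2 normsqL2_affine//.
have := normsqL2_ge0 mu2 f; case: (normsqL2 mu2 f) => [r|_|//]; first by rewrite -EFinM.
(* An infinite norm stays infinite, and both sides are then the default value 0 of [fine]. *)
by rewrite gt0_muley /= ?mulr0// lte_fin invr_gt0 exprn_gt0.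
Qed.

Lemma L2_affine f c b : 0 < c -> L2 mu2 f -> L2 mu2 (f \o affine c b).
Proof.
move=> c0 [mf ff]; split; first exact: cmfun_affine.
by rewrite normsqL2_affine// lte_mul_pinfty// lee_fin invr_ge0 exprn_ge0 ?ltW.
Qed.

Lemma L1L2_affine f c b : 0 < c -> L1L2 f -> L1L2 (f \o affine c b).
Proof.
by move=> c0 [If Lf]; split; [exact: cintegrable_affine | exact: L2_affine].
Qed.

Lemma normsqL2_eq f g : (forall p, normsq (f p) = normsq (g p)) ->
  normsqL2 mu2 f = normsqL2 mu2 g.
Proof. by move=> h; apply: eq_integral => p _; rewrite h. Qed.

(* The Fourier transform of [c * f (c x + b)]. *)
Definition fourier_dilate (c : R) b g xi : R[i] :=
  (c^-1)%:C%C * (expi (2 * pi * (dot b xi / c)) * g (affine c^-1 (0, 0) xi)).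

Lemma cmfun_fourier_dilate c b g : cmfun g -> cmfun (fourier_dilate c b g).
Proof.
move=> mg; apply: cmfunZ; apply: cmfunM; last exact: cmfun_affine.
rewrite (_ : (fun _ => _) = (fun xi => expi (2 * pi / c * dot xi b))).
  exact: cmfun_modulation.
by apply/funext => xi; congr expi; rewrite /dot; ring.
Qed.

Lemma normsqL2_fourier_dilate c b g : 0 < c -> cmfun g ->
  normsqL2 mu2 (fourier_dilate c b g) = normsqL2 mu2 g.
Proof.
move=> c0 mg; have c1 : 0 < c^-1 by rewrite invr_gt0.
transitivity (normsqL2 mu2 (((c^-1)%:C%C \*o g) \o affine c^-1 (0, 0))).
  apply: normsqL2_eq => p.
  by rewrite /fourier_dilate /= !normsqM normsq_expi mul1r.
rewrite normsqL2_affine//; last exact: cmfunZ.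
have E p : (normsq (((c^-1)%:C%C \*o g) p))%:E = (((c^-1) ^+ 2)%:E * (normsq (g p))%:E)%E.
  by rewrite /= normsqM normsq_realc EFinM.
rewrite /normsqL2; under eq_integral do rewrite E.
rewrite ge0_integralZl_EFin ?sqr_ge0//; last 2 first.
- by move=> p _; rewrite lee_fin normsq_ge0.
- exact: cmfun_normsqE.
by rewrite muleA -EFinM mulVf ?mul1e// expf_neq0// gt_eqF.
Qed.

Lemma L2_fourier_dilate c b g : 0 < c -> L2 mu2 g -> L2 mu2 (fourier_dilate c b g).
Proof.
move=> c0 [mg fg]; split; first exact: cmfun_fourier_dilate.
by rewrite normsqL2_fourier_dilate.
Qed.

Lemma fourier_dilateB c b f g :
  fourier_dilate c b (f \- g) = fourier_dilate c b f \- fourier_dilate c b g.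
Proof. by apply/funext => xi; rewrite /fourier_dilate /= !mulrBr. Qed.

Lemma fourierL1_dilate c b f : 0 < c -> cintegrable mu2 f ->
  fourierL1 (c%:C%C \*o (f \o affine c b)) = fourier_dilate c b (fourierL1 f).
Proof.
move=> c0 If; rewrite fourierL1Z; last exact: cintegrable_affine.
apply/funext => xi /=; rewrite fourierL1_affine// mulrA -rmorphM /=.
congr (_%:C%C * _); have : c != 0 by rewrite gt_eqF.
by move=> cN; field.
Qed.

(** Both normalized dilations are isometries, so an approximating sequence for [f] is carried to one
    for its dilate without any loss. *)
Lemma fourier_limit_dilate c b f g : 0 < c -> fourier_limit f g ->
  fourier_limit (c%:C%C \*o (f \o affine c b)) (fourier_dilate c b g).
Proof.
move=> c0 [Lf Lg [F [HF f1 f2]]]; have cN : c != 0 by rewrite gt_eqF.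
split; [by apply: L2Z; exact: L2_affine | exact: L2_fourier_dilate |].
exists (fun n => c%:C%C \*o (F n \o affine c b)); split.
- by move=> n; apply: L1L2Z; exact: L1L2_affine.
- apply: cvg_trans f1; rewrite (_ : (fun n => _) = (fun n => n2 mu2 (F n \- f)))//.
  apply/funext => n; have LB : L2 mu2 (F n \- f) by apply: L2B => //; exact: (HF n).2.
  transitivity (n2 mu2 (c%:C%C \*o ((F n \- f) \o affine c b))).
    by congr (n2 mu2 _); apply/funext => p /=; rewrite mulrBr.
  rewrite n2Z ?n2_affine//; [|by case: LB|exact: L2_affine].
  by rewrite normsq_realc mulrA mulfV ?mul1r// expf_neq0.
- apply: cvg_trans f2.
  rewrite (_ : (fun n => _) = (fun n => n2 mu2 (fourierL1 (F n) \- g)))//.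
  apply/funext => n; rewrite fourierL1_dilate//; last exact: (HF n).1.
  rewrite -fourier_dilateB /n2 normsqL2_fourier_dilate//.
  by apply: cmfunB; [case: (L2_fourierL1 (HF n)) | case: Lg].
Qed.

(** [plancherel_ip] holds along the approximating sequence, and Cauchy-Schwarz shows that both
    errors vanish. *)
Lemma fourier_limit_ip f g h : fourier_limit f g -> L1L2 h ->
  ip mu2 h f = ip mu2 (fourierL1 h) g.
Proof.
move=> [Lf Lg [F [HF f1 f2]]] Hh; have Lh := Hh.2; have LH := L2_fourierL1 Hh.
have LF n := (HF n).2; have LT n := L2_fourierL1 (HF n).
suff : normsq (ip mu2 h f - ip mu2 (fourierL1 h) g) = 0.
  by move=> /normsq_eq0/eqP; rewrite subr_eq0 => /eqP.
apply/eqP; rewrite eq_le normsq_ge0 andbT.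
have ub n : normsq (ip mu2 h f - ip mu2 (fourierL1 h) g) <=
    2 * (n2 mu2 h * n2 mu2 (F n \- f)) + 2 * (n2 mu2 h * n2 mu2 (fourierL1 (F n) \- g)).
  have -> : ip mu2 h f - ip mu2 (fourierL1 h) g =
      (-1) * ip mu2 h (F n \- f) + ip mu2 (fourierL1 h) (fourierL1 (F n) \- g).
    rewrite (ipBr (LF n) Lf Lh) (ipBr (LT n) Lg LH) (plancherel_ip Hh (HF n)).
    by rewrite mulN1r opprB addrA subrK.
  apply: le_trans (normsqD_le _ _) _; rewrite normsqM.
  have -> : normsq (-1 : R[i]) = 1 by rewrite /normsq !ReImE !ReIm_realE; ring.
  rewrite mul1r -{2}(plancherel Hh).
  have b1 := normsq_ip_le Lh (L2B (LF n) Lf).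
  have b2 := normsq_ip_le LH (L2B (LT n) Lg).
  by apply: lerD; rewrite ler_pM2l//.
apply: ler_cvg0 ub.
have cZ (k : R) (u : nat -> R) : u n @[n --> \oo] --> (0 : R) -> k * u n @[n --> \oo] --> (0 : R).
  by move=> hu; rewrite -[X in _ --> X](mulr0 k); apply: cvgM => //; exact: cvg_cst.
by rewrite -[X in _ --> X](addr0 0); apply: cvgD; do 2 apply: (cZ).
Qed.

(** On a bounded square L^2 is contained in L^1: each coordinate is at most the squared modulus plus
    1. *)
Lemma L2_truncate n f : L2 mu2 f -> L1L2 (truncate n f).
Proof.
move=> Lf; have [mf _] := Lf.
have n0 : 0 < n.+1%:R^-1 :> R by rewrite invr_gt0.
(* Makes the box a dilate of a known integrable function. *)
have boxE p : box n p = normsq (trig2 0 (affine n.+1%:R^-1 (0, 0) p)).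
  by rewrite normsq_trig2 /box /= !addr0 ![_^-1 * _]mulrC.
have b01 p : box n p = 0 \/ box n p = 1.
  by rewrite /box /chi !indicE; do 2 case: (_ \in _); rewrite ?mulr0 ?mul0r ?mulr1; [right|left..].
have ibox : mu2.-integrable setT (EFin \o box n).
  have := L2_integrable (L2_affine (0, 0) n0 (L2_trig2 0)).
  by apply: eq_integrable => // p _ /=; rewrite boxE.
split.
  apply: (cintegrable_le (u := fun p => normsq (f p) + box n p)).
  - exact: cmfun_truncate.
  - by apply: integrableD_EFin => //; exact: L2_integrable.
  - move=> p; rewrite /truncate /normsq !ReImE Re_realc Im_realc.
    by case: (b01 p) => ->; rewrite ler_norml; nra.
  - move=> p; rewrite /truncate /normsq !ReImE Re_realc Im_realc.
    by case: (b01 p) => ->; rewrite ler_norml; nra.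
apply: (L2_le (cmfun_truncate n mf) (L2_integrable Lf)) => p.
rewrite normsqM normsq_realc ler_piMl ?normsq_ge0// expr2.
by rewrite mulr_ile1 ?box_ge0 ?box_le1.
Qed.

End FourierL2.

(** * The wavelet system as a Parseval frame *)

Section WaveletFrame.
Context {R : realType}.
Local Notation mu := (@lebesgue_measure R).
Local Notation Rm := (measurableTypeR R).
Local Notation mu2 := (@leb2 R).
Variables (f : Rm * Rm -> R) (psi : Rm * Rm -> R[i]).
Hypothesis mf : measurable_fun setT f.
Hypothesis f_le1 : forall p, f p ^+ 2 <= 1.
Hypothesis f_support : forall p, ~ (unit_itv p.1 /\ unit_itv p.2) -> f p = 0.
Hypothesis f_dyadic : forall p, p != (0, 0) ->
  (\esum_(n in [set: int]) (f (affine (2 ^ (- n)) (0, 0) p) ^+ 2)%:E = 1%:E)%E.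
Hypothesis psi_hat : fourier_limit psi (fun p => (f p)%:C%C).

Local Notation fc := (fun p => (f p)%:C%C).

Lemma affineK (c : R) p : c != 0 -> affine c^-1 (0, 0) (affine c (0, 0) p) = p.
Proof. by move=> c0; case: p => x y; rewrite /affine /= !addr0 !mulKf. Qed.

(** Rescaling by [c] moves the dilation onto [h]; the Jacobian [c ^+ 2] times the normalization
    [c^-1] leaves the factor [c]. As [f] is supported in the unit square, the exponential may be cut
    off to [trig2 k]. *)
Lemma ip_fourier_dilate (h : Rm * Rm -> R[i]) (c : R) (k : int * int) :
  0 < c -> L2 mu2 h ->
  ip mu2 h (fourier_dilate c (- k.1%:~R, - k.2%:~R) fc) =
  ip mu2 (fun p => c%:C%C * (h (affine c (0, 0) p) * (f p)%:C%C)) (trig2 k).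
Proof.
move=> c0 Lh; have cN : c != 0 by rewrite gt_eqF.
have [_ Lf _] := psi_hat.
pose b : R * R := (- k.1%:~R, - k.2%:~R).
have Iv := L2_ip Lh (L2_fourier_dilate b c0 Lf).
rewrite /ip -/b; set v := (fun x => h x * _) in Iv *.
have Ivc := cintegrable_affine (0, 0) c0 Iv.
have -> : cint mu2 v = (c ^+ 2)%:C%C * cint mu2 (v \o affine c (0, 0)).
  by rewrite cint_affine// mulrA -rmorphM /= mulfV ?mul1r// expf_neq0.
rewrite -cintZ//; apply: eq_cint => p.
rewrite -[LHS]/((c ^+ 2)%:C%C * v (affine c (0, 0) p)).
rewrite /v /fourier_dilate affineK//.
have -> : dot b (affine c (0, 0) p) / c = - (k.1%:~R * p.1 + k.2%:~R * p.2).
  by rewrite /dot /affine /b /=; field.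
rewrite -[trig2 k p]/(trig k.1 p.1 * trig k.2 p.2).
have [[u1 u2]|/f_support ->] := pselect (unit_itv p.1 /\ unit_itv p.2); last first.
  have -> : (0 : R)%:C%C = 0 by [].
  by rewrite !mulr0 conjc0 mulr0 mulr0 mul0r.
rewrite /trig (chi_in u1) (chi_in u2) !rmorph1 !mul1r -expiD !conjcM !conj_expi !conjc_real.
have -> : - (2 * pi * - (k.1%:~R * p.1 + k.2%:~R * p.2)) =
  - (- (2 * pi * (k.1%:~R * p.1)) - 2 * pi * (k.2%:~R * p.2)) by ring.
set E := expi _; set H := h _; set F := (f p)%:C%C.
have cc : (c ^+ 2)%:C%C * (c^-1)%:C%C = c%:C%C by rewrite -rmorphM /= expr2 mulfK.
by rewrite -cc; ring.
Qed.

(** The inner products at one scale are the trigonometric coefficients of a single function on the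
    unit square; torus Parseval sums them, and the scaling is then undone. *)
Lemma esum_ip_fourier_dilate (h : Rm * Rm -> R[i]) (c : R) : 0 < c -> L2 mu2 h ->
  (\esum_(k in [set: int * int])
    (normsq (ip mu2 h (fourier_dilate c (- k.1%:~R, - k.2%:~R) fc)))%:E =
  \int[mu2]_p (normsq (h p) * f (affine c^-1 (0, 0) p) ^+ 2)%:E)%E.
Proof.
move=> c0 Lh; have cN : c != 0 by rewrite gt_eqF.
have [mh _] := Lh; have c2 : 0 < c ^+ 2 by rewrite exprn_gt0.
have Lhc := L2_affine (0, 0) c0 Lh; have [mhc _] := Lhc.
under eq_esum do rewrite ip_fourier_dilate//.
pose G p := c%:C%C * (h (affine c (0, 0) p) * (f p)%:C%C).
have GE p : normsq (G p) = c ^+ 2 * (normsq (h (affine c (0, 0) p)) * f p ^+ 2).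
  by rewrite /G !normsqM !normsq_realc.
have LG : L2 mu2 G.
  apply: (L2_le (u := fun p => c ^+ 2 * normsq (h (affine c (0, 0) p)))).
  - by apply: cmfunZ; apply: cmfunM; [exact: mhc | exact: cmfun_realc].
  - by apply: integrableZ_EFin; exact: L2_integrable Lhc.
  - by move=> p; rewrite GE ler_pM2l// ler_piMr ?normsq_ge0.
rewrite -/(G _) torus_parseval//; last first.
  by move=> p /f_support fp; rewrite /G fp rmorph0 !mulr0.
pose W p := normsq (h p) * f (affine c^-1 (0, 0) p) ^+ 2.
have mW : measurable_fun setT W.
  apply: measurable_funM; first exact: cmfun_normsq.
  by apply: measurable_funX; exact: (measurableT_comp mf (measurable_fun_affine c^-1 (0, 0))).
have W0 p : 0 <= W p by rewrite mulr_ge0 ?normsq_ge0 ?sqr_ge0.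
rewrite /normsqL2.
have E p : (normsq (G p))%:E = ((c ^+ 2)%:E * (W (affine c (0, 0) p))%:E)%E.
  by rewrite GE /W affineK// EFinM.
under eq_integral do rewrite E.
have mWE : measurable_fun setT (EFin \o W) by exact/measurable_EFinP.
rewrite ge0_integralZl_EFin ?sqr_ge0//; last 2 first.
- by move=> p _; rewrite lee_fin.
- exact: (measurableT_comp mWE (measurable_fun_affine c (0, 0))).
rewrite (ge0_integral_affine2 (0, 0) c0 (F := fun p => (W p)%:E))//.
by rewrite muleA -EFinM mulfV ?mul1e// expf_neq0.
Qed.

Lemma ge0_esumZ (J : countType) (k : R) (u : J -> R) : 0 <= k -> (forall j, 0 <= u j) ->
  (\esum_(j in [set: J]) (k * u j)%:E = k%:E * \esum_(j in [set: J]) (u j)%:E)%E.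
Proof.
move=> k0 u0; rewrite !esum_countE; [|by move=> j; rewrite lee_fin..|]; last first.
  by move=> j; rewrite lee_fin mulr_ge0.
rewrite -nneseriesZl//.
  by apply: eq_eseriesr => n _; case: pickle_inv => [j|]; rewrite ?EFinM ?mule0.
by move=> n _; case: pickle_inv => // j; rewrite lee_fin.
Qed.

(** The origin is the only point that [f_dyadic] leaves out. *)
Lemma ae_neq0 : {ae mu2, forall p : Rm * Rm, p != (0, 0)}.
Proof.
exists ([set 0] `*` [set 0]); split.
- exact: measurableX.
- transitivity (mu [set 0%R] * mu [set 0%R])%E; first by rewrite /leb2 product_measure1E.
  by rewrite lebesgue_measure_set1 mule0.
- by move=> [x y] /= /negP; rewrite negbK => /eqP[-> ->].
Qed.

Lemma esum_dilations (h : Rm * Rm -> R[i]) : L2 mu2 h ->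
  (\esum_(n in [set: int])
    \int[mu2]_p (normsq (h p) * f (affine (2 ^ n)^-1 (0, 0) p) ^+ 2)%:E =
  normsqL2 mu2 h)%E.
Proof.
move=> [mh _]; rewrite -integral_esum; last 2 first.
- move=> n; apply/measurable_EFinP; apply: measurable_funM; first exact: cmfun_normsq.
  by apply: measurable_funX; exact: (measurableT_comp mf (measurable_fun_affine _ (0, 0))).
- by move=> n p; rewrite lee_fin mulr_ge0 ?normsq_ge0 ?sqr_ge0.
apply: ge0_ae_eq_integral => //.
- apply: measurable_esum => [n|n p]; last by rewrite lee_fin mulr_ge0 ?normsq_ge0 ?sqr_ge0.
  apply/measurable_EFinP; apply: measurable_funM; first exact: cmfun_normsq.
  by apply: measurable_funX; exact: (measurableT_comp mf (measurable_fun_affine _ (0, 0))).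
- exact: cmfun_normsqE.
- by move=> p _; apply: esum_ge0 => n _; rewrite lee_fin mulr_ge0 ?normsq_ge0 ?sqr_ge0.
- by move=> p _; rewrite lee_fin normsq_ge0.
apply: filterS ae_neq0 => p p0 _.
rewrite ge0_esumZ ?normsq_ge0//; last by move=> n; exact: sqr_ge0.
under eq_esum do rewrite invr_expz.
by rewrite f_dyadic// mule1.
Qed.

Lemma wavelet_systemE n k : wavelet_system psi (n, k) =
  (2 ^ n)%:C%C \*o (psi \o affine (2 ^ n) (- k.1%:~R, - k.2%:~R)).
Proof. by []. Qed.

Lemma wavelet_L2 j : L2 mu2 (wavelet_system psi j).
Proof.
case: j => n k; rewrite wavelet_systemE; have [Lpsi _ _] := psi_hat.
by apply: L2Z; apply: L2_affine => //; rewrite exprz_gt0.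
Qed.

Lemma wavelet_parseval h : L1L2 h ->
  (\esum_(j in [set: int * (int * int)]) (normsq (ip mu2 h (wavelet_system psi j)))%:E =
  (n2 mu2 h)%:E)%E.
Proof.
move=> Hh; have LH := L2_fourierL1 Hh.
rewrite esum_pair; last by move=> j; rewrite lee_fin normsq_ge0.
have pow0 n : 0 < 2 ^ n :> R by rewrite exprz_gt0.
transitivity (\esum_(n in [set: int]) \esum_(k in [set: int * int])
    (normsq (ip mu2 (fourierL1 h) (fourier_dilate (2 ^ n) (- k.1%:~R, - k.2%:~R) fc)))%:E)%E.
  apply: eq_esum => n _; apply: eq_esum => k _; rewrite wavelet_systemE.
  by rewrite (fourier_limit_ip (fourier_limit_dilate _ (pow0 n) psi_hat) Hh).
under eq_esum do rewrite esum_ip_fourier_dilate//.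
by rewrite esum_dilations// -n2E// plancherel.
Qed.

(** Truncations make [L1L2] dense in L^2, so [dense_parseval] extends the identity from the
    functions whose transform is an integral. *)
Lemma wavelet_parseval_frame : parseval_frame (wavelet_system psi).
Proof.
split=> [j|h /in_Lp2P Lh]; first by apply/in_Lp2P; exact: wavelet_L2.
rewrite Lpnorm2_sqr -n2E//; under eq_esum do rewrite normsqE.
apply: (dense_parseval wavelet_L2 (D := L1L2)) => //.
- by move=> u [].
- exact: L1L2B.
- exact: wavelet_parseval.
- move=> x x0; have [n hn] := cvg0_exists_lt (n2_truncate Lh) x0.
  by exists (truncate n h) => //; exact: L2_truncate.
Qed.

End WaveletFrame.
(** * The kink of the smoothed indicator *)

Section Kink.
Context {R : realType}.
Local Notation mu := (@lebesgue_measure R).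
Local Notation Rm := (measurableTypeR R).
Local Notation mu2 := (@leb2 R).

(** Continuous functions that differ at a point differ on a square around it, of measure
    [(2 e)^2 > 0]. *)
Lemma ae_eq_continuous (u v : R * R -> R) : continuous u -> continuous v ->
  {ae mu2, forall p : Rm * Rm, u p = v p} -> u = v.
Proof.
move=> cu cv [A [mA A0 sA]]; apply/funext => p; apply/eqP; apply/negPn/negP => uv.
have : \forall q \near p, u q - v q != 0.
  have cw : (u q - v q) @[q --> p] --> u p - v p by apply: cvgB; [exact: cu | exact: cv].
  by apply: cvgr_neq0 cw _; rewrite subr_eq0.
move=> /nbhs_ballP[e /= e0 he].
pose I (x : R) : set R := `]x - e, x + e[%classic.
have sub : I p.1 `*` I p.2 `<=` A.
  move=> q [/= q1 q2]; apply: sA => /= uvq.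
  have : u q - v q != 0.
    apply: he; split; rewrite /ball /= ltr_distlC;
    by [move: q1; rewrite /I /= in_itv | move: q2; rewrite /I /= in_itv].
  by rewrite uvq subrr eqxx.
have mI x : measurable (I x : set Rm) by exact: measurable_itv.
have muI x : mu (I x) = (2 * e)%:E.
  rewrite lebesgue_measure_itv /= lte_fin; case: ifPn => [_|/negP[]]; last by lra.
  by rewrite -EFinD; congr (_%:E); ring.
have : (mu2 (I p.1 `*` I p.2) <= mu2 A)%E.
  by apply: le_measure => //; rewrite inE//; exact: measurableX.
rewrite A0 => h; have : (mu (I p.1) * mu (I p.2) <= 0)%E.
  by rewrite -product_measure1E.
by rewrite !muI -EFinM lee_fin; nra.
Qed.

(** Compares two punctured limits along one-sided rays; the signs of [alpha] and [beta] choose the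
    sides, which isolates the left and right behaviour of a difference quotient. *)
Lemma dnbhs_scaled_unique (F G : R -> R) (L M alpha beta r : R) :
  F x @[x --> 0^'] --> L -> G x @[x --> 0^'] --> M ->
  alpha != 0 -> beta != 0 -> 0 < r ->
  (forall h, 0 < h < r -> F (alpha * h) = G (beta * h)) -> L = M.
Proof.
move=> /cvgrPdist_lt hF /cvgrPdist_lt hG al be r0 FG.
apply/eqP; rewrite -subr_eq0 -normr_eq0; apply/negPn/negP => LM.
have e0 : 0 < `|L - M| / 2 by rewrite divr_gt0// lt_neqAle eq_sym LM normr_ge0.
have [d1 /= d10 h1] := (nbhs_ballP _ _).1 (hF _ e0).
have [d2 /= d20 h2] := (nbhs_ballP _ _).1 (hG _ e0).
have al0 : 0 < `|alpha| by rewrite normr_gt0.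
have be0 : 0 < `|beta| by rewrite normr_gt0.
(* Half of the smallest admissible radius, to make all three inequalities strict. *)
pose h := Num.min r (Num.min (d1 / `|alpha|) (d2 / `|beta|)) / 2.
have m0 : 0 < Num.min r (Num.min (d1 / `|alpha|) (d2 / `|beta|)).
  by rewrite !lt_min r0 !divr_gt0.
have hh : h < Num.min r (Num.min (d1 / `|alpha|) (d2 / `|beta|)).
  by rewrite /h; lra.
have h0 : 0 < h by rewrite divr_gt0.
move: hh; rewrite !lt_min => /and3P[hr].
rewrite !ltr_pdivlMr// => hd1 hd2.
have k1 : `|L - F (alpha * h)| < `|L - M| / 2.
  apply: (h1 (alpha * h)); last by rewrite mulf_neq0 ?(gt_eqF h0).
  by rewrite /ball /= sub0r normrN normrM (gtr0_norm h0) mulrC.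
have k2 : `|M - G (beta * h)| < `|L - M| / 2.
  apply: (h2 (beta * h)); last by rewrite mulf_neq0 ?(gt_eqF h0).
  by rewrite /ball /= sub0r normrN normrM (gtr0_norm h0) mulrC.
have := ler_distD (F (alpha * h)) L M.
rewrite {2}FG ?h0//= (distrC (G _)) => /(le_lt_trans)/(_ (ltrD k1 k2)).
by rewrite -splitr ltxx.
Qed.

Variables (theta : R -> R) (a delta : R).
Hypothesis theta_lo : forall x : R, x <= -1 -> theta x = 0.
Hypothesis theta_hi : forall x : R, 1 <= x -> theta x = 1.
Hypotheses (a_gt0 : 0 < a) (delta_gt0 : 0 < delta) (delta_lt : delta < a / 2).
Hypothesis theta_derivable : forall x, derivable theta x 1.

(* The ray leaves the plateau at [x = 2 a - delta] while [y] is in the transition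
   zone: [f_La] is constant to the left and a rescaled [theta] to the right. *)
Lemma f_La_kink t h : -1 < t < 1 -> `|h| < a ->
  f_La theta a delta (2 * a - delta + h, 2 * a - delta * t) =
  theta (t - Num.max h 0 / delta).
Proof.
have a0 := a_gt0; have d0 := delta_gt0; have da := delta_lt.
move=> /andP[t1 t2]; rewrite ltr_norml => /andP[h1 h2].
have y1 : 2 * a - delta < 2 * a - delta * t by nra.
rewrite f_LaE// /outer_cutoff /inner_cutoff /= (ger0_norm (_ : 0 <= 2 * a - delta + h)); last by lra.
rewrite (ger0_norm (_ : 0 <= 2 * a - delta * t)); last by lra.
rewrite theta_inner_hi//.
  rewrite mulr1 /outer_arg (max_l (ltW y1)); congr theta.
  have dN : delta != 0 by rewrite gt_eqF.
  have [hh|hh] := leP h 0.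
    by rewrite max_r ?(max_r hh); [field | lra].
  by rewrite max_l ?(max_l (ltW hh)); [field | lra].
have m1 : 2 * (2 * a - delta + h) <= Num.max (2 * (2 * a - delta + h)) (2 * a - delta).
  by rewrite le_max lexx.
have m2 : 2 * (2 * a - delta * t) <= Num.max (2 * (2 * a - delta * t)) (2 * a - delta).
  by rewrite le_max lexx.
lra.
Qed.

(** At [x = 2 a - delta] the left difference quotients are 0 and the right ones tend to
    [- theta'(t) / delta]. Differentiability would kill theta' on the whole of ]-1, 1[, although
    theta climbs from 0 to 1 there. *)
Lemma f_La_not_differentiable : ~ (forall p, differentiable (f_La theta a delta) p).
Proof.
have a0 := a_gt0; have d0 := delta_gt0; have da := delta_lt.
have dN : delta != 0 by rewrite gt_eqF.
move=> df.
have theta'0 (t : R) : -1 < t < 1 -> 'D_1 theta t = 0.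
  move=> tb; pose p : R * R := (2 * a - delta, 2 * a - delta * t).
  have hF : h^-1 *: (f_La theta a delta (h *: (1, 0) + p) - f_La theta a delta p)
      @[h --> 0^'] --> 'D_(1, 0) (f_La theta a delta) p.
    exact: (diff_derivable (df p)).
  have hG : h^-1 *: (theta (h *: 1 + t) - theta t) @[h --> 0^'] --> 'D_1 theta t.
    exact: theta_derivable.
  have E h : `|h| < a -> f_La theta a delta (h *: (1, 0) + p) - f_La theta a delta p =
      theta (t - Num.max h 0 / delta) - theta t.
    move=> ha; congr (_ - _); last first.
      rewrite -[p in LHS]/(2 * a - delta, _) -{1}[2 * a - delta]addr0 f_La_kink//.
        by rewrite maxxx mul0r subr0.
      by rewrite normr0.
    rewrite -f_La_kink//; congr (f_La _ _ _ (_, _)).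
      by rewrite /= [_ *: _]mulr1 addrC.
    by rewrite /= [_ *: _]mulr0 add0r.
  have L0 : 'D_(1, 0) (f_La theta a delta) p = 0.
    (* Approach from the left, along the plateau in [x]. *)
    apply: (dnbhs_scaled_unique (alpha := -1) (beta := 1) hF (cvg_cst 0) _ _ a0).
    - by rewrite oppr_eq0 oner_eq0.
    - by rewrite oner_eq0.
    - move=> h /andP[h0 ha]; rewrite mulN1r E ?normrN ?gtr0_norm//.
      by rewrite max_r ?oppr_le0 ?ltW// mul0r subr0 subrr scaler0.
  rewrite L0 in hF.
  have hF' : - delta * (h^-1 *: (f_La theta a delta (h *: (1, 0) + p) - f_La theta a delta p))
      @[h --> 0^'] --> (0 : R).
    by have := cvgM (cvg_cst (- delta)) hF; rewrite mulr0; exact.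
  have r0 : 0 < a / delta by rewrite divr_gt0.
  (* Approach from the right: the step [delta * h] in [x] moves the argument of theta by [- h], and
     the factor [- delta] turns the quotient into that of theta at [- h]. *)
  rewrite (dnbhs_scaled_unique (alpha := delta) (beta := -1) hF' hG dN _ r0)//.
  move=> h /andP[h0]; rewrite ltr_pdivlMr// mulrC => ha.
  have dh0 : 0 < delta * h by rewrite mulr_gt0.
  rewrite E ?gtr0_norm// max_l ?(ltW dh0)//.
  have -> : t - delta * h / delta = -1 * h *: 1 + t.
    rewrite [_ *: _]mulr1; field; exact: dN.
  rewrite -![_ *: (theta _ - _)]/(_ * _); have hN : h != 0 by rewrite gt_eqF.
  by field; rewrite hN dN.
(* The mean value theorem would give [theta 1 - theta (-1) = 0]. *)
have [] := @MVT _ theta (fun t => 'D_1 theta t) (-1) 1.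
- lra.
- by move=> x _; exact/derivableP.
- apply: continuous_subspaceT => x; apply: differentiable_continuous.
  exact/derivable1_diffP.
move=> c; rewrite in_itv /= => /theta'0 ->.
rewrite (theta_lo (lexx _)) (theta_hi (lexx _)); lra.
Qed.

End Kink.

(** * Conclusion: regularity of the transform and the frame property *)

Lemma fourier_limit_Cc1 (R : realType) (psi : R * R -> R[i]) (f : R * R -> R)
    (g : R * R -> R[i]) :
  continuous f -> fourier_limit psi (fun p => (f p)%:C%C) -> fourier_limit psi g ->
  in_Cc1 g -> forall p, differentiable f p.
Proof.
move=> cf psif psig [[dRe _] _ _].
suff -> : f = fun p => complex.Re (g p) by [].
apply: ae_eq_continuous => //.
  by move=> p; apply: differentiable_continuous.
by apply: filterS (fourier_limit_unique psif psig) => p /(congr1 (@complex.Re R)).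
Qed.

Theorem proposition17 (R : realType) (theta : R -> R)
  (theta_smooth : smooth theta)
  (theta_lo : forall x : R, x <= -1 -> theta x = 0)
  (theta_hi : forall x : R, 1 <= x -> theta x = 1)
  (theta_sq : forall x : R, theta x ^+ 2 + theta (- x) ^+ 2 = 1)
  (a delta : R) (a_gt0 : 0 < a) (a_lt : a < 1 / 4)
  (delta_gt0 : 0 < delta) (delta_lt : delta < 1 / 2 * Num.min (1 - 4 * a) a)
  (psi : R * R -> R[i])
  (psiE : fourierL2 psi (fun p => (f_La theta a delta p)%:C%C)) :
  [/\ in_Cc (fun p => (f_La theta a delta p)%:C%C),
      (forall g : R * R -> R[i], fourierL2 psi g -> ~ in_Cc1 g)
    & parseval_frame (wavelet_system psi)].
Proof.
(* The two halves of the minimum: [d1] governs the geometry of the annulus, [d2] puts its smoothed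
   version inside the unit square. *)
have [d1 d2] : delta < a / 2 /\ 2 * a + delta < 1 / 2.
  by move: delta_lt; have [h|h] := leP (1 - 4 * a) a; split; lra.
have dtheta : forall x, derivable theta x 1 := theta_smooth 0.
have ctheta : continuous theta.
  by move=> x; apply: differentiable_continuous; exact/derivable1_diffP.
have cf : continuous (f_La theta a delta) by exact: continuous_f_La.
have psiF := fourierL2_limit psiE.
split.
- split => //; first by move=> p; exact: cvg_cst.
  exact: compact_support_f_La.
- move=> g /fourierL2_limit psig /(fourier_limit_Cc1 cf psiF psig).
  exact: f_La_not_differentiable.
- have [_ [[mf _] _] _] := psiF.
  apply: (wavelet_parseval_frame mf) => //.
  (* The square of [f_La] is at most that of the outer cutoff, which the identity for theta bounds
     by 1. *)
  + move=> p; rewrite f_La_sqr//; apply: (@le_trans _ _ (outer_cutoff theta a delta p ^+ 2)).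
      by rewrite lerBlDr lerDl sqr_ge0.
    by rewrite -(theta_sq (outer_arg a delta `|p.1| `|p.2|)) lerDl sqr_ge0.
  + move=> p; apply: contra_notP => /eqP /f_La_support[]// h1 h2.
    by rewrite /unit_itv /= !in_itv /= -!ltr_norml; split; lra.
  + move=> p p0; under eq_esum do rewrite /affine !addr0.
    exact: f_La_dyadic_sum.
Qed.
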